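(* Let $(r_k)_{k\ge0}$ be a real sequence and let $g_0\in C^\infty((0,\infty))$ be a real-valued function such that, for all integers $k\ge0$ and some $\alpha>0$, $$\lim_{x\to0}x^{k-\alpha}g_0^{(k)}(x)=\lim_{x\to\infty}x^{k+1+\alpha}g_0^{(k)}(x)=0.$$ Define functions $g_k$, $k\ge1$, by the induction $g_{k+1}(x)=-x g_k'(x)-r_k g_k(x)$ for $k\ge0$. Then, for every $k\ge0$, the Mellin transform $\widehat{g_k^\times}(s)$ is well defined for $0<\mathrm{Re}(s)<1$, and $$\widehat{g_k^\times}(s)=-\left(\prod_{j=0}^{k-1}(s-r_j)\right)\frac{\zeta(s)}{s}\,\widehat{g_0}(s),\qquad 0<\mathrm{Re}(s)<1$$ (with the empty product equal to $1$ for $k=0$). Moreover, if $\widehat{g_0}\left(\frac12+it\right)\ll e^{-\delta|t|}$ for $t\in\mathbb{R}$, for some $\delta>0$, then $(g_k)_{k\ge0}$ verifies gNB, that is: there exist real coefficients $(c_{k,n})_{0\le k\le n,\ n\ge 0}$ such that $$\int_0^\infty\left|\chi(t)-\sum_{k=0}^n c_{k,n}\,g_k^\times(t)\right|^2dt\longrightarrow0\quad\text{as } n\to\infty.$$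
   Context: $\{y\}$ denotes the fractional part of a real number $y$, $\chi$ the indicator function of $(0,1)$ on $(0,\infty)$, and $\zeta$ the Riemann zeta function. For $g:(0,\infty)\to\mathbb{R}$ with $\int_0^\infty|g(x)|\,dx<\infty$ and $\int_0^\infty|g(x)|\frac{dx}{x}<\infty$ (which holds for all $g_k$ in the statement), define for $t>0$ $$g^\times(t)=\int_0^\infty\left\{\frac{x}{t}\right\}g(x)\,\frac{dx}{x},$$ and write $g_k^\times=(g_k)^\times$. The Mellin transform of a function $f$ is $\widehat{f}(s)=\int_0^\infty f(x)x^{s-1}\,dx$; ''well defined'' means that this integral converges absolutely. The notation $F(t)\ll G(t)$ means $|F(t)|\le C\,G(t)$ for some constant $C$ independent of $t$.
   Formalization: In the ''Moreover'' part, g_0 is additionally assumed not identically zero on (0,∞); for g_0 = 0 all hypotheses hold but every g_k^× vanishes and the integral equals 1 for all n, so gNB fails. *)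

(* Defs.v *)
From HB Require Import structures.
From mathcomp Require Import all_boot all_order all_algebra.
From mathcomp Require Import complex.
From mathcomp Require Import all_classical all_reals all_analysis.

Set Implicit Arguments.
Unset Strict Implicit.
Unset Printing Implicit Defensive.

Import Order.TTheory GRing.Theory Num.Theory.
Import numFieldNormedType.Exports ComplexField.Normc.

Local Open Scope classical_set_scope.
Local Open Scope ring_scope.

Section Definitions.
Context {R : realType}.
Local Notation mu := (@lebesgue_measure R).

(* x ^ s for a positive real x and a complex s; not used for x <= 0. *)
Definition cpow (x : R) (s : R[i]) : R[i] :=
  Complex (x `^ complex.Re s * cos (complex.Im s * ln x))
          (x `^ complex.Re s * sin (complex.Im s * ln x)).

Definition cintegrable (D : set R) (F : R -> R[i]) : Prop :=
  [/\ measurable_fun D (fun x => complex.Re (F x)),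
      measurable_fun D (fun x => complex.Im (F x)) &
      (\int[mu]_(x in D) (normc (F x))%:E < +oo)%E].

Definition cintegral (D : set R) (F : R -> R[i]) : R[i] :=
  Complex (\int[mu]_(x in D) complex.Re (F x))
          (\int[mu]_(x in D) complex.Im (F x)).

Definition mellin_integrand (f : R -> R) (s : R[i]) (x : R) : R[i] :=
  real_complex R (f x) * cpow x (s - 1).

Definition mellin_defined (f : R -> R) (s : R[i]) : Prop :=
  cintegrable `]0, +oo[ (mellin_integrand f s).

Definition mellin (f : R -> R) (s : R[i]) : R[i] :=
  cintegral `]0, +oo[ (mellin_integrand f s).

Definition cseries_to (u : nat -> R[i]) (l : R[i]) : Prop :=
  (fun N => normc (\sum_(n < N) u n - l)) @ \oo --> (0 : R).

Definition analytic_at (F : R[i] -> R[i]) (s0 : R[i]) : Prop :=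
  exists (a : nat -> R[i]) (rho : R), 0 < rho /\
    forall s, normc (s - s0) < rho ->
      cseries_to (fun n => a n * (s - s0) ^+ n) (F s).

(* Z is, on the half-plane Re s > 0 deprived of 1, the analytic continuation
   of the Dirichlet series. This domain being connected, Z is uniquely
   determined there; its values elsewhere are unconstrained. *)
Definition is_zeta (Z : R[i] -> R[i]) : Prop :=
  (forall s, 1 < complex.Re s -> cseries_to (fun n => cpow n.+1%:R (- s)) (Z s))
  /\ (forall s, 0 < complex.Re s -> s != 1 -> analytic_at Z s).

(* The Riemann zeta function on Re s > 0, s != 1; unspecified elsewhere. *)
Definition zeta : R[i] -> R[i] := xget (fun=> 0) is_zeta.

Definition frac_part (y : R) : R := y - (Num.floor y)%:~R.

Definition cross (g : R -> R) (t : R) : R :=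
  \int[mu]_(x in `]0, +oo[) (frac_part (x / t) * g x / x).

Definition smooth_pos (g : R -> R) : Prop :=
  forall (k : nat) (x : R), 0 < x -> derivable (derive1n k g) x 1.

Fixpoint gseq (r : nat -> R) (g0 : R -> R) (k : nat) : R -> R :=
  if k is j.+1 then
    fun x => - x * derive1 (gseq r g0 j) x - r j * gseq r g0 j x
  else g0.

Definition gNB (g : nat -> R -> R) : Prop :=
  exists c : nat -> nat -> R,
    (fun n => \int[mu]_(t in `]0%R, +oo[)
       ((`| \1_`]0%R, 1%R[ t - \sum_(k < n.+1) c k n * cross (g k) t | ^+ 2)
          %:E))%E @ \oo --> 0%E.

End Definitions.

(* Main.v *)
Require Import Defs.
From HB Require Import structures.
From mathcomp Require Import all_boot all_order all_algebra.
From mathcomp Require Import complex.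
From mathcomp Require Import all_classical all_reals all_analysis.
From mathcomp Require Import measurable_realfun ring lra.

Set Implicit Arguments.
Unset Strict Implicit.
Unset Printing Implicit Defensive.

Import Order.TTheory GRing.Theory Num.Theory.
Import numFieldNormedType.Exports ComplexField.Normc.

Local Open Scope classical_set_scope.
Local Open Scope ring_scope.

(** Put x = exp u, and write G_k for g_k in the variable u and L for the
    two-sided Laplace transform, L h (s) = int h(u) exp (s u) du. The Mellin
    transform of f is then L applied to u |-> f (exp u), and the operation
    g |-> g^x becomes convolution with the kernel u |-> {exp (- u)}
    ([cross_expR]).

    The Mellin transforms. Convolutions are mapped by L to products
    ([laplace_fracconv]), and L of the kernel is - zeta(s)/s in the critical
    strip ([laplace_fracker_zeta]): the part of the kernel on u > 0 is
    exp (- u), and Abel summation identifies the transform of the other part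
    with the Dirichlet series when Re s > 1, whence the identity wherever both
    sides are analytic. The recursion defining g_(k+1) is
    G_(k+1) = - G_k' - r_k G_k, which L turns into multiplication by s - r_k
    ([laplace_glog]); the boundary terms vanish because the growth conditions
    make every G_k at most C min (exp (alpha u), exp (- (1 + alpha) u))
    ([tame_glog]).

    The approximation. Let F = L {exp (- u)} * L G_0 and let s = 1/2 + i t.
    The function exp (u/2) (1_(u < 0) - sum c_k g_k^x (exp u)) has Fourier
    transform 1/s - Q(s) F(s), with Q = sum c_k prod_(j < k) (X - r_j); by
    expansion in Newton's basis Q ranges over all the real polynomials
    ([newton_expansion]). The Plancherel inequality, bounding the norm of this
    function by that of its transform ([plancherel_le]), reduces the claim to
    the approximation of 1/s by functions Q(s) F(s) in L^2 of the critical
    line ([inverse_approx]). This rests on two facts.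

    - F is nonzero almost everywhere on the line. Otherwise its zeros would
      accumulate at some t != 0, hence those of zeta or of L G_0 would. In the
      first case zeta would vanish identically, by the identity theorem along
      a segment ending at 2; in the second case L G_0 would vanish on the
      line and G_0 would be 0 ([laplace_line_inj]).
    - As F decays like exp (- delta |t|), it suffices to approximate 1/(s F) by
      real polynomials in s for the weight exp (- 2 delta |t|). Regularized as
      conj F / (s (|F|^2 + eta)), this quotient is bounded and continuous, and
      such functions are limits of polynomials in t for an exponential weight
      ([multiplier_continuous]); the symmetry F(- t) = conj F(t) allows
      polynomials in t with even real part and odd imaginary part, which are
      exactly the real polynomials in s ([ceval_parity]).

    Density of polynomials for an exponential weight is obtained without
    duality: Taylor expansion puts cos (u t) and sin (u t) in the closure for
    small u, then for all u; the bounded functions that multiply the closure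
    into itself form an algebra stable under bounded pointwise limits, so they
    contain sign (sin (t/n)), the sign function, the step functions, and the
    bounded continuous functions. *)

Local Notation Re := complex.Re.
Local Notation Im := complex.Im.
Local Notation toC := (real_complex _).

(** * Integrals over the real line *)

Section Toolkit.
Context {R : realType}.
Local Notation mu := (@lebesgue_measure R).
Implicit Types f g : R -> R.

Definition L1 f := mu.-integrable setT (EFin \o f).
Definition Int f : R := \int[mu]_x f x.

Lemma L1_measurable f : L1 f -> measurable_fun setT f.
Proof. by move/measurable_int/measurable_EFinP. Qed.

Lemma L1_le f g : measurable_fun setT f -> (forall x, `|f x| <= g x) ->
  L1 g -> L1 f.
Proof.
move=> mf fg; apply: le_integrable => //; first exact/measurable_EFinP.
by move=> x _ /=; rewrite lee_fin (le_trans (fg x))// ler_norm.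
Qed.

Lemma L1_lty f : measurable_fun setT f ->
  (\int[mu]_x (`|f x|)%:E < +oo)%E -> L1 f.
Proof. by move=> mf fi; apply/integrableP; split=> //; exact/measurable_EFinP. Qed.

Lemma lty_L1 f : L1 f -> (\int[mu]_x (`|f x|)%:E < +oo)%E.
Proof. by case/integrableP. Qed.

Lemma eq_L1 f g : f =1 g -> L1 f -> L1 g.
Proof. by move=> /funext ->. Qed.

Lemma L1D f g : L1 f -> L1 g -> L1 (fun x => f x + g x).
Proof. by move=> ? ?; rewrite /L1 [_ \o _](_ : _ = (EFin \o f) \+ (EFin \o g))%E//; exact: integrableD. Qed.

Lemma L1B f g : L1 f -> L1 g -> L1 (fun x => f x - g x).
Proof. by move=> ? ?; rewrite /L1 [_ \o _](_ : _ = (EFin \o f) \- (EFin \o g))%E//; exact: integrableB. Qed.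

Lemma L1Z (c : R) f : L1 f -> L1 (fun x => c * f x).
Proof. by move=> ?; rewrite /L1 [_ \o _](_ : _ = (fun x => c%:E * (EFin \o f) x))%E//; exact: integrableZl. Qed.

Lemma L1_0 : L1 (fun _ => 0).
Proof. exact: integrable0. Qed.

Lemma L1_norm f : L1 f -> L1 (fun x => `|f x|).
Proof. exact: integrable_norm. Qed.

Lemma L1_mul_bounded f g (M : R) : L1 f -> measurable_fun setT g ->
  (forall x, `|g x| <= M) -> L1 (fun x => f x * g x).
Proof.
move=> fi mg gM; apply: (@L1_le _ (fun x => M * `|f x|)).
- by apply: measurable_funM => //; exact: L1_measurable.
- by move=> x; rewrite normrM mulrC ler_wpM2r.
- by apply: L1Z; exact: L1_norm.
Qed.

Lemma eq_Int f g : f =1 g -> Int f = Int g.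
Proof. by move=> /funext ->. Qed.

Lemma IntD f g : L1 f -> L1 g -> Int (fun x => f x + g x) = Int f + Int g.
Proof. by move=> ? ?; exact: RintegralD. Qed.

Lemma IntB f g : L1 f -> L1 g -> Int (fun x => f x - g x) = Int f - Int g.
Proof. by move=> ? ?; exact: RintegralB. Qed.

Lemma IntZ (c : R) f : L1 f -> Int (fun x => c * f x) = c * Int f.
Proof. by move=> ?; exact: RintegralZl. Qed.

Lemma IntN f : L1 f -> Int (fun x => - f x) = - Int f.
Proof. by move=> fi; rewrite -mulN1r -IntZ//; apply: eq_Int => x; rewrite mulN1r. Qed.

Lemma Int0 : Int (fun _ => 0) = 0.
Proof. by rewrite /Int /Rintegral integral0. Qed.

Lemma le_Int f g : L1 f -> L1 g -> (forall x, f x <= g x) -> Int f <= Int g.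
Proof. by move=> ? ? fg; apply: le_Rintegral. Qed.

Lemma Int_ge0 f : (forall x, 0 <= f x) -> 0 <= Int f.
Proof. by move=> f0; apply: Rintegral_ge0. Qed.

Lemma le_norm_Int f : L1 f -> `|Int f| <= Int (fun x => `|f x|).
Proof. by move=> fi; exact: le_normr_Rintegral. Qed.

Lemma EFin_Int f : L1 f -> (Int f)%:E = (\int[mu]_x (f x)%:E)%E.
Proof.
move=> fi; rewrite /Int /Rintegral fineK//.
exact: (integrable_fin_num measurableT fi).
Qed.

Lemma dominated_cvg (f_ : nat -> R -> R) f g :
  (forall n, measurable_fun setT (f_ n)) -> measurable_fun setT f -> L1 g ->
  {ae mu, forall x, f_ ^~ x @ \oo --> f x} ->
  (forall n x, `|f_ n x| <= g x) ->
  L1 f /\ (fun n => Int (f_ n)) @ \oo --> Int f.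
Proof.
move=> mf_ mf gi f_f f_g.
have [] := @dominated_convergence _ _ _ mu setT measurableT
  (fun n => EFin \o f_ n) (EFin \o f) (EFin \o g).
- by move=> n /=; apply/measurable_EFinP; exact: mf_.
- exact/measurable_EFinP.
- have [N [mN N0 sN]] := f_f; exists N; split=> // x /= nx; apply: sN => /= fx.
  by apply: nx => _; apply: cvg_EFin; [exact: nearW | exact: fx].
- exact: gi.
- by apply: aeW => x n _ /=; rewrite lee_fin.
move=> fi _ h; split=> //.
have -> : (fun n => Int (f_ n)) = fine \o (fun n => \int[mu]_x (EFin \o f_ n) x)%E by [].
apply: fine_cvg; rewrite /Int /Rintegral fineK//.
exact: (integrable_fin_num measurableT fi).
Qed.

(** With every section integrable, not almost every one, the iterated integrals
    are real-valued functions defined everywhere. *)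
Lemma fubini (F : R * R -> R) : measurable_fun setT F ->
  (forall x, L1 (fun y => F (x, y))) -> (forall y, L1 (fun x => F (x, y))) ->
  (\int[mu]_x \int[mu]_y (`|F (x, y)|)%:E < +oo)%E ->
  [/\ L1 (fun x => Int (fun y => F (x, y))),
      L1 (fun y => Int (fun x => F (x, y))) &
      Int (fun x => Int (fun y => F (x, y))) =
      Int (fun y => Int (fun x => F (x, y)))].
Proof.
move=> mF Fx Fy Foo.
have mF' : measurable_fun setT (EFin \o F) by exact/measurable_EFinP.
have Fi : (mu \x mu)%E.-integrable setT (EFin \o F) by apply/integrable12ltyP.
have E1 x : (\int[mu]_y (EFin \o F) (x, y))%E = (Int (fun y => F (x, y)))%:E.
  by rewrite EFin_Int.
have E2 y : (\int[mu]_x (EFin \o F) (x, y))%E = (Int (fun x => F (x, y)))%:E.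
  by rewrite EFin_Int.
split.
- have := integrable_fubini_F Fi; rewrite /fubini_F.
  by under eq_fun do rewrite E1.
- have mFs : measurable_fun setT (EFin \o (F \o (fun z => (z.2, z.1)))).
    by apply/measurable_EFinP; apply: measurableT_comp => //; exact: measurable_fun_pair.
  have /integrable_fubini_F : (mu \x mu)%E.-integrable setT (EFin \o (F \o (fun z => (z.2, z.1)))).
    apply/integrable12ltyP => //=.
    have := @fubini_tonelli _ _ _ _ _ mu mu (fun z => (`|F z|)%:E).
    move=> /= <- //.
    by apply/measurable_EFinP; apply: measurableT_comp.
  by rewrite /fubini_F; under eq_fun do rewrite E2.
- have := Fubini Fi.
  under eq_integral do rewrite E1.
  under [RHS]eq_integral do rewrite E2.
  by rewrite /Int /Rintegral => ->.
Qed.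

(** * Affine and exponential substitutions *)

(** The image of a times the measure under x |-> a x + b agrees with the measure
    on half-open intervals, hence everywhere. *)
Lemma ge0_integral_affine (f : R -> \bar R) (a b : R) : 0 < a ->
  measurable_fun setT f -> (forall x, 0 <= f x)%E ->
  (\int[mu]_x f x = a%:E * \int[mu]_x f (a * x + b)%R)%E.
Proof.
move=> a0 mf f0.
pose phi : R -> measurableTypeR R := fun x => a * x + b.
have mphi : measurable_fun setT phi.
  by apply: measurable_funD => //; exact: measurable_funM.
pose nu := mscale (NngNum (ltW a0)) (pushforward mu phi).
have nuE A : measurable A -> mu A = nu mphi A.
  apply: lebesgue_measure_unique => _ [[c d]] _ <-.
  rewrite /nu /= /mscale/= /pushforward.
  have -> : phi @^-1` `]c, d] = `](c - b) / a, (d - b) / a]%classic.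
    apply/seteqP; split=> x /=; rewrite !in_itv/= /phi ltr_pdivrMr// ler_pdivlMr//.
      by rewrite ltrBlDr lerBrDr mulrC.
    by rewrite ltrBlDr lerBrDr mulrC.
  rewrite !lebesgue_measure_itv/= !lte_fin ltr_pM2r ?invr_gt0// ltrD2r.
  case: ifP => _; last by rewrite mule0.
  by rewrite -EFinB -EFinM; congr EFin; field; rewrite gt_eqF.
transitivity (\int[nu mphi]_x f x)%E.
  by apply: eq_measure_integral => A mA _; exact: nuE.
rewrite ge0_integral_mscale//=; congr (_ * _)%E.
by rewrite ge0_integral_pushforward.
Qed.

Lemma ge0_integralN (f : R -> \bar R) : measurable_fun setT f ->
  (forall x, 0 <= f x)%E -> (\int[mu]_x f x = \int[mu]_x f (- x)%R)%E.
Proof.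
move=> mf f0.
transitivity (\int[pushforward mu (-%R : R -> measurableTypeR R)]_x f x)%E.
  by apply: eq_measure_integral => A mA _; apply/esym/lebesgue_measureN.
by rewrite ge0_integral_pushforward.
Qed.

Lemma measurable_affine (a b : R) : measurable_fun setT (fun x : R => a * x + b).
Proof. by apply: measurable_funD => //; exact: measurable_funM. Qed.

Lemma Int_affine f (a b : R) : 0 < a -> L1 f ->
  L1 (fun x => f (a * x + b)) /\ Int f = a * Int (fun x => f (a * x + b)).
Proof.
move=> a0 fi; have mf := L1_measurable fi.
have mfa : measurable_fun setT (fun x => f (a * x + b)).
  by apply: measurableT_comp => //; exact: measurable_affine.
have fia : L1 (fun x => f (a * x + b)).
  apply: L1_lty => //; have := lty_L1 fi.
  rewrite (@ge0_integral_affine _ a b)//; last first.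
    by apply/measurable_EFinP; exact: measurableT_comp.
  move=> h; rewrite ltNge; apply/negP; rewrite leye_eq => /eqP E; move: h.
  by rewrite E gt0_muley// lte_fin.
split=> //; apply: EFin_inj; rewrite EFinM !EFin_Int//.
rewrite [LHS]integralE [X in (_ = _ * X)%E]integralE.
rewrite (@ge0_integral_affine (fun x => (EFin \o f)^\+ x)%E a b)//; last first.
  by apply: measurable_funepos; exact/measurable_EFinP.
rewrite (@ge0_integral_affine (fun x => (EFin \o f)^\- x)%E a b)//; last first.
  by apply: measurable_funeneg; exact/measurable_EFinP.
have Ep : (fun x : R => ((EFin \o f)^\+)%E (a * x + b)%R) =
    ((EFin \o (fun x => f (a * x + b)%R))^\+)%E.
  by apply/funext => x; rewrite !funeposE.
have Em : (fun x : R => ((EFin \o f)^\-)%E (a * x + b)%R) =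
    ((EFin \o (fun x => f (a * x + b)%R))^\-)%E.
  by apply/funext => x; rewrite !funenegE.
rewrite Ep Em -muleBr//; apply: fin_num_adde_defr.
exact: (integrable_pos_fin_num measurableT fia).
Qed.

Lemma Int_neg f : L1 f -> L1 (fun x => f (- x)) /\ Int f = Int (fun x => f (- x)).
Proof.
move=> fi; have mf := L1_measurable fi.
have mfa : measurable_fun setT (fun x : R => f (- x)) by exact: measurableT_comp.
split.
  apply: L1_lty => //; have := lty_L1 fi.
  by rewrite ge0_integralN//; apply/measurable_EFinP; exact: measurableT_comp.
rewrite /Int /Rintegral [in LHS]integralE [in RHS]integralE.
rewrite (@ge0_integralN (fun x => (EFin \o f)^\+ x)%E)//; last first.
  by apply: measurable_funepos; exact/measurable_EFinP.
rewrite (@ge0_integralN (fun x => (EFin \o f)^\- x)%E)//; last first.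
  by apply: measurable_funeneg; exact/measurable_EFinP.
by congr (fine (_ - _))%E; apply: eq_integral => x _; rewrite ?funeposE ?funenegE.
Qed.

(** The normalization used in [ge0_integral_expR]. *)
Lemma integral_inv_e : (\int[mu]_x (\1_`[expR (-1), 1] x * x^-1)%:E = 1)%E.
Proof.
have e1 : expR (-1) < 1 :> R by rewrite -[ltRHS]expR0 ltr_expR; lra.
transitivity (\int[mu]_(x in `[expR (-1), 1%R]) (x^-1)%:E)%E.
  rewrite [RHS]integral_mkcond; apply: eq_integral => x _.
  by rewrite patchE indicE; case: ifPn => _; rewrite ?mul1r ?mul0r.
have p x : expR (-1) <= x -> 0 < x :> R by apply: lt_le_trans; exact: expR_gt0.
rewrite (@continuous_FTC2 _ (fun x => x^-1) (@ln R))//.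
- by rewrite ln1 expRK sub0e -EFinN opprK.
- apply: continuous_in_subspaceT => x; rewrite inE/= in_itv/= => /andP[/p x0 _].
  by apply: inv_continuous; rewrite gt_eqF.
- split.
  + by move=> x; rewrite in_itv/= => /andP[/ltW/p x0 _]; exact/ex_derive/is_derive1_ln.
  + by apply: cvg_at_right_filter; apply: continuous_ln; exact: expR_gt0.
  + by apply: cvg_at_left_filter; apply: continuous_ln.
- move=> x; rewrite in_itv/= => /andP[/ltW/p x0 _].
  by rewrite derive1E; apply/derive_val/is_derive1_ln.
Qed.

(** Insert the factor 1, as the integral over u of the indicator of
    0 <= u - ln x <= 1, and exchange the integrals. For fixed u the substitution
    x = exp u * y leaves y in [1/e, 1], an interval of mass 1 for dy/y, and the
    integral over u remaining at fixed y is translated by ln y to the right-hand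
    side. The argument applies to discontinuous f,
    as the fractional part requires. *)
Lemma ge0_integral_expR (f : R -> R) : measurable_fun setT f ->
  (forall x, 0 <= f x) ->
  (\int[mu]_(x in `]0%R, +oo[) (f x)%:E = \int[mu]_u (f (expR u) * expR u)%:E)%E.
Proof.
move=> mf f0.
pose k (x : R) : R := \1_`]0, +oo[ x.
pose i (x : R) : R := \1_`[0, 1] x.
have k0 x : 0 <= k x by rewrite /k indicE.
have i0 x : 0 <= i x by rewrite /i indicE.
have mk : measurable_fun setT k by exact: measurable_indic.
have mi : measurable_fun setT i by exact: measurable_indic.
have ii b : (\int[mu]_u (i (u + b))%:E = 1)%E.
  have <- : (\int[mu]_u (i u)%:E = 1)%E.
    rewrite integral_indic//= setIT lebesgue_measure_itv/= lte_fin ltr01.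
    by rewrite -EFinB subr0.
  rewrite (@ge0_integral_affine (fun u => (i u)%:E) 1 b)//; last first.
    exact/measurable_EFinP.
  by rewrite mul1e; apply: eq_integral => u _; rewrite mul1r.
have mln : measurable_fun setT (fun x : R => ln x) by exact: measurable_ln.
pose H (z : R * R) := (f z.1 * k z.1 * i (z.2 - ln z.1))%:E.
have mH : measurable_fun setT H.
  apply/measurable_EFinP; apply: measurable_funM.
    by apply: measurable_funM; exact: measurableT_comp.
  apply: measurableT_comp => //; apply: measurable_funB => //.
  exact: measurableT_comp.
have H0 z : (0 <= H z)%E by rewrite lee_fin !mulr_ge0.
transitivity (\int[mu]_x \int[mu]_u H (x, u))%E.
  rewrite integral_mkcond; apply: eq_integral => x _; rewrite /H /=.
  under eq_integral do rewrite EFinM.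
  rewrite ge0_integralZl_EFin//=; last 3 first.
  - by move=> u _; rewrite lee_fin.
  - by apply/measurable_EFinP; apply: measurableT_comp => //; exact: measurable_funB.
  - by rewrite mulr_ge0.
  rewrite ii mule1 patchE /k indicE.
  by case: ifPn => xi; rewrite (mulr1, mulr0).
rewrite (@fubini_tonelli _ _ _ _ _ mu mu H mH H0).
pose K (z : R * R) := (expR z.1 * f (expR z.1 * z.2) * (k z.2 * i (- ln z.2)))%:E.
have mK : measurable_fun setT K.
  have me : measurable_fun setT (fun z : R * R => expR z.1).
    exact: measurableT_comp.
  apply/measurable_EFinP; apply: measurable_funM; apply: measurable_funM => //.
  - by apply: measurableT_comp => //; exact: measurable_funM.
  - exact: measurableT_comp.
  - apply: measurableT_comp => //; apply: measurableT_comp => //.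
    exact: measurableT_comp.
have K0 z : (0 <= K z)%E by rewrite lee_fin !mulr_ge0// expR_ge0.
transitivity (\int[mu]_u \int[mu]_y K (u, y))%E.
  apply: eq_integral => u _.
  rewrite (@ge0_integral_affine (fun x => H (x, u)) (expR u) 0)//; last first.
  - exact: measurableT_comp.
  - exact: expR_gt0.
  rewrite -ge0_integralZl_EFin ?expR_ge0//=; last first.
    apply: (measurableT_comp mH); apply: measurable_fun_pair => //.
    exact: measurable_affine.
  apply: eq_integral => y _; rewrite /H /K /= addr0 -EFinM; congr EFin.
  rewrite !mulrA -[LHS]mulrA -[RHS]mulrA; congr (_ * _).
  rewrite /k !indicE !mem_setE !in_itv/= !andbT pmulr_rgt0 ?expR_gt0//.
  case: ltP => y0; last by rewrite !mul0r.
  by rewrite lnM ?posrE ?expR_gt0// expRK opprD addrA subrr add0r.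
rewrite (@fubini_tonelli _ _ _ _ _ mu mu K mK K0).
transitivity (\int[mu]_y ((\1_`[expR (-1), 1] y * y^-1)%:E *
    \int[mu]_u (f (expR u) * expR u)%:E))%E; last first.
  rewrite ge0_integralZr//; last 3 first.
  - rewrite [X in measurable_fun _ X](_ : _ =
        (fun y => (\1_`[expR (-1), 1] y * y `^ (-1))%:E)); last first.
      apply/funext => y; rewrite indicE mem_setE in_itv/=.
      have [|_] := boolP (expR (-1) <= y <= 1).
        by move=> /andP[/(lt_le_trans (expR_gt0 _))/ltW y0 _]; rewrite powR_inv1.
      by rewrite !mul0r.
    apply/measurable_EFinP; apply: measurable_funM; first exact: measurable_indic.
    exact: measurable_powR.
  - move=> y _; rewrite lee_fin indicE mem_setE in_itv/=.
    have [/andP[+ _]|_] := boolP (expR (-1) <= y <= 1); last by rewrite mul0r.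
    by move=> /(lt_le_trans (expR_gt0 _)) y0; rewrite mul1r invr_ge0 ltW.
  - by apply: integral_ge0 => u _; rewrite lee_fin mulr_ge0// expR_ge0.
  by rewrite integral_inv_e mul1e.
apply: eq_integral => y _.
have [y0|y0] := ltP 0 y; last first.
  rewrite [X in (X%:E * _)%E](_ : _ = 0) ?mul0e; last first.
    rewrite indicE mem_setE in_itv/= leNgt (le_lt_trans y0) ?expR_gt0//=.
    by rewrite mul0r.
  apply: integral0_eq => u _; rewrite /K/= /k indicE mem_setE in_itv/= andbT.
  by rewrite ltNge y0/= mul0r mulr0.
have iE : i (- ln y) = \1_`[expR (-1), 1] y.
  rewrite /i !indicE !mem_setE !in_itv/= oppr_ge0 lerNl.
  rewrite -[in RHS](@lnK _ y)// ler_expR -[X in _ = ((_ && (_ <= X)))%:R]expR0.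
  by rewrite ler_expR andbC.
rewrite [in RHS](@ge0_integral_affine (fun u => (f (expR u) * expR u)%:E) 1 (ln y))//;
  last 2 first.
- by apply/measurable_EFinP; apply: measurable_funM => //; exact: measurableT_comp.
- by move=> u; rewrite lee_fin mulr_ge0// expR_ge0.
rewrite mul1e -ge0_integralZl_EFin//=; last 3 first.
- by move=> u _; rewrite lee_fin mulr_ge0// expR_ge0.
- have ma : measurable_fun setT (fun u : R => expR (1 * u + ln y)).
    by apply: measurableT_comp => //; exact: measurable_affine.
  by apply/measurable_EFinP; apply: measurable_funM => //; exact: measurableT_comp.
- by rewrite mulr_ge0 ?invr_ge0 ?(ltW y0)// indicE.
apply: eq_integral => u _; rewrite /K/= -EFinM; congr EFin.
rewrite iE mul1r expRD (@lnK _ y)// /k indicE mem_setE in_itv/= y0 mul1r.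
by field; rewrite gt_eqF.
Qed.
End Toolkit.

(** * Exponential substitution on the half-line, convolution, primitives *)

Section LineTools.
Context {R : realType}.
Local Notation mu := (@lebesgue_measure R).
Implicit Types f g : R -> R.

Lemma ge0_integral_expR_in (f : R -> R) : measurable_fun (`]0, +oo[ : set R) f ->
  (forall x, 0 < x -> 0 <= f x) ->
  (\int[mu]_(x in `]0%R, +oo[) (f x)%:E = \int[mu]_u (f (expR u) * expR u)%:E)%E.
Proof.
move=> mf f0; pose h := f \_ (`]0, +oo[ : set R).
transitivity (\int[mu]_(x in `]0%R, +oo[) (h x)%:E)%E.
  by apply: eq_integral => x xi; rewrite /h patchE xi.
rewrite ge0_integral_expR.
- apply: eq_integral => u _; rewrite /h patchE mem_set//=.
  by rewrite in_itv/= expR_gt0.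
- exact/(measurable_restrictT _ _).1.
- move=> x; rewrite /h patchE; case: ifPn => //.
  by rewrite inE/= in_itv/= andbT => /f0.
Qed.

Lemma Rintegral_expR f : measurable_fun (`]0, +oo[ : set R) f ->
  \int[mu]_(x in `]0, +oo[) f x = Int (fun u => f (expR u) * expR u).
Proof.
move=> mf; have mE : measurable_fun (`]0, +oo[ : set R) (EFin \o f) by exact/measurable_EFinP.
rewrite /Int /Rintegral [in LHS]integralE [in RHS]integralE.
congr (fine (_ - _)).
  transitivity (\int[mu]_(x in `]0%R, +oo[) (Num.max (f x) 0)%:E)%E.
    by apply: eq_integral => x _; rewrite funeposE -EFin_max.
  rewrite ge0_integral_expR_in.
  - apply: eq_integral => u _; rewrite funeposE -EFin_max -{2}(mul0r (expR u)).
    by rewrite maxr_pMl// expR_ge0.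
  - exact: measurable_maxr.
  - by move=> x _; rewrite le_max lexx orbT.
transitivity (\int[mu]_(x in `]0%R, +oo[) (Num.max (- f x) 0)%:E)%E.
  by apply: eq_integral => x _; rewrite funenegE -EFinN -EFin_max.
rewrite ge0_integral_expR_in.
- apply: eq_integral => u _; rewrite funenegE -EFinN -EFin_max.
  by rewrite -{2}(mul0r (expR u)) -mulNr maxr_pMl// expR_ge0.
- by apply: measurable_maxr => //; exact: measurableT_comp.
- by move=> x _; rewrite le_max lexx orbT.
Qed.

(** The bound on p makes every inner integral converge, so that the convolution
    is defined everywhere. *)
Lemma convolution (p q : R -> R) (M : R) : L1 p -> L1 q ->
  (forall x, `|p x| <= M) ->
  L1 (fun v => Int (fun u => p (v - u) * q u)) /\
  Int (fun v => Int (fun u => p (v - u) * q u)) = Int p * Int q.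
Proof.
move=> pi qi pM; have mp := L1_measurable pi; have mq := L1_measurable qi.
pose F (z : R * R) := p (z.1 - z.2) * q z.2.
have mF : measurable_fun setT F.
  apply: measurable_funM; last exact: measurableT_comp.
  by apply: measurableT_comp => //; exact: measurable_funB.
have shift u (h : R -> R) : L1 h -> L1 (fun v => h (v - u)) /\
    Int (fun v => h (v - u)) = Int h.
  move=> hi; have [] := @Int_affine _ h 1 (- u) ltr01 hi.
  rewrite mul1r => h1 ->; split; last by apply: eq_Int => v; rewrite mul1r.
  by apply: eq_L1 h1 => v; rewrite mul1r.
have Fx v : L1 (fun u => F (v, u)).
  apply: (@eq_L1 _ (fun u => q u * p (v - u))); first by move=> u; rewrite mulrC.
  apply: (@L1_mul_bounded _ _ _ M) => //.
  by apply: measurableT_comp => //; exact: measurable_funB.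
have Fy u : L1 (fun v => F (v, u)).
  apply: (@eq_L1 _ (fun v => q u * p (v - u))); first by move=> v; rewrite mulrC.
  by apply: L1Z; have [] := shift u p pi.
have Foo : (\int[mu]_v \int[mu]_u (`|F (v, u)|)%:E < +oo)%E.
  have := @fubini_tonelli _ _ _ _ _ mu mu (fun z => (`|F z|)%:E).
  move=> /= -> //; last by apply/measurable_EFinP; exact: measurableT_comp.
  under eq_integral => u _.
    rewrite -EFin_Int; last exact: L1_norm.
    rewrite (_ : Int _ = `|q u| * Int (fun x => `|p x|)); last first.
      have [h1 <-] := shift u _ (L1_norm pi).
      by rewrite -IntZ//; apply: eq_Int => v; rewrite /F/= normrM mulrC.
    over.
  have h : L1 (fun u => `|q u| * Int (fun x => `|p x|)).
    apply: (@eq_L1 _ (fun u => Int (fun x => `|p x|) * `|q u|)).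
      by move=> u; rewrite mulrC.
    by apply: L1Z; exact: L1_norm.
  by rewrite -EFin_Int// ltry.
have [h1 h2 h3] := fubini mF Fx Fy Foo; split; first exact: h1.
transitivity (Int (fun v => Int (fun u => F (v, u)))) => //.
rewrite h3 -IntZ//; apply: eq_Int => u.
have [h <-] := shift u p pi.
by rewrite mulrC -IntZ//; apply: eq_Int => v; rewrite mulrC.
Qed.

Lemma L1_indic_itv (f : R -> R) (a b : R) : continuous f ->
  L1 (fun x => \1_`[a, b] x * f x).
Proof.
move=> cf; have := @continuous_compact_integrable _ f `[a, b].
move=> /(_ (@segment_compact _ _ _) (continuous_subspaceT cf)).
move=> fi; have /integrable_mkcond : mu.-integrable `[a, b] (EFin \o f) by [].
move=> /(_ (measurable_itv _)); apply: eq_integrable => //.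
move=> x _; rewrite patchE /= indicE; case: ifPn => _; rewrite ?mul1r ?mul0r//.
Qed.

Lemma Int_derive_itv (f f' : R -> R) (a b : R) : a < b ->
  (forall x : R, is_derive x 1 f (f' x)) -> continuous f' ->
  Int (fun x => \1_`[a, b] x * f' x) = f b - f a.
Proof.
move=> ab df cf'.
have cf x : {for x, continuous f}.
  by apply/differentiable_continuous/derivable1_diffP; exact: ex_derive.
apply: EFin_inj; rewrite EFinB.
rewrite -(@continuous_FTC2 _ f' f a b)//.
- rewrite EFin_Int.
    rewrite [RHS]integral_mkcond; apply: eq_integral => x _.
    by rewrite patchE indicE; case: ifPn => _; rewrite ?mul1r ?mul0r.
  exact: L1_indic_itv.
- by apply: continuous_subspaceT.
- split=> [x _||]; first exact: ex_derive.
    by apply: cvg_at_right_filter; exact: cf.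
  by apply: cvg_at_left_filter; exact: cf.
- by move=> x _; rewrite derive1E; exact: derive_val.
Qed.

(** The exhaustion by [-n, n] makes limits along the integers sufficient. *)
Lemma Int_derive_line (f f' : R -> R) (l m : R) :
  (forall x : R, is_derive x 1 f (f' x)) -> continuous f' -> L1 f' ->
  (fun n : nat => f n%:R) @ \oo --> l -> (fun n : nat => f (- n%:R)) @ \oo --> m ->
  Int f' = l - m.
Proof.
move=> df cf' f'i fl fm.
have mf' := L1_measurable f'i.
have [] := @dominated_cvg _ (fun n x => \1_`[- n%:R, n%:R] x * f' x) f' (fun x => `|f' x|).
- by move=> n; exact: measurable_funM.
- by [].
- exact: L1_norm.
- apply: aeW => x; apply: cvg_near_cst.
  near=> n; rewrite indicE mem_set ?mul1r//= in_itv/= -ler_norml.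
  by near: n; exact: nbhs_infty_ger.
- by move=> n x; rewrite indicE; case: (_ \in _); rewrite ?mul1r// mul0r normr0.
move=> _ h; apply: (cvg_unique _ h) => //.
have : (fun n : nat => f n%:R - f (- n%:R)) @ \oo --> l - m by exact: cvgB.
apply: cvg_trans; apply: near_eq_cvg; near=> n.
rewrite (@Int_derive_itv f)//; rewrite gtrN// ltr0n.
by near: n; exact: nbhs_infty_gt.
Unshelve. all: by end_near. Qed.

Lemma cvg_expR_decay (s : R) : 0 < s -> expR (- (s * x)) @[x --> +oo] --> (0 : R).
Proof.
move=> s0; apply: (@cvg_comp _ _ _ (fun x : R => s * x) (fun y => expR (- y)) _
  (pinfty_nbhs R)); last exact: cvgr_expR.
exact: gt0_cvgMry.
Qed.

Lemma L1_exp_half (s : R) : 0 < s -> L1 (fun x => \1_`[0, +oo[ x * expR (- (s * x))).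
Proof.
move=> s0; apply: L1_lty.
  apply: measurable_funM => //; apply: measurableT_comp => //.
  by apply: measurableT_comp => //; exact: measurable_funM.
have de (x : R) : is_derive x 1 (fun x : R => - s^-1 * expR (- (s * x)))
    (expR (- (s * x))).
  apply: is_derive_eq; rewrite !scaler1 /GRing.scale/=.
  by field; rewrite gt_eqF.
have ce : continuous (fun x : R => expR (- (s * x))).
  move=> x; apply: continuous_comp; last exact: continuous_expR.
  by apply: continuousN; apply: cvgM => //; exact: cvg_cst.
rewrite (_ : (\int[mu]_x _)%E = (\int[mu]_(x in `[0%R, +oo[) (expR (- (s * x)))%:E)%E).
  rewrite (@ge0_continuous_FTC2y _ _ (fun x : R => - s^-1 * expR (- (s * x))) 0 0)//.
  - by rewrite -EFinB ltry.
  - exact: continuous_subspaceT.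
  - rewrite -(mulr0 (- s^-1)); apply: cvgM; first exact: cvg_cst.
    exact: cvg_expR_decay.
  - apply: cvg_at_right_filter; apply: cvgM; [exact: cvg_cst|exact: ce].
  - by move=> x _; rewrite derive1E; exact: derive_val.
rewrite [RHS]integral_mkcond; apply: eq_integral => x _.
rewrite patchE indicE normrM (ger0_norm (expR_ge0 _)).
by case: ifPn => _; rewrite ?mul1r ?normr1 ?mul1r// normr0 mul0r.
Qed.
End LineTools.

(** * Derivation rules *)

Section DerivationRules.
Context {R : realType}.
Implicit Types (f g : R -> R) (x a b c : R).

Lemma drvD f g x a b : is_derive x 1 f a -> is_derive x 1 g b ->
  is_derive x 1 (fun x => f x + g x) (a + b).
Proof. by move=> ? ?; exact: is_deriveD. Qed.

Lemma drvB f g x a b : is_derive x 1 f a -> is_derive x 1 g b ->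
  is_derive x 1 (fun x => f x - g x) (a - b).
Proof. by move=> ? ?; exact: is_deriveB. Qed.

Lemma drvM f g x a b : is_derive x 1 f a -> is_derive x 1 g b ->
  is_derive x 1 (fun x => f x * g x) (a * g x + f x * b).
Proof.
move=> fa gb; apply: is_derive_eq (is_deriveM fa gb) _.
by rewrite /GRing.scale/= addrC [_ * a]mulrC.
Qed.

Lemma drvZ f x a c : is_derive x 1 f a -> is_derive x 1 (fun x => c * f x) (c * a).
Proof. by move=> ?; exact: is_deriveZ. Qed.

Lemma drv_lin c x : is_derive x 1 (fun x : R => c * x) c.
Proof. by apply: is_derive_eq (drvZ c (is_derive_id x 1)) _; rewrite mulr1. Qed.

Lemma drv_monomial c n x :
  is_derive x 1 (fun x => c * x ^+ n) (c * (n%:R * x ^+ n.-1)).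
Proof.
have h : is_derive x 1 (fun x : R => x ^+ n) (n%:R * x ^+ n.-1).
  have := is_deriveX n (is_derive_id x (1 : R)).
  by rewrite exprfctE /GRing.scale/= mulr1.
exact: drvZ.
Qed.

Lemma drv_expR f x a : is_derive x 1 f a ->
  is_derive x 1 (fun x => expR (f x)) (expR (f x) * a).
Proof. by move=> fa; exact: (is_derive1_comp (is_derive_expR _) fa). Qed.

Lemma drv_cos f x a : is_derive x 1 f a ->
  is_derive x 1 (fun x => cos (f x)) (- sin (f x) * a).
Proof. by move=> fa; exact: (is_derive1_comp (is_derive_cos _) fa). Qed.

Lemma drv_sin f x a : is_derive x 1 f a ->
  is_derive x 1 (fun x => sin (f x)) (cos (f x) * a).
Proof. by move=> fa; exact: (is_derive1_comp (is_derive_sin _) fa). Qed.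

Lemma drv_continuous f x a : is_derive x 1 f a -> {for x, continuous f}.
Proof.
by move=> h; apply/differentiable_continuous/derivable1_diffP; exact: ex_derive.
Qed.

End DerivationRules.

(** * Complex numbers and the complex exponential *)

Section ComplexBasics.
Context {R : realType}.
Implicit Types (z w : R[i]) (x y : R).

Lemma ReD z w : Re (z + w) = Re z + Re w. Proof. by case: z; case: w. Qed.

Lemma ImD z w : Im (z + w) = Im z + Im w. Proof. by case: z; case: w. Qed.

Lemma ReN z : Re (- z) = - Re z. Proof. by case: z. Qed.

Lemma ImN z : Im (- z) = - Im z. Proof. by case: z. Qed.

Lemma ReM z w : Re (z * w) = Re z * Re w - Im z * Im w.
Proof. by case: z; case: w. Qed.

Lemma ImM z w : Im (z * w) = Re z * Im w + Im z * Re w.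
Proof. by case: z; case: w. Qed.

Lemma Re_scale x z : Re (toC x * z) = x * Re z.
Proof. by rewrite ReM /= mul0r subr0. Qed.

Lemma Im_scale x z : Im (toC x * z) = x * Im z.
Proof. by rewrite ImM /= mul0r addr0. Qed.

Lemma Re_sum n (u : nat -> R[i]) : Re (\sum_(k < n) u k) = \sum_(k < n) Re (u k).
Proof. by elim: n => [|n ih]; rewrite ?big_ord0// !big_ord_recr/= -ih ReD. Qed.

Lemma Im_sum n (u : nat -> R[i]) : Im (\sum_(k < n) u k) = \sum_(k < n) Im (u k).
Proof. by elim: n => [|n ih]; rewrite ?big_ord0// !big_ord_recr/= -ih ImD. Qed.

Lemma complex_eq z w : Re z = Re w -> Im z = Im w -> z = w.
Proof. by case: z => a b; case: w => c d /= -> ->. Qed.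

Lemma natcE n : (n%:R : R[i]) = toC n%:R.
Proof. by rewrite rmorph_nat. Qed.

Lemma normc_ge0 z : 0 <= normc z.
Proof. by case: z => a b; rewrite /normc sqrtr_ge0. Qed.

Lemma normcR x : normc (toC x) = `|x|.
Proof. by rewrite /normc/= expr0n/= addr0 sqrtr_sqr. Qed.

Lemma sqr_normc z : normc z ^+ 2 = Re z ^+ 2 + Im z ^+ 2.
Proof. by case: z => a b; rewrite /normc sqr_sqrtr// addr_ge0 ?sqr_ge0. Qed.

Lemma normcX z n : normc (z ^+ n) = normc z ^+ n.
Proof. by elim: n => [|n ih]; rewrite ?expr0 ?normc1// !exprS normcM ih. Qed.

Lemma normcB z w : normc (z - w) = normc (w - z).
Proof. by rewrite -normcN opprB. Qed.

Lemma norm_Re_le z : `|Re z| <= normc z.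
Proof.
by rewrite -ler_sqr ?nnegrE ?normc_ge0// sqr_normc real_normK ?num_real// lerDl sqr_ge0.
Qed.

Lemma norm_Im_le z : `|Im z| <= normc z.
Proof.
by rewrite -ler_sqr ?nnegrE ?normc_ge0// sqr_normc real_normK ?num_real// lerDr sqr_ge0.
Qed.

Lemma normc_le z : normc z <= `|Re z| + `|Im z|.
Proof.
rewrite -ler_sqr ?nnegrE ?normc_ge0 ?addr_ge0// sqr_normc sqrrD.
by rewrite !real_normK ?num_real// -addrA [X in _ <= _ + X]addrC addrA lerDl mulrn_wge0 ?mulr_ge0.
Qed.

Lemma le_normcB z w : normc z - normc w <= normc (z - w).
Proof. by rewrite lerBlDr -{1}(subrK w z) le_normcD. Qed.

Lemma normc_sum n (u : nat -> R[i]) :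
  normc (\sum_(k < n) u k) <= \sum_(k < n) normc (u k).
Proof.
elim: n => [|n ih]; first by rewrite !big_ord0 normc0.
by rewrite !big_ord_recr/= (le_trans (le_normcD _ _))// lerD2r.
Qed.

Lemma normc_eq0 z : (normc z == 0) = (z == 0).
Proof. by apply/eqP/eqP => [/eq0_normc//|->]; rewrite normc0. Qed.

Lemma normc_gt0 z : (0 < normc z) = (z != 0).
Proof. by rewrite lt_neqAle normc_ge0 andbT eq_sym normc_eq0. Qed.

(** Convergence for the modulus, the one that [cseries_to] refers to. *)
Definition cvgC (u : nat -> R[i]) (l : R[i]) : Prop :=
  (fun n => normc (u n - l)) @ \oo --> (0 : R).

Lemma cvgC_squeeze (u : nat -> R[i]) l (v : nat -> R) :
  (\forall n \near \oo, normc (u n - l) <= v n) -> v @ \oo --> (0 : R) -> cvgC u l.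
Proof.
move=> uv v0; apply: (squeeze_cvgr _ (cvg_cst 0) v0).
by near=> n; rewrite normc_ge0/=; near: n.
Unshelve. all: by end_near. Qed.

Lemma cvgCP (u : nat -> R[i]) l : cvgC u l <->
  ((fun n => Re (u n)) @ \oo --> Re l /\ (fun n => Im (u n)) @ \oo --> Im l).
Proof.
split=> [ul|[Rl Il]].
- split; apply/cvgrPdist_le => e e0.
  + have /cvgrPdist_le/(_ e e0) := ul; apply: filterS => n.
    rewrite sub0r normrN ger0_norm ?normc_ge0//; apply: le_trans.
    by rewrite -ReN -ReD normcB norm_Re_le.
  + have /cvgrPdist_le/(_ e e0) := ul; apply: filterS => n.
    rewrite sub0r normrN ger0_norm ?normc_ge0//; apply: le_trans.
    by rewrite -ImN -ImD normcB norm_Im_le.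
- apply: (@cvgC_squeeze _ _ (fun n => `|Re (u n) - Re l| + `|Im (u n) - Im l|)).
    by apply: nearW => n; rewrite (le_trans (normc_le _))// ReD ImD ReN ImN.
  rewrite -(addr0 (0 : R)); apply: cvgD; apply/norm_cvg0P/subr_cvg0; exact.
Qed.

Lemma cvgC_unique u l m : cvgC u l -> cvgC u m -> l = m.
Proof.
move=> /cvgCP[ul1 ul2] /cvgCP[um1 um2].
by apply: complex_eq; [exact: (cvg_unique _ ul1)|exact: (cvg_unique _ ul2)].
Qed.

Lemma cvgCD u v l m : cvgC u l -> cvgC v m -> cvgC (fun n => u n + v n) (l + m).
Proof.
move=> /cvgCP[ul1 ul2] /cvgCP[um1 um2]; apply/cvgCP; split.
  by under eq_fun do rewrite ReD; rewrite ReD; exact: cvgD.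
by under eq_fun do rewrite ImD; rewrite ImD; exact: cvgD.
Qed.

Lemma cvgC_cst l : cvgC (fun=> l) l.
Proof. by apply/cvgCP; split; exact: cvg_cst. Qed.

Lemma cvgCM u v l m : cvgC u l -> cvgC v m -> cvgC (fun n => u n * v n) (l * m).
Proof.
move=> /cvgCP[ul1 ul2] /cvgCP[um1 um2]; apply/cvgCP; split.
  by under eq_fun do rewrite ReM; rewrite ReM; apply: cvgB; exact: cvgM.
by under eq_fun do rewrite ImM; rewrite ImM; apply: cvgD; exact: cvgM.
Qed.

Lemma cvgCS u l : cvgC u l -> cvgC (fun n => u n.+1) l.
Proof. by move=> /cvgCP[h1 h2]; apply/cvgCP; split; rewrite (cvg_shiftS (fun n => _ (u n))). Qed.

(** The polar form matches [cpow], see [cpowE]. *)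
Definition cexp z : R[i] :=
  Complex (expR (Re z) * cos (Im z)) (expR (Re z) * sin (Im z)).

Lemma cexpD z w : cexp (z + w) = cexp z * cexp w.
Proof.
apply: complex_eq; rewrite ?ReM ?ImM /= ReD ImD expRD ?cosD ?sinD; ring.
Qed.

Lemma cexp0 : cexp 0 = 1.
Proof. by rewrite /cexp /= expR0 cos0 sin0 !mul1r. Qed.

Lemma normc_cexp z : normc (cexp z) = expR (Re z).
Proof.
apply/eqP; rewrite -(@eqrXn2 _ 2) ?normc_ge0 ?expR_ge0// sqr_normc /=.
by rewrite !exprMn -mulrDr cos2Dsin2 mulr1.
Qed.

Lemma cpowE x (s : R[i]) : 0 < x -> cpow x s = cexp (s * toC (ln x)).
Proof.
move=> x0; rewrite /cpow /cexp ReM ImM /= !mulr0 subr0 add0r.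
by rewrite /powR gt_eqF.
Qed.

Lemma cpow_expR (u : R) (s : R[i]) : cpow (expR u) s = cexp (s * toC u).
Proof. by rewrite cpowE ?expR_gt0// expRK. Qed.

Let tcoef z n : R[i] := z ^+ n / n`!%:R.

Let tcoefS z n : toC n.+1%:R * tcoef z n.+1 = z * tcoef z n.
Proof.
rewrite /tcoef factS natrM exprS -natcE.
have a0 : n.+1%:R != 0 :> R[i] by rewrite pnatr_eq0.
have b0 : n`!%:R != 0 :> R[i] by rewrite pnatr_eq0 -lt0n fact_gt0.
by move: n.+1%:R n`!%:R a0 b0 => a b a0 b0; field; rewrite a0 b0.
Qed.

(** Real and imaginary parts of the Taylor remainder of order n at x z, for a
    real x: the derivative in x of the remainder of order n + 1 is z times the
    remainder of order n. *)
Let remRe z n x : R :=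
  expR (Re z * x) * cos (Im z * x) - \sum_(k < n) Re (tcoef z k) * x ^+ k.
Let remIm z n x : R :=
  expR (Re z * x) * sin (Im z * x) - \sum_(k < n) Im (tcoef z k) * x ^+ k.

(** Differentiating shifts the Taylor coefficients: f and g will be the real or
    imaginary parts of w and of z w. *)
Let is_derive_psum z (f g : R[i] -> R) :
  (forall n, n.+1%:R * f (tcoef z n.+1) = g (tcoef z n)) ->
  forall n x, is_derive x 1 (fun x => \sum_(k < n.+1) f (tcoef z k) * x ^+ k)
    (\sum_(k < n) g (tcoef z k) * x ^+ k).
Proof.
move=> fg; elim=> [|n ih] x.
  rewrite big_ord0 (_ : (fun x => _) = cst (f (tcoef z 0))); last first.
    by apply/funext => t; rewrite big_ord1 expr0 mulr1.
  exact: is_derive_cst.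
rewrite (_ : (fun x => _) = (fun x => \sum_(k < n.+1) f (tcoef z k) * x ^+ k) +
    (fun x => f (tcoef z n.+1) * x ^+ n.+1)); last first.
  by apply/funext => t; rewrite big_ord_recr.
rewrite big_ord_recr /=; apply: is_deriveD.
apply: is_derive_eq (drv_monomial _ _ _) _.
by rewrite -fg; ring.
Qed.

Let is_derive_remRe z n x :
  is_derive x 1 (remRe z n.+1) (Re z * remRe z n x - Im z * remIm z n x).
Proof.
have hc m : m.+1%:R * Re (tcoef z m.+1) =
    Re z * Re (tcoef z m) - Im z * Im (tcoef z m).
  by rewrite -ReM -tcoefS ReM/= mul0r subr0.
have h := @is_derive_psum z (@complex.Re R) (fun w => Re z * Re w - Im z * Im w) hc n x.
have e := drv_expR (drv_lin (Re z) x); have c := drv_cos (drv_lin (Im z) x).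
apply: is_derive_eq (drvB (drvM e c) h) _.
rewrite /remRe /remIm !mulrBr !mulr_sumr.
have -> : \sum_(k < n) (Re z * Re (tcoef z k) - Im z * Im (tcoef z k)) * x ^+ k =
  \sum_(k < n) (Re z * (Re (tcoef z k) * x ^+ k)) -
  \sum_(k < n) (Im z * (Im (tcoef z k) * x ^+ k)).
  by rewrite -sumrB; apply: eq_bigr => k _; ring.
ring.
Qed.

Let is_derive_remIm z n x :
  is_derive x 1 (remIm z n.+1) (Re z * remIm z n x + Im z * remRe z n x).
Proof.
have hc m : m.+1%:R * Im (tcoef z m.+1) =
    Re z * Im (tcoef z m) + Im z * Re (tcoef z m).
  by rewrite -ImM -tcoefS ImM/= mul0r addr0.
have h := @is_derive_psum z (@complex.Im R) (fun w => Re z * Im w + Im z * Re w) hc n x.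
have e := drv_expR (drv_lin (Re z) x); have c := drv_sin (drv_lin (Im z) x).
apply: is_derive_eq (drvB (drvM e c) h) _.
rewrite /remRe /remIm !mulrBr !mulr_sumr.
have -> : \sum_(k < n) (Re z * Im (tcoef z k) + Im z * Re (tcoef z k)) * x ^+ k =
  \sum_(k < n) (Re z * (Im (tcoef z k) * x ^+ k)) +
  \sum_(k < n) (Im z * (Re (tcoef z k) * x ^+ k)).
  by rewrite -big_split/=; apply: eq_bigr => k _; ring.
ring.
Qed.

(** Integration of a power bound from 0, by monotonicity of the difference. *)
Let le_power_bound (f f' : R -> R) (K : R) n : f 0 = 0 ->
  (forall x, is_derive x 1 f (f' x)) ->
  (forall x, 0 <= x <= 1 -> f' x <= K * (x ^+ n / n`!%:R)) ->
  forall x, 0 <= x <= 1 -> f x <= K * (x ^+ n.+1 / n.+1`!%:R).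
Proof.
move=> f0 df f'K x /andP[x0 x1].
pose g x := K / n.+1`!%:R * x ^+ n.+1 - f x.
have dg y : is_derive y 1 g (K / n.+1`!%:R * (n.+1%:R * y ^+ n) - f' y).
  by apply: drvB => //; exact: drv_monomial.
suff : g 0 <= g x.
  rewrite /g f0 expr0n/= mulr0 subr0 subr_ge0 => /le_trans; apply.
  by rewrite mulrAC mulrA.
apply: (@ger0_derive1_ndecr _ g 0 1) => //.
- move=> y; rewrite in_itv/= => /andP[y0 y1].
  rewrite derive1E (@derive_val _ _ _ _ _ _ _ (dg y)) subr_ge0.
  apply: le_trans (f'K y _) _; first by rewrite !ltW.
  rewrite factS natrM.
  rewrite le_eqVlt; apply/orP; left; apply/eqP.
  have b0 : n`!%:R != 0 :> R by rewrite pnatr_eq0 -lt0n fact_gt0.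
  have a0 : n.+1%:R != 0 :> R by [].
  by move: n.+1%:R n`!%:R a0 b0 => a b a0 b0; field; rewrite a0 b0.
- by apply: continuous_subspaceT => y; exact: drv_continuous (dg y).
Qed.

Let rem0 z n : remRe z n.+1 0 = 0 /\ remIm z n.+1 0 = 0.
Proof.
have S (f : R[i] -> R) : \sum_(k < n.+1) f (tcoef z k) * (0 : R) ^+ k = f 1.
  rewrite big_ord_recl/= expr0 mulr1 /tcoef expr0 fact0 divr1 big1 ?addr0//.
  by move=> k _; rewrite expr0n/= mulr0.
by rewrite /remRe /remIm !mulr0 expR0 cos0 sin0 !S/= mulr1 mulr0 !subrr.
Qed.

(** By induction on n: each part of the derivative combines both parts of the
    previous remainder, with coefficients at most |z|, whence the powers of 2 |z|. *)
Let rem_bound z n x : 0 <= x <= 1 ->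
  `|remRe z n x| <= expR `|Re z| * (normc z *+ 2) ^+ n * (x ^+ n / n`!%:R) /\
  `|remIm z n x| <= expR `|Re z| * (normc z *+ 2) ^+ n * (x ^+ n / n`!%:R).
Proof.
elim: n x => [|n ih] x x01.
  rewrite /remRe /remIm !big_ord0 !subr0 !expr0 fact0 divr1 !mulr1.
  rewrite !normrM !(ger0_norm (expR_ge0 _)).
  have e : expR (Re z * x) <= expR `|Re z|.
    rewrite ler_expR (le_trans (ler_norm _))// normrM.
    by case/andP: x01 => x0 x1; rewrite ler_piMr// ger0_norm.
  by split; rewrite -[leRHS]mulr1 ler_pM// ler_norml ?cos_geN1 ?cos_le1 ?sin_geN1 ?sin_le1.
pose K := expR `|Re z| * (normc z *+ 2) ^+ n.+1.
have step (a b u v M : R) : `|a| <= normc z -> `|b| <= normc z -> `|u| <= M ->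
    `|v| <= M -> `|a * u + b * v| <= normc z *+ 2 * M.
  move=> az bz uM vM; rewrite (le_trans (ler_normD _ _))// !normrM mulr2n mulrDl.
  by apply: lerD; apply: ler_pM.
have bRe y : 0 <= y <= 1 ->
    `|Re z * remRe z n y - Im z * remIm z n y| <= K * (y ^+ n / n`!%:R).
  move=> /ih[h1 h2]; rewrite /K exprSr [X in _ <= X](_ : _ = normc z *+ 2 *
    (expR `|Re z| * (normc z *+ 2) ^+ n * (y ^+ n / n`!%:R))); last by ring.
  by rewrite -mulNr; apply: step => //; rewrite ?normrN ?norm_Re_le ?norm_Im_le.
have bIm y : 0 <= y <= 1 ->
    `|Re z * remIm z n y + Im z * remRe z n y| <= K * (y ^+ n / n`!%:R).
  move=> /ih[h1 h2]; rewrite /K exprSr [X in _ <= X](_ : _ = normc z *+ 2 *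
    (expR `|Re z| * (normc z *+ 2) ^+ n * (y ^+ n / n`!%:R))); last by ring.
  by apply: step => //; rewrite ?norm_Re_le ?norm_Im_le.
have [r0 i0] := rem0 z n.
have signs (f f' : R -> R) : f 0 = 0 -> (forall y, is_derive y 1 f (f' y)) ->
    (forall y, 0 <= y <= 1 -> `|f' y| <= K * (y ^+ n / n`!%:R)) ->
    `|f x| <= K * (x ^+ n.+1 / n.+1`!%:R).
  move=> f0 df f'K; rewrite ler_norml; apply/andP; split; last first.
    apply: (@le_power_bound f f') => // y y01.
    exact: le_trans (ler_norm _) (f'K y y01).
  rewrite lerNl; apply: (@le_power_bound (fun y => - f y) (fun y => - f' y)) => //.
  - by rewrite f0 oppr0.
  - by move=> y y01; rewrite (le_trans _ (f'K y y01))// -normrN ler_norm.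
by split; [apply: (signs _ _ r0 (is_derive_remRe z n)) |
           apply: (signs _ _ i0 (is_derive_remIm z n))].
Qed.

(** The bound is, up to a constant, a term of a convergent exponential series. *)
Lemma cexp_taylor_le z n :
  normc (\sum_(k < n) z ^+ k / k`!%:R - cexp z) <=
  (expR `|Re z| *+ 2) * exp_coeff (normc z *+ 2) n.
Proof.
have [] := @rem_bound z n 1 _; first by rewrite ler01 lexx.
rewrite /remRe /remIm !mulr1 expr1n.
under eq_bigr do rewrite expr1n mulr1.
move=> h1; under eq_bigr do rewrite expr1n mulr1.
move=> h2; rewrite normcB (le_trans (normc_le _))//.
rewrite ReD ImD ReN ImN (Re_sum _ (tcoef z)) (Im_sum _ (tcoef z)) /= /exp_coeff /=.
apply: le_trans (lerD h1 h2) _.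
by rewrite mulr2n mulrDl !mul1r !mulrA.
Qed.

Lemma cexp_series z : cseries_to (fun n => z ^+ n / n`!%:R) (cexp z).
Proof.
apply: (@cvgC_squeeze _ _ (fun n => (expR `|Re z| *+ 2) * exp_coeff (normc z *+ 2) n)).
  by apply: nearW => n; exact: cexp_taylor_le.
by rewrite -(mulr0 (expR `|Re z| *+ 2)); apply: cvgM; [exact: cvg_cst|exact: cvg_exp_coeff].
Qed.

Lemma expR_series_le (x : R) n : 0 <= x -> \sum_(k < n) x ^+ k / k`!%:R <= expR x.
Proof.
move=> x0; rewrite -(big_mkord xpredT (fun k => x ^+ k / k`!%:R)).
apply: (@nondecreasing_cvgn_le _ (series (exp_coeff x))).
  apply/nondecreasing_seqP => m; rewrite /series/= big_nat_recr//= lerDl.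
  by rewrite divr_ge0// exprn_ge0.
exact: is_cvg_series_exp_coeff.
Qed.

Lemma cexp_psum_le z n : normc (\sum_(k < n) z ^+ k / k`!%:R) <= expR (normc z).
Proof.
apply: le_trans (normc_sum n (tcoef z)) _; apply: le_trans (expR_series_le n (normc_ge0 z)).
by apply: ler_sum => k _; rewrite normcM normcX normcV natcE normcR ger0_norm.
Qed.

End ComplexBasics.

(** * Power series and the identity theorem *)

Section PowerSeries.
Context {R : realType}.
Implicit Types (z w s : R[i]) (a b : nat -> R[i]) (F G : R[i] -> R[i]).

Lemma cvgC_cst_eq (l m : R[i]) : cvgC (fun=> l) m -> l = m.
Proof. exact: cvgC_unique (cvgC_cst l). Qed.

(** The bound 2 survives the induction only with the remainder 2 q^n added. *)
Lemma geometric_le (q : R) n : 0 <= q -> q <= 2^-1 -> \sum_(k < n) q ^+ k <= 2.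
Proof.
move=> q0 q2; suff : \sum_(k < n) q ^+ k + 2 * q ^+ n <= 2.
  by apply: le_trans; rewrite lerDl mulr_ge0// exprn_ge0.
elim: n => [|n ih]; first by rewrite big_ord0 add0r expr0 mulr1.
rewrite big_ord_recr/= exprS; have : 0 <= q ^+ n by exact: exprn_ge0.
nra.
Qed.

(** The terms of a convergent series tend to 0. *)
Lemma series_terms_bounded a z l : cseries_to (fun n => a n * z ^+ n) l ->
  exists2 M : R, 0 < M & forall n, normc (a n) * normc z ^+ n <= M.
Proof.
move=> al; have al1 := cvgCS al.
have /cvgCP : cvgC (fun n => a n * z ^+ n) 0.
  have := cvgCD al1 (cvgCM (cvgC_cst (-1)) al); rewrite mulN1r subrr.
  congr cvgC; apply/funext => n; rewrite big_ord_recr/=; ring.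
move=> [h1 h2].
have : (fun n => `|Re (a n * z ^+ n)| + `|Im (a n * z ^+ n)|) @ \oo --> (0 : R).
  by rewrite -(addr0 (0 : R)); apply: cvgD; exact/norm_cvg0P.
move=> /cvgP/cvg_seq_bounded/pinfty_ex_gt0[M M0 hM]; exists M => // n.
rewrite -normcX -normcM (le_trans (normc_le _))//.
by have := hM n I; apply: le_trans; exact: ler_norm.
Qed.

(** Zeros accumulating at the centre kill the coefficients one by one: near the
    centre the first nonzero term would dominate the tail of the series. *)
Lemma series_zeros_cluster a (rho : R) F : 0 < rho ->
  (forall z, normc z < rho -> cseries_to (fun n => a n * z ^+ n) (F z)) ->
  (forall e : R, 0 < e -> exists z, [/\ z != 0, normc z < e & F z = 0]) ->
  forall n, a n = 0.
Proof.
move=> rho0 aF accF; pose r := rho / 2.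
have r0 : 0 < r by rewrite divr_gt0.
have [M M0 aM] : exists2 M : R, 0 < M & forall n, normc (a n) * r ^+ n <= M.
  have [|M M0 hM] := @series_terms_bounded a (toC r) (F (toC r)).
    by apply: aF; rewrite normcR gtr0_norm// /r ltr_pdivrMr// ltr_pMr//; lra.
  by exists M => // n; have := hM n; rewrite normcR gtr0_norm.
move=> m; elim/ltn_ind: m => m ih; apply/eqP/negPn/negP => am0.
pose A := normc (a m); have A0 : 0 < A by rewrite normc_gt0.
(* At distance e the tail, at most 2 M q^(m+1), is smaller than the m-th term. *)
pose e := Num.min (r / 2) (A * r ^+ m * r / (4 * M)).
have e0 : 0 < e.
  by rewrite lt_min !divr_gt0// ?mulr_gt0 ?exprn_gt0.
have [z [z0 ze Fz]] := accF e e0.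
have nz0 : 0 < normc z by rewrite normc_gt0.
pose q := normc z / r.
have q0 : 0 < q by rewrite divr_gt0.
have q2 : q <= 2^-1.
  rewrite /q ler_pdivrMr// mulrC; apply/ltW/(lt_le_trans ze).
  by rewrite ge_min lexx.
have zq : normc z = q * r by rewrite divfK ?gt_eqF.
have zr : normc z < rho.
  by rewrite zq (le_lt_trans (ler_wpM2r (ltW r0) q2))// /r; lra.
have low N : A * normc z ^+ m - M * q ^+ m.+1 * 2 <=
    normc (\sum_(k < m.+1 + N) a k * z ^+ k).
  rewrite big_split_ord /= big_ord_recr /= big1 => [|i _]; last first.
    by rewrite ih ?mul0r.
  rewrite add0r; apply: (@le_trans _ _ (normc (a m * z ^+ m) -
     normc (\sum_(i < N) a (m.+1 + i)%N * z ^+ (m.+1 + i)))); last first.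
    set w := (X in _ <= normc (_ + X)).
    by rewrite -(normcN w) -{2}(opprK w) le_normcB.
  rewrite normcM normcX lerB//.
  apply: le_trans (@normc_sum _ N (fun i => a (m.+1 + i)%N * z ^+ (m.+1 + i))) _.
  apply: (@le_trans _ _ (\sum_(i < N) M * q ^+ m.+1 * q ^+ i)).
    apply: ler_sum => i _; rewrite normcM normcX zq exprMn -mulrA -exprD.
    by rewrite mulrCA mulrC ler_pM2r ?exprn_gt0.
  rewrite -mulr_sumr ler_pM2l ?mulr_gt0 ?exprn_gt0//.
  exact: geometric_le (ltW q0) q2.
have : A * normc z ^+ m - M * q ^+ m.+1 * 2 <= 0.
  have /cvgrPdist_le h := aF z zr; apply/ler_addgt0Pr => d d0; rewrite add0r.
  have [N _ hN] := h d d0; have := hN (m.+1 + N)%N (leq_addl _ _).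
  rewrite sub0r normrN ger0_norm ?normc_ge0// Fz subr0.
  exact: le_trans (low N).
rewrite subr_le0 zq exprMn exprS leNgt => /negP; apply.
rewrite [X in X < _](_ : _ = (M * q * 2) * q ^+ m); last by ring.
rewrite [X in _ < X](_ : _ = (A * r ^+ m) * q ^+ m); last by ring.
rewrite ltr_pM2r ?exprn_gt0//.
have : normc z < A * r ^+ m * r / (4 * M).
  by rewrite (lt_le_trans ze)// ge_min lexx orbT.
rewrite zq [X in _ < X]mulrAC ltr_pM2r//.
rewrite ltr_pdivlMr ?mulr_gt0//.
have : 0 < M * q by exact: mulr_gt0.
nra.
Qed.

Definition vanishes_near F z := exists2 e : R, 0 < e &
  forall w, normc (w - z) < e -> F w = 0.

Lemma analytic_vanishes F z : analytic_at F z ->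
  (forall e : R, 0 < e -> exists w, [/\ w != z, normc (w - z) < e & F w = 0]) ->
  vanishes_near F z.
Proof.
move=> [a [rho [rho0 aF]]] accF; exists rho => // w wz.
have a0 : forall n, a n = 0.
  apply: (@series_zeros_cluster a rho (fun y => F (y + z))) => //.
    by move=> y yr; have := aF (y + z); rewrite addrK => /(_ yr).
  move=> e e0; have [y [yz ye Fy]] := accF e e0; exists (y - z).
  by rewrite subr_eq0 subrK.
have := aF w wz; have -> : (fun n => a n * (w - z) ^+ n) = fun=> 0.
  by apply/funext => n; rewrite a0 mul0r.
move=> h; apply/esym/cvgC_cst_eq; move: h; congr cvgC.
by apply/funext => n; rewrite big1.
Qed.

(** Let T be the supremum of the parameters near which F vanishes. Zeros
    accumulate at the point of parameter T, so F vanishes near it, which lets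
    the parameter move past T unless T = 1. *)
Lemma vanishes_along_segment F z w :
  (forall t : R, 0 <= t <= 1 -> analytic_at F (z + toC t * (w - z))) ->
  vanishes_near F z -> vanishes_near F w.
Proof.
move=> anF Fz; have [->//|zw] := eqVneq w z.
have d0 : 0 < normc (w - z) by rewrite normc_gt0 subr_eq0.
pose g (t : R) := z + toC t * (w - z).
have gB (s t : R) : normc (g s - g t) = `|s - t| * normc (w - z).
  by rewrite -normcR -normcM /g; congr normc; rewrite rmorphB; ring.
pose E := [set t : R | 0 <= t <= 1 /\ vanishes_near F (g t)].
have E0 : E 0 by split; [rewrite lexx ler01|rewrite /g mul0r addr0].
have supE : has_sup E.
  by split; [exists 0|exists 1 => t [/andP[]]].
pose T := sup E.
have T0 : 0 <= T by apply: ub_le_sup => //; exact: supE.2.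
have T1 : T <= 1 by apply: ge_sup => [|t [/andP[]]//]; exists 0.
have ET : vanishes_near F (g T).
  have [[_ //]|nET] := pselect (E T).
  apply: analytic_vanishes; first by apply: anF; rewrite T0.
  move=> e e0; have ed0 : 0 < e / normc (w - z) by rewrite divr_gt0.
  have [t Et tT] := sup_adherent ed0 supE.
  have tT' : t <= T by apply: ub_le_sup => //; exact: supE.2.
  have ntT : t != T by apply: contra_notN nET => /eqP <-.
  exists (g t); split.
  - by rewrite -subr_eq0 -normc_eq0 gB mulf_neq0 ?gt_eqF// normr_gt0 subr_eq0.
  - rewrite gB -ltr_pdivlMr// distrC ger0_norm ?subr_ge0//.
    by rewrite ltrBlDr -ltrBlDl.
  - by have [_ [e' e'0 ->//]] := Et; rewrite subrr normc0.
have [e e0 Fe] := ET.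
have near t : `|t - T| * normc (w - z) < e / 2 -> vanishes_near F (g t).
  move=> tT; exists (e / 2); first by rewrite divr_gt0.
  move=> y yt; apply: Fe.
  rewrite -(subrK (g t) y) -addrA (le_lt_trans (le_normcD _ _))// gB.
  by rewrite [ltRHS]splitr ltrD.
(* If T < 1, a parameter beyond T contradicts the definition of T. *)
have [T1'|] := ltP T 1; last first.
  move=> T1'; have {}T1' : T = 1 by apply/eqP; rewrite eq_le T1.
  by move: ET; rewrite T1' /g mul1r addrC subrK.
pose t := Num.min 1 (T + e / (4 * normc (w - z))).
have eta0 : 0 < e / (4 * normc (w - z)) by rewrite divr_gt0// mulr_gt0.
have tT : T < t by rewrite lt_min T1'/= ltrDl.
suff /(ub_le_sup supE.2) : E t by rewrite -/T leNgt tT.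
split; first by rewrite (le_trans T0 (ltW tT))/= ge_min lexx.
apply: near; rewrite gtr0_norm ?subr_gt0//.
apply: (@le_lt_trans _ _ (e / (4 * normc (w - z)) * normc (w - z))).
  by rewrite ler_pM2r// lerBlDl ge_min lexx orbT.
rewrite [ltLHS](_ : _ = e / 4); last by field; rewrite gt_eqF.
by rewrite ltr_pM2l// ltf_pV2 ?posrE//; lra.
Qed.

Lemma analyticD F G z : analytic_at F z -> analytic_at G z ->
  analytic_at (fun w => F w + G w) z.
Proof.
move=> [a [r [r0 aF]]] [b [r' [r'0 bG]]].
exists (fun n => a n + b n), (Num.min r r'); split; first by rewrite lt_min r0.
move=> w; rewrite lt_min => /andP[wr wr'].
have := cvgCD (aF w wr) (bG w wr'); congr cvgC; apply/funext => n.
by rewrite -big_split; apply: eq_bigr => k _; rewrite mulrDl.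
Qed.

Lemma analyticZ (c : R[i]) F z : analytic_at F z -> analytic_at (fun w => c * F w) z.
Proof.
move=> [a [r [r0 aF]]]; exists (fun n => c * a n), r; split=> // w wr.
have := cvgCM (cvgC_cst c) (aF w wr); congr cvgC; apply/funext => n.
by rewrite mulr_sumr; apply: eq_bigr => k _; rewrite mulrA.
Qed.

(** The series of the product is that of F with shifted coefficients. *)
Lemma analytic_shift F z : analytic_at F z ->
  analytic_at (fun w => (w - z) * F w) z.
Proof.
move=> [a [r [r0 aF]]].
exists (fun n => if n is m.+1 then a m else 0), r; split=> // w wr.
suff h : cvgC (fun n => \sum_(k < n.+1) (if k : nat is m.+1 then a m else 0) *
    (w - z) ^+ k) ((w - z) * F w).
  by apply/cvgCP; move/cvgCP: h => [h1 h2]; split; rewrite -(cvg_shiftS (fun n => _ (\sum_(k < n) _))).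
have := cvgCM (cvgC_cst (w - z)) (aF w wr); congr cvgC; apply/funext => n.
rewrite big_ord_recl mul0r add0r mulr_sumr; apply: eq_bigr => k _ /=.
by rewrite /bump /= add1n exprS mulrCA.
Qed.

Lemma analytic_cst (c : R[i]) z : analytic_at (fun=> c) z.
Proof.
exists (fun n => if n is 0%N then c else 0), 1; split=> // w _.
apply: (@cvgC_squeeze _ _ _ (fun=> 0)); last exact: cvg_cst.
exists 1%N => // n /= n0; case: n n0 => // n _.
rewrite big_ord_recl/= expr0 mulr1 big1 ?addr0 ?subrr ?normc0// => k _.
by rewrite mul0r.
Qed.

(** As w = (w - z) + z. *)
Lemma analyticMl F z : analytic_at F z -> analytic_at (fun w => w * F w) z.
Proof.
move=> Fz; have := analyticD (analytic_shift Fz) (analyticZ z Fz).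
by congr analytic_at; apply/funext => w; rewrite -mulrDl subrK.
Qed.

(** Geometric series in (w - z)/(c - z), valid up to the pole. *)
Lemma analytic_inv (c z : R[i]) : z != c -> analytic_at (fun w => (w - c)^-1) z.
Proof.
move=> zc; have d0 : 0 < normc (z - c) by rewrite normc_gt0 subr_eq0.
have zc0 : z - c != 0 by rewrite subr_eq0.
exists (fun n => (z - c)^-1 * (- (z - c)^-1) ^+ n), (normc (z - c)); split=> // w wz.
pose q := - (z - c)^-1 * (w - z).
have nq : normc q < 1.
  by rewrite normcM normcN normcV mulrC ltr_pdivrMr// mul1r.
have wc0 : w - c != 0.
  rewrite subr_eq0; apply/eqP => wc.
  by move: wz; rewrite wc normcB ltxx.
apply: (@cvgC_squeeze _ _ _ (fun n => (normc (w - c))^-1 * normc q ^+ n)); last first.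
  rewrite -(mulr0 (normc (w - c))^-1); apply: cvgM; first exact: cvg_cst.
  by apply: cvg_expr; rewrite ger0_norm ?normc_ge0.
apply: nearW => n; rewrite le_eqVlt; apply/orP; left; apply/eqP.
rewrite -normcV -normcX -normcM -normcN; congr normc.
have -> : \sum_(k < n) (z - c)^-1 * (- (z - c)^-1) ^+ k * (w - z) ^+ k =
   (w - c)^-1 * (1 - q ^+ n).
  have -> : 1 - q ^+ n = (1 - q) * \sum_(k < n) q ^+ k.
    by rewrite -opprB subrX1 -mulNr opprB.
  have -> : 1 - q = (w - c) / (z - c) by rewrite /q; field.
  rewrite mulrA mulrA mulVf// mul1r mulr_sumr; apply: eq_bigr => k _.
  by rewrite exprMn mulrA.
ring.
Qed.

End PowerSeries.

(** * Complex integrals and the two-sided Laplace transform *)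

Section ComplexIntegral.
Context {R : realType}.
Local Notation mu := (@lebesgue_measure R).
Implicit Types (F G : R -> R[i]) (h g : R -> R) (s z c : R[i]) (u : R).

Definition CL1 F := L1 (fun u => Re (F u)) /\ L1 (fun u => Im (F u)).
Definition CInt F : R[i] :=
  Complex (Int (fun u => Re (F u))) (Int (fun u => Im (F u))).

Lemma eq_CInt F G : F =1 G -> CInt F = CInt G.
Proof. by move=> /funext ->. Qed.

Lemma eq_CL1 F G : F =1 G -> CL1 F -> CL1 G.
Proof. by move=> /funext ->. Qed.

Lemma CL1_le F g : measurable_fun setT (fun u => Re (F u)) ->
  measurable_fun setT (fun u => Im (F u)) -> L1 g ->
  (forall u, normc (F u) <= g u) -> CL1 F.
Proof.
move=> mR mI gi Fg; split; apply: (@L1_le _ _ g) => // u.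
  exact: le_trans (norm_Re_le _) (Fg u).
exact: le_trans (norm_Im_le _) (Fg u).
Qed.

Lemma CL1D F G : CL1 F -> CL1 G -> CL1 (fun u => F u + G u).
Proof.
move=> [F1 F2] [G1 G2]; split.
  by apply: eq_L1 (L1D F1 G1) => u; rewrite ReD.
by apply: eq_L1 (L1D F2 G2) => u; rewrite ImD.
Qed.

Lemma CIntD F G : CL1 F -> CL1 G -> CInt (fun u => F u + G u) = CInt F + CInt G.
Proof.
move=> [F1 F2] [G1 G2]; apply: complex_eq; rewrite ?ReD ?ImD /= -IntD//.
  by apply: eq_Int => u; rewrite ReD.
by apply: eq_Int => u; rewrite ImD.
Qed.

Lemma CL1Z c F : CL1 F -> CL1 (fun u => c * F u).
Proof.
move=> [F1 F2]; split.
  by apply: eq_L1 (L1B (L1Z (Re c) F1) (L1Z (Im c) F2)) => u; rewrite ReM.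
by apply: eq_L1 (L1D (L1Z (Re c) F2) (L1Z (Im c) F1)) => u; rewrite ImM.
Qed.

Lemma CIntZ c F : CL1 F -> CInt (fun u => c * F u) = c * CInt F.
Proof.
move=> [F1 F2]; apply: complex_eq; rewrite ?ReM ?ImM /= -!IntZ//.
  rewrite -IntB; [|exact: L1Z..].
  by apply: eq_Int => u; rewrite ReM.
rewrite -IntD; [|exact: L1Z..].
by apply: eq_Int => u; rewrite ImM.
Qed.

Lemma CInt0 : CInt (fun=> 0) = 0.
Proof. by apply: complex_eq; rewrite /= Int0. Qed.

Lemma CL1_sum n (F : nat -> R -> R[i]) : (forall k, CL1 (F k)) ->
  CL1 (fun u => \sum_(k < n) F k u).
Proof.
move=> Fi; elim: n => [|n ih].
  by apply: (@eq_CL1 (fun=> 0)) => [u|]; [rewrite big_ord0|split; exact: L1_0].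
by apply: eq_CL1 (CL1D ih (Fi n)) => u; rewrite big_ord_recr.
Qed.

Lemma CInt_sum n (F : nat -> R -> R[i]) : (forall k, CL1 (F k)) ->
  CInt (fun u => \sum_(k < n) F k u) = \sum_(k < n) CInt (F k).
Proof.
move=> Fi; elim: n => [|n ih].
  by rewrite big_ord0 -[RHS]CInt0; apply: eq_CInt => u; rewrite big_ord0.
rewrite big_ord_recr/= -ih -(CIntD (CL1_sum n Fi) (Fi n)).
by apply: eq_CInt => u; rewrite big_ord_recr.
Qed.

(** Real and imaginary parts are bounded separately, whence the factor 2. *)
Lemma normc_CInt_le F g : CL1 F -> L1 g -> (forall u, normc (F u) <= g u) ->
  normc (CInt F) <= Int g *+ 2.
Proof.
move=> [F1 F2] gi Fg; apply: le_trans (normc_le _) _; rewrite mulr2n /=.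
apply: lerD; apply: le_trans (le_norm_Int _) _ => //; apply: le_Int => //.
- exact: L1_norm.
- by move=> u; exact: le_trans (norm_Re_le _) (Fg u).
- exact: L1_norm.
- by move=> u; exact: le_trans (norm_Im_le _) (Fg u).
Qed.

Lemma CInt_dominated_cvg (F_ : nat -> R -> R[i]) F g : (forall n, CL1 (F_ n)) -> CL1 F ->
  L1 g -> (forall u, cvgC (F_ ^~ u) (F u)) -> (forall n u, normc (F_ n u) <= g u) ->
  cvgC (fun n => CInt (F_ n)) (CInt F).
Proof.
move=> F_i Fi gi F_F F_g; apply/cvgCP; split => /=.
  have [] := @dominated_cvg _ (fun n u => Re (F_ n u)) (fun u => Re (F u)) g => //.
  - by move=> n; exact: L1_measurable (F_i n).1.
  - exact: L1_measurable Fi.1.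
  - by apply: aeW => u; have /cvgCP[] := F_F u.
  - by move=> n u; exact: le_trans (norm_Re_le _) (F_g n u).
have [] := @dominated_cvg _ (fun n u => Im (F_ n u)) (fun u => Im (F u)) g => //.
- by move=> n; exact: L1_measurable (F_i n).2.
- exact: L1_measurable Fi.2.
- by apply: aeW => u; have /cvgCP[] := F_F u.
- by move=> n u; exact: le_trans (norm_Im_le _) (F_g n u).
Qed.

(** Half-open intervals and one-sided indicators differ at one point, which
    integrals ignore. *)
Lemma eq_Int_except (a : R) f g : measurable_fun setT f -> measurable_fun setT g ->
  (forall x, x != a -> f x = g x) -> Int f = Int g.
Proof.
move=> mf mg fg; rewrite /Int /Rintegral; congr fine.
apply: ae_eq_integral => //; [exact/measurable_EFinP..|].
exists [set a]; split=> //; first exact: lebesgue_measure_set1.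
move=> x /= nx; apply/eqP/negP => /negP xa; apply: nx => _ /=.
by rewrite fg.
Qed.

Definition lap_fun h s u : R[i] := toC (h u) * cexp (s * toC u).
Definition laplace h s := CInt (lap_fun h s).

(** Absolute convergence of the Laplace integral on the line Re s = sigma. *)
Definition lap_conv h (sigma : R) := L1 (fun u => h u * expR (sigma * u)).

Lemma Re_lap_fun h s u : Re (lap_fun h s u) = h u * (expR (Re s * u) * cos (Im s * u)).
Proof. by rewrite /lap_fun ReM /= ReM ImM /= !mulr0 mul0r !subr0 add0r. Qed.

Lemma Im_lap_fun h s u : Im (lap_fun h s u) = h u * (expR (Re s * u) * sin (Im s * u)).
Proof. by rewrite /lap_fun ImM /= ReM ImM /= !mulr0 mul0r subr0 add0r addr0. Qed.

Lemma normc_lap_fun h s u : normc (lap_fun h s u) = `|h u * expR (Re s * u)|.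
Proof.
rewrite /lap_fun normcM normcR normc_cexp normrM (ger0_norm (expR_ge0 _)).
by rewrite ReM /= mulr0 subr0.
Qed.

Lemma measurable_lin (c : R) : measurable_fun setT (fun u : R => c * u).
Proof. exact: measurable_funM. Qed.

Lemma measurable_sin : measurable_fun setT (@sin R).
Proof. by apply: continuous_measurable_fun => x; exact: continuous_sin. Qed.

Lemma measurable_cos : measurable_fun setT (@cos R).
Proof. by apply: continuous_measurable_fun => x; exact: continuous_cos. Qed.

Lemma measurable_expR_lin (c : R) : measurable_fun setT (fun u : R => expR (c * u)).
Proof. by apply: measurableT_comp => //; exact: measurable_lin. Qed.

Lemma lap_conv_measurable h sigma : lap_conv h sigma -> measurable_fun setT h.
Proof.
move=> /L1_measurable mh.
have : measurable_fun setT (fun u => h u * expR (sigma * u) * expR (- sigma * u)).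
  by apply: measurable_funM => //; exact: measurable_expR_lin.
apply: eq_measurable_fun => u _.
by rewrite -mulrA -expRD mulNr subrr expR0 mulr1.
Qed.

Lemma measurable_lap_fun h s : measurable_fun setT h ->
  measurable_fun setT (fun u => Re (lap_fun h s u)) /\
  measurable_fun setT (fun u => Im (lap_fun h s u)).
Proof.
move=> mh; split.
  under eq_fun do rewrite Re_lap_fun.
  apply: measurable_funM => //; apply: measurable_funM; first exact: measurable_expR_lin.
  by apply: measurableT_comp; [exact: measurable_cos|exact: measurable_lin].
under eq_fun do rewrite Im_lap_fun.
apply: measurable_funM => //; apply: measurable_funM; first exact: measurable_expR_lin.
by apply: measurableT_comp; [exact: measurable_sin|exact: measurable_lin].
Qed.

Lemma lap_conv_CL1 h s : lap_conv h (Re s) -> CL1 (lap_fun h s).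
Proof.
move=> hi; have [m1 m2] := measurable_lap_fun s (lap_conv_measurable hi).
apply: (CL1_le m1 m2 (L1_norm hi)) => u.
by rewrite normc_lap_fun.
Qed.

(** An exponential is at most the sum of those at the ends of the strip. *)
Lemma lap_conv_between h (a b c : R) : a <= c <= b ->
  lap_conv h a -> lap_conv h b -> lap_conv h c.
Proof.
move=> /andP[ac cb] ha hb.
apply: (L1_le _ _ (L1D (L1_norm ha) (L1_norm hb))).
  apply: measurable_funM; [exact: lap_conv_measurable ha|exact: measurable_expR_lin].
move=> u; rewrite !normrM -mulrDr ler_wpM2l// !(ger0_norm (expR_ge0 _)).
have [u0|u0] := leP 0 u.
  rewrite (@le_trans _ _ (expR (b * u)))// ?lerDr ?expR_ge0//.
  by rewrite ler_expR ler_wpM2r.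
rewrite (@le_trans _ _ (expR (a * u)))// ?lerDl ?expR_ge0//.
by rewrite ler_expR ler_wnM2r// ltW.
Qed.

Lemma lap_conv_le h g sigma : measurable_fun setT h ->
  (forall u, `|h u| <= g u) -> lap_conv g sigma -> lap_conv h sigma.
Proof.
move=> mh hg; apply: L1_le.
  by apply: measurable_funM => //; exact: measurable_expR_lin.
by move=> u; rewrite normrM (ger0_norm (expR_ge0 _)) ler_wpM2r// expR_ge0.
Qed.

Lemma lap_convD h g sigma : lap_conv h sigma -> lap_conv g sigma ->
  lap_conv (fun u => h u + g u) sigma.
Proof. by move=> h1 g1; apply: eq_L1 (L1D h1 g1) => u; rewrite mulrDl. Qed.

Lemma lap_convZ (c : R) h sigma : lap_conv h sigma -> lap_conv (fun u => c * h u) sigma.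
Proof. by move=> /(L1Z c); apply: eq_L1 => u; rewrite mulrA. Qed.

Lemma laplaceD h g s : lap_conv h (Re s) -> lap_conv g (Re s) ->
  laplace (fun u => h u + g u) s = laplace h s + laplace g s.
Proof.
move=> hi gi; rewrite -CIntD; [|exact: lap_conv_CL1..].
by apply: eq_CInt => u; rewrite /lap_fun rmorphD mulrDl.
Qed.

Lemma laplaceZ (c : R) h s : lap_conv h (Re s) ->
  laplace (fun u => c * h u) s = toC c * laplace h s.
Proof.
move=> hi; rewrite -CIntZ; last exact: lap_conv_CL1.
by apply: eq_CInt => u; rewrite /lap_fun rmorphM mulrA.
Qed.

Lemma laplace_neg h s : lap_conv h (Re s) ->
  laplace h s = laplace (fun u => h (- u)) (- s).
Proof.
move=> hi; have [c1 c2] := lap_conv_CL1 hi.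
rewrite /laplace /CInt; congr Complex.
  rewrite (Int_neg c1).2; apply: eq_Int => u.
  by rewrite !Re_lap_fun ReN ImN !mulrN !mulNr.
rewrite (Int_neg c2).2; apply: eq_Int => u.
by rewrite !Im_lap_fun ReN ImN !mulrN !mulNr.
Qed.

Lemma lap_conv_neg h sigma : lap_conv h sigma -> lap_conv (fun u => h (- u)) (- sigma).
Proof. by move=> /Int_neg[+ _]; apply: eq_L1 => u; rewrite mulrN mulNr. Qed.

(** Expand cexp ((s - s0) u) and integrate termwise: the partial sums are at most
    exp (rho |u|), and exp (Re s0 u + rho |u|) is at most the sum of the
    exponentials at both ends of the strip. *)
Lemma laplace_analytic h s0 (rho : R) : 0 < rho ->
  lap_conv h (Re s0 - rho) -> lap_conv h (Re s0 + rho) ->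
  analytic_at (laplace h) s0.
Proof.
move=> rho0 hm hp.
pose g u := `|h u * expR ((Re s0 - rho) * u)| + `|h u * expR ((Re s0 + rho) * u)|.
have gi : L1 g by apply: L1D; exact: L1_norm.
have conv (sigma : R) : Re s0 - rho <= sigma <= Re s0 + rho -> lap_conv h sigma.
  by move=> /lap_conv_between; exact.
have h0 : lap_conv h (Re s0) by apply: conv; rewrite gerBl lerDl ltW.
have dom (q : R) u : 0 <= q -> q <= rho ->
    `|h u * expR (Re s0 * u)| * expR (q * `|u|) <= g u.
  move=> q0 qr; rewrite /g !normrM !(ger0_norm (expR_ge0 _)) -mulrA -mulrDr.
  rewrite ler_wpM2l// -expRD.
  have [u0|u0] := leP 0 u.
    rewrite (le_trans _ (_ : expR ((Re s0 + rho) * u) <= _))// ?lerDr ?expR_ge0//.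
    by rewrite ler_expR mulrDl lerD2l ger0_norm// ler_wpM2r.
  rewrite (le_trans _ (_ : expR ((Re s0 - rho) * u) <= _))// ?lerDl ?expR_ge0//.
  by rewrite ler_expR mulrBl lerD2l ltr0_norm// mulrN lerN2 ler_wnM2r// ltW.
pose T n u : R[i] := lap_fun h s0 u * ((toC u) ^+ n / n`!%:R).
have TE n u : T n u = toC (u ^+ n / n`!%:R) * lap_fun h s0 u.
  by rewrite /T mulrC rmorphM rmorphXn /= fmorphV rmorph_nat.
have Ti n : CL1 (T n).
  have [m1 m2] := lap_conv_CL1 h0.
  apply: (@CL1_le _ (fun u => rho ^- n * g u)).
  - rewrite [X in measurable_fun _ X](_ : _ = fun u => u ^+ n / n`!%:R * Re (lap_fun h s0 u)); last first.
      by apply/funext => u; rewrite TE Re_scale.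
    apply: measurable_funM; last exact: L1_measurable m1.
    by apply: measurable_funM => //; exact: measurable_funX.
  - rewrite [X in measurable_fun _ X](_ : _ = fun u => u ^+ n / n`!%:R * Im (lap_fun h s0 u)); last first.
      by apply/funext => u; rewrite TE Im_scale.
    apply: measurable_funM; last exact: L1_measurable m2.
    by apply: measurable_funM => //; exact: measurable_funX.
  - exact: L1Z.
  - move=> u; rewrite TE normcM normcR normc_lap_fun normrM normfV normrX.
    rewrite (ger0_norm (ler0n _ _)) ler_pdivlMl ?exprn_gt0//.
    apply: le_trans (dom rho u (ltW rho0) (lexx _)).
    rewrite mulrA [X in _ <= X]mulrC ler_wpM2r// mulrA -exprMn.
    have ru0 : 0 <= rho * `|u| by rewrite mulr_ge0// ltW.
    apply: le_trans (expR_series_le n.+1 ru0).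
    rewrite big_ord_recr/= lerDr sumr_ge0// => k _.
    by rewrite divr_ge0// exprn_ge0.
exists (fun n => CInt (T n)), rho; split=> // s srho.
set q := normc (s - s0); have q0 : 0 <= q by exact: normc_ge0.
have Fs : lap_conv h (Re s).
  apply: conv; rewrite lerBlDl -lerBlDr -[X in X <= _ + _](subrK (Re s0)).
  have : `|Re (s - s0)| <= rho := le_trans (norm_Re_le _) (ltW srho).
  rewrite ReD ReN ler_norml => /andP[]; lra.
pose S n u := \sum_(k < n) (s - s0) ^+ k * T k u.
have Sn n : \sum_(k < n) CInt (T k) * (s - s0) ^+ k = CInt (S n).
  rewrite /S (@CInt_sum n (fun k u => (s - s0) ^+ k * T k u)); last first.
    by move=> k; exact: CL1Z.
  by apply: eq_bigr => k _; rewrite mulrC CIntZ.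
have SE n u : S n u = lap_fun h s0 u * \sum_(k < n) ((s - s0) * toC u) ^+ k / k`!%:R.
  by rewrite /S mulr_sumr; apply: eq_bigr => k _; rewrite /T exprMn; ring.
rewrite /cseries_to; under eq_fun do rewrite Sn.
apply: (@CInt_dominated_cvg S (lap_fun h s) g).
- move=> n; apply: (@CL1_sum n (fun k u => (s - s0) ^+ k * T k u)) => k.
  exact: CL1Z.
- exact: lap_conv_CL1.
- exact: gi.
- move=> u; have -> : lap_fun h s u = lap_fun h s0 u * cexp ((s - s0) * toC u).
    by rewrite /lap_fun -mulrA -cexpD; congr (_ * cexp _); ring.
  have := cvgCM (cvgC_cst (lap_fun h s0 u)) (cexp_series ((s - s0) * toC u)).
  by congr cvgC; apply/funext => n; rewrite SE.
- move=> n u; rewrite SE normcM normc_lap_fun.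
  apply: le_trans (dom q u q0 (ltW srho)); rewrite ler_wpM2l//.
  by apply: le_trans (cexp_psum_le ((s - s0) * toC u) n) _; rewrite normcM normcR.
Qed.
End ComplexIntegral.

(** * The zeta function as a Laplace transform *)

Section Zeta.
Context {R : realType}.
Local Notation mu := (@lebesgue_measure R).
Implicit Types (s z c : R[i]) (u : R).

Lemma indic_cc (a b u : R) : \1_`[a, b] u = (a <= u <= b)%R%:R :> R.
Proof. by rewrite indicE mem_setE in_itv. Qed.

Lemma indic_co (a b u : R) : \1_`[a, b[ u = (a <= u < b)%R%:R :> R.
Proof. by rewrite indicE mem_setE in_itv. Qed.

Lemma indic_Nyc (b u : R) : \1_`]-oo, b] u = (u <= b)%R%:R :> R.
Proof. by rewrite indicE mem_setE in_itv. Qed.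

Lemma indic_cy (a u : R) : \1_`[a, +oo[ u = (a <= u)%R%:R :> R.
Proof. by rewrite indicE mem_setE in_itv/= andbT. Qed.

Lemma measurable_frac_part : measurable_fun setT (@frac_part R).
Proof.
apply: measurable_funB => //; rewrite -[X in measurable_fun X](setTI setT).
move=> mT; apply: (measurability _ (RGenCInfty.measurableE R)) => //.
move=> /= _ [_ [a ->] <-]; rewrite setIT setTI.
rewrite [X in measurable X](_ : _ = `[(Num.ceil a)%:~R, +oo[%classic).
  exact: measurable_itv.
apply/seteqP; split => x /=; rewrite !in_itv/= !andbT.
  by rewrite -ceil_le_int -floor_ge_int.
by rewrite -floor_ge_int ceil_le_int.
Qed.

Lemma frac_part_ge0 (y : R) : 0 <= frac_part y.
Proof. by rewrite subr_ge0 floor_le. Qed.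

Lemma frac_part_lt1 (y : R) : frac_part y < 1.
Proof. by rewrite /frac_part ltrBlDr addrC -intrD1 floorD1_gt. Qed.

Lemma frac_part_le (y : R) : 0 <= y -> frac_part y <= y.
Proof. by move=> y0; rewrite gerBl ler0z floor_ge0. Qed.

Lemma frac_partE (y : R) (n : nat) : n%:R <= y < n.+1%:R -> frac_part y = y - n%:R.
Proof.
move=> yn; rewrite /frac_part (@floor_def _ _ n)//.
by rewrite -[n%:~R]/(n%:R) intrD1 -natr1 in yn *.
Qed.

(** The elementary kernel, of transform 1/s on Re s > 0 ([laplace_hlf]). *)
Definition hlf u : R := \1_`]-oo, 0] u.

Lemma cexp_linE z u : cexp (z * toC u) =
  Complex (expR (Re z * u) * cos (Im z * u)) (expR (Re z * u) * sin (Im z * u)).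
Proof.
by rewrite /cexp ReM ImM [Re (toC u)]/= [Im (toC u)]/= !mulr0 subr0 add0r.
Qed.

Lemma cexp_toC u : cexp (toC u) = toC (expR u).
Proof. by rewrite /cexp /= cos0 sin0 mulr1 mulr0. Qed.

Lemma normc_cexp_lin z u : normc (cexp (z * toC u)) = expR (Re z * u).
Proof. by rewrite normc_cexp ReM [Im (toC u)]/= [Re (toC u)]/= mulr0 subr0. Qed.

Lemma is_derive_cexp z u :
  is_derive u 1 (fun u => expR (Re z * u) * cos (Im z * u))
    (Re (z * cexp (z * toC u))) /\
  is_derive u 1 (fun u => expR (Re z * u) * sin (Im z * u))
    (Im (z * cexp (z * toC u))).
Proof.
have e := drv_expR (drv_lin (Re z) u).
split.
  apply: is_derive_eq (drvM e (drv_cos (drv_lin (Im z) u))) _.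
  by rewrite ReM cexp_linE /=; ring.
apply: is_derive_eq (drvM e (drv_sin (drv_lin (Im z) u))) _.
by rewrite ImM cexp_linE /=; ring.
Qed.

Lemma cexp_continuous z : continuous (fun u => Re (cexp (z * toC u))) /\
  continuous (fun u => Im (cexp (z * toC u))).
Proof.
split=> u.
  by under eq_fun do rewrite cexp_linE; exact: drv_continuous (is_derive_cexp z u).1.
by under eq_fun do rewrite cexp_linE; exact: drv_continuous (is_derive_cexp z u).2.
Qed.

Lemma CInt_cexp_itv z (a b : R) : z != 0 -> a < b ->
  CL1 (fun u => toC (\1_`[a, b] u) * cexp (z * toC u)) /\
  CInt (fun u => toC (\1_`[a, b] u) * cexp (z * toC u)) =
  z^-1 * (cexp (z * toC b) - cexp (z * toC a)).
Proof.
move=> z0 ab; have [c1 c2] := cexp_continuous z.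
have Fi : CL1 (fun u => toC (\1_`[a, b] u) * cexp (z * toC u)).
  split.
    by under eq_fun do rewrite Re_scale; exact: L1_indic_itv.
  by under eq_fun do rewrite Im_scale; exact: L1_indic_itv.
split=> //; apply: (mulfI z0); rewrite mulrA divff// mul1r -CIntZ//.
have cl (x y : R) : continuous (fun u => x * Re (cexp (z * toC u)) + y * Im (cexp (z * toC u))).
  move=> u; apply: cvgD; apply: cvgM; try exact: cvg_cst.
    exact: c1.
  exact: c2.
apply: complex_eq; rewrite ?ReD ?ImD ?ReN ?ImN /CInt.
  rewrite [LHS]/= (@eq_Int _ _ (fun u => \1_`[a, b] u * Re (z * cexp (z * toC u)))).
    rewrite (Int_derive_itv ab (fun u => (is_derive_cexp z u).1)).
      by rewrite !cexp_linE.
    by under eq_fun do rewrite ReM -mulNr; exact: cl.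
  by move=> u; rewrite mulrCA Re_scale.
rewrite [LHS]/= (@eq_Int _ _ (fun u => \1_`[a, b] u * Im (z * cexp (z * toC u)))).
  rewrite (Int_derive_itv ab (fun u => (is_derive_cexp z u).2)).
    by rewrite !cexp_linE.
  by under eq_fun do rewrite ImM addrC; exact: cl.
by move=> u; rewrite mulrCA Im_scale.
Qed.

Lemma lap_conv_hlf (sigma : R) : 0 < sigma -> lap_conv hlf sigma.
Proof.
move=> s0; have [h _] := Int_neg (L1_exp_half s0); apply: eq_L1 h => u.
by rewrite /hlf indic_cy indic_Nyc oppr_ge0 mulrN opprK.
Qed.

Lemma laplace_hlf s : 0 < Re s -> laplace hlf s = s^-1.
Proof.
move=> s0; have hi := lap_conv_CL1 (lap_conv_hlf s0).
have sn0 : s != 0 by apply: contraTneq s0 => ->; rewrite ltxx.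
pose F n u := toC (\1_`[- n.+1%:R, 0] u) * cexp (s * toC u).
have lt n : - n.+1%:R < 0 :> R by rewrite oppr_lt0.
have FE n u : F n u = toC (\1_`[- n.+1%:R, 0] u) * lap_fun hlf s u.
  rewrite /F /lap_fun /hlf indic_cc indic_Nyc.
  by have [u0|] := leP u 0; rewrite ?andbF ?andbT ?rmorph1 ?mul1r// ?rmorph0 ?mul0r.
have h1 : cvgC (fun n => CInt (F n)) (laplace hlf s).
  apply: (@CInt_dominated_cvg _ F (lap_fun hlf s) (fun u => `|hlf u * expR (Re s * u)|)) => //.
  - by move=> n; exact: (CInt_cexp_itv sn0 (lt n)).1.
  - exact: L1_norm (lap_conv_hlf s0).
  - move=> u; apply: (@cvgC_squeeze _ _ _ (fun=> 0)); last exact: cvg_cst.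
    near=> n; rewrite FE /lap_fun /hlf indic_cc indic_Nyc.
    have [u0|u0] := leP u 0; last by rewrite rmorph0 !mul0r mulr0 subrr normc0.
    rewrite andbT (_ : - n.+1%:R <= u) ?rmorph1 ?mul1r ?subrr ?normc0//.
    rewrite lerNl -natr1 ler_wpDr//; near: n; exact: nbhs_infty_ger.
  - move=> n u; rewrite FE normcM normcR normc_lap_fun ler_piMl//.
    by rewrite indic_cc ger0_norm// lern1 leq_b1.
apply: (cvgC_unique h1); under eq_fun do rewrite (CInt_cexp_itv sn0 (lt _)).2.
have h2 : cvgC (fun n => cexp (s * toC (- n.+1%:R))) 0.
  apply: (@cvgC_squeeze _ _ _ (fun n => expR (- (Re s * n.+1%:R)))).
    by apply: nearW => n; rewrite subr0 normc_cexp_lin mulrN.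
  apply: (@cvg_comp _ _ _ (fun n : nat => n.+1%:R : R)
      (fun x => expR (- (Re s * x))) _ (pinfty_nbhs R)); last exact: cvg_expR_decay.
  by rewrite (cvg_shiftS (fun n => n%:R : R)); exact: cvgr_idn.
have := cvgCM (cvgC_cst s^-1) (cvgCD (cvgC_cst (cexp (s * toC 0)))
  (cvgCM (cvgC_cst (-1)) h2)).
rewrite rmorph0 !mulr0 addr0 cexp0 mulr1.
by congr cvgC; apply/funext => n; rewrite mulN1r.
Unshelve. all: by end_near. Qed.

(** Half-open intervals tile the line, and the integer part of exp u is constant on
    those between consecutive ln k. *)
Lemma CInt_cexp_ico z (a b : R) : z != 0 -> a < b ->
  CL1 (fun u => toC (\1_`[a, b[ u) * cexp (z * toC u)) /\
  CInt (fun u => toC (\1_`[a, b[ u) * cexp (z * toC u)) =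
  z^-1 * (cexp (z * toC b) - cexp (z * toC a)).
Proof.
move=> z0 ab; have [[i1 i2] <-] := CInt_cexp_itv z0 ab.
have [c1 c2] := cexp_continuous z.
have mi : measurable_fun setT (\1_`[a, b[ : R -> R) by exact: measurable_indic.
have E u : u != b -> \1_`[a, b[ u = \1_`[a, b] u :> R.
  by move=> ub; rewrite indic_cc indic_co lt_neqAle ub.
have m1 : measurable_fun setT (fun u => \1_`[a, b[ u * Re (cexp (z * toC u))).
  by apply: measurable_funM => //; exact: continuous_measurable_fun.
have m2 : measurable_fun setT (fun u => \1_`[a, b[ u * Im (cexp (z * toC u))).
  by apply: measurable_funM => //; exact: continuous_measurable_fun.
split.
  have le u : \1_`[a, b[ u <= \1_`[a, b] u :> R.
    rewrite indic_cc indic_co ler_nat.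
    by have [/ltW ub|_] := ltP u b; [rewrite ub|rewrite andbF].
  have ge u : 0 <= \1_`[a, b[ u :> R by rewrite indic_co.
  split; [apply: (L1_le _ _ (L1_norm i1)) | apply: (L1_le _ _ (L1_norm i2))].
  - by under eq_fun do rewrite Re_scale.
  - move=> u; rewrite !Re_scale !normrM ler_wpM2r//.
    by rewrite !ger0_norm ?(le_trans (ge u)).
  - by under eq_fun do rewrite Im_scale.
  - move=> u; rewrite !Im_scale !normrM ler_wpM2r//.
    by rewrite !ger0_norm ?(le_trans (ge u)).
rewrite /CInt; congr Complex.
  under eq_Int do rewrite Re_scale.
  apply: (@eq_Int_except _ b) => //; first exact: L1_measurable i1.
  by move=> u /E ub; rewrite Re_scale ub.
under eq_Int do rewrite Im_scale.
apply: (@eq_Int_except _ b) => //; first exact: L1_measurable i2.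
by move=> u /E ub; rewrite Im_scale ub.
Qed.

(** With x = exp u and t = exp v, the fractional part of x/t is [fracker (v - u)]. *)
Definition fracker u : R := frac_part (expR (- u)).
(** On u > 0 the kernel is exp (- u), whose transform 1/(1 - s) has the pole at 1;
    the transform of the remaining part converges for Re s > 0. *)
Definition fracker_left u : R := hlf u * fracker u.

Lemma hlf01 u : 0 <= hlf u <= 1.
Proof. by rewrite /hlf indic_Nyc ler0n lern1 leq_b1. Qed.

Lemma measurable_hlf : measurable_fun setT hlf.
Proof. exact: measurable_indic. Qed.

Lemma measurable_fracker : measurable_fun setT fracker.
Proof.
apply: measurableT_comp; first exact: measurable_frac_part.
exact: measurableT_comp.
Qed.

Lemma measurable_fracker_left : measurable_fun setT fracker_left.
Proof. by apply: measurable_funM; [exact: measurable_hlf|exact: measurable_fracker]. Qed.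

Lemma fracker01 u : 0 <= fracker u <= 1.
Proof. by rewrite frac_part_ge0 ltW// frac_part_lt1. Qed.

Lemma lap_conv_fracker_left (sigma : R) : 0 < sigma -> lap_conv fracker_left sigma.
Proof.
move=> s0; apply: lap_conv_le (lap_conv_hlf s0); first exact: measurable_fracker_left.
move=> u; have /andP[h0 h1] := hlf01 u; have /andP[f0 f1] := fracker01 u.
by rewrite /fracker_left ger0_norm ?mulr_ge0// ler_piMr.
Qed.

Lemma fracker_split u : u != 0 ->
  fracker u = fracker_left u + hlf (- u) * expR (- u).
Proof.
move=> u0; rewrite /fracker_left /hlf !indic_Nyc oppr_le0.
have [lu|gu] := leP u 0; rewrite ?mul1r ?mul0r.
  by rewrite leNgt lt_neqAle u0 lu/= mul0r addr0.
rewrite ltW// mul1r add0r /fracker (@frac_partE _ 0) ?subr0// expR_ge0/=.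
by rewrite expR_lt1 oppr_lt0.
Qed.

(** This is the part of the kernel on the right half-line. *)
Lemma lap_conv_right (sigma : R) : sigma < 1 ->
  lap_conv (fun u => hlf (- u) * expR (- u)) sigma.
Proof.
move=> s1; have s0 : 0 < 1 - sigma by rewrite subr_gt0.
apply: eq_L1 (lap_conv_neg (lap_conv_hlf s0)) => u.
by rewrite -mulrA -expRD; congr (_ * expR _); ring.
Qed.

Lemma lap_conv_fracker (sigma : R) : 0 < sigma < 1 -> lap_conv fracker sigma.
Proof.
move=> /andP[s0 s1].
apply: (lap_conv_le measurable_fracker _ (lap_convD (lap_conv_hlf s0) (lap_conv_right s1))).
move=> u; have /andP[f0 f1] := fracker01 u; rewrite ger0_norm//.
rewrite /hlf !indic_Nyc oppr_le0; have [lu|gu] := leP u 0; rewrite ?mul1r ?mul0r.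
  by rewrite (le_trans f1)// lerDl mulr_ge0// expR_ge0.
by rewrite (ltW gu) mul1r add0r frac_part_le// expR_ge0.
Qed.

Lemma laplace_fracker s : 0 < Re s < 1 ->
  laplace fracker s = laplace fracker_left s + (1 - s)^-1.
Proof.
move=> s01; have /andP[s0 s1] := s01.
have i1 := lap_conv_fracker_left s0; have i2 := lap_conv_right s1.
have r0 : 0 < Re (1 - s) by rewrite ReD ReN subr_gt0.
transitivity (laplace (fun u => fracker_left u + hlf (- u) * expR (- u)) s).
  have mR := lap_conv_CL1 (lap_convD i1 i2 : lap_conv _ (Re s)).
  have mL := lap_conv_CL1 (lap_conv_fracker s01 : lap_conv _ (Re s)).
  rewrite /laplace /CInt; congr Complex; apply: (@eq_Int_except _ 0).
  - exact: L1_measurable mL.1.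
  - exact: L1_measurable mR.1.
  - by move=> u /fracker_split E; rewrite /lap_fun E.
  - exact: L1_measurable mL.2.
  - exact: L1_measurable mR.2.
  - by move=> u /fracker_split E; rewrite /lap_fun E.
rewrite laplaceD//; congr (_ + _).
rewrite -(laplace_hlf r0) (laplace_neg (lap_conv_hlf r0)) opprB.
apply: eq_CInt => u; rewrite /lap_fun rmorphM -mulrA; congr (_ * _).
rewrite -[_ (expR _)]cexp_toC -cexpD; congr cexp; rewrite rmorphN/=; ring.
Qed.

(** The classical formula zeta s = s/(s - 1) - s int_1^oo {x} x^(- s - 1) dx, written
    with x = exp (- u) and with the pole isolated. *)
Definition zeta_cont s := 1 + (s - 1)^-1 - s * laplace fracker_left s.

Lemma zeta_cont_analytic s : 0 < Re s -> s != 1 -> analytic_at zeta_cont s.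
Proof.
move=> s0 s1; apply: analyticD; first apply: analyticD.
- exact: analytic_cst.
- exact: analytic_inv.
have h0 : 0 < Re s / 2 by rewrite divr_gt0.
have h : analytic_at (laplace fracker_left) s.
  apply: (@laplace_analytic _ _ _ (Re s / 2)) => //; apply: lap_conv_fracker_left.
    by rewrite subr_gt0 ltr_pdivrMr// ltr_pMr// ltr1n.
  exact: addr_gt0.
have := analyticZ (-1) (analyticMl h).
by congr analytic_at; apply/funext => w; rewrite mulN1r.
Qed.

Lemma laplace_fracker_zeta_cont s : 0 < Re s < 1 ->
  laplace fracker s = - (zeta_cont s / s).
Proof.
move=> s01; rewrite laplace_fracker//; case/andP: s01 => s0 s1.
have sn0 : s != 0 by apply: contraTneq s0 => ->; rewrite ltxx.
have sn1 : s - 1 != 0.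
  by rewrite subr_eq0; apply: contraTneq s1 => ->; rewrite ltxx.
rewrite /zeta_cont -opprB invrN; move: (laplace _ _) => L.
by field; rewrite sn0 sn1.
Qed.

Lemma cvgC_unshift (v : nat -> R[i]) l : cvgC (fun n => v n.+1) l -> cvgC v l.
Proof.
move=> /cvgCP[h1 h2]; apply/cvgCP; split.
  by rewrite -(cvg_shiftS (fun n => Re (v n))).
by rewrite -(cvg_shiftS (fun n => Im (v n))).
Qed.

Section DirichletSeries.
Variable s : R[i].
Hypothesis s1 : 1 < Re s.

Let P n := cpow n.+1%:R (- s).
Let lnn n : R := ln n.+1%:R.

Let PE n : P n = cexp (- s * toC (lnn n)).
Proof. by rewrite /P cpowE. Qed.

Let cexp_1s n : cexp ((1 - s) * toC (lnn n)) = n.+1%:R * P n.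
Proof.
rewrite mulrDl cexpD -PE mul1r; congr (_ * _).
by rewrite cexp_toC lnK ?posrE// natcE.
Qed.

(* The fractional part of exp u, times exp (- s u), between ln (k+1) and ln (k+2). *)
Let G k u := toC (\1_`[lnn k, lnn k.+1[ u) * cexp ((1 - s) * toC u) +
  - k.+1%:R * (toC (\1_`[lnn k, lnn k.+1[ u) * cexp (- s * toC u)).

Let s0 : 0 < Re s. Proof. exact: lt_trans ltr01 s1. Qed.
Let sn0 : s != 0. Proof. by apply: contraTneq s0 => ->; rewrite ltxx. Qed.
Let sn1 : 1 - s != 0.
Proof. by rewrite subr_eq0 eq_sym; apply: contraTneq s1 => ->; rewrite ltxx. Qed.
Let lnn_lt k : lnn k < lnn k.+1.
Proof. by rewrite ltr_ln ?posrE// ltr_nat. Qed.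

Let G_int k : CL1 (G k) /\ CInt (G k) =
  (1 - s)^-1 * (k.+2%:R * P k.+1 - k.+1%:R * P k) +
  - k.+1%:R * ((- s)^-1 * (P k.+1 - P k)).
Proof.
have sn0' : - s != 0 by rewrite oppr_eq0.
have [i1 e1] := CInt_cexp_ico sn1 (lnn_lt k).
have [i2 e2] := CInt_cexp_ico sn0' (lnn_lt k).
split; first by apply: CL1D => //; exact: CL1Z.
rewrite CIntD//; last exact: CL1Z.
by rewrite CIntZ// e1 e2 !cexp_1s -!PE.
Qed.

Let G_sum n : \sum_(k < n) CInt (G k) = (1 - s)^-1 * (n.+1%:R * P n - 1) +
  s^-1 * (n.+1%:R * P n - \sum_(k < n.+1) P k).
Proof.
elim: n => [|n ih].
  rewrite big_ord0 big_ord_recl big_ord0 addr0 PE /lnn ln1 rmorph0 mulr0 cexp0.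
  by rewrite mulr1 subrr !mulr0 addr0.
rewrite big_ord_recr/= ih (G_int n).2 [in RHS]big_ord_recr/=.
move: (\sum_(_ < _) _) => S; rewrite -[n.+2%:R]natr1.
move: (P n) (P n.+1) (n.+1%:R : R[i]) => p q m; field.
by rewrite sn0 sn1.
Qed.

(** On the k-th interval exp u lies between the integers k + 1 and k + 2. *)
Let G_partial n u : \sum_(k < n) G k u =
  toC (\1_`[0, lnn n[ u * frac_part (expR u)) * cexp (- s * toC u).
Proof.
have cexpE : cexp ((1 - s) * toC u) = toC (expR u) * cexp (- s * toC u).
  by rewrite mulrDl mul1r cexpD cexp_toC.
elim: n => [|n ih].
  rewrite big_ord0 /lnn ln1 indic_co.
  by have [u0|u0] := leP 0 u; rewrite ?(ltNge u 0) ?u0 /= mul0r rmorph0 mul0r.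
rewrite big_ord_recr/= ih /G cexpE natcE mulrA -rmorphM -rmorphN mulrA -rmorphM.
rewrite -!mulrDl -!rmorphD; congr (toC _ * _).
have l0 : 0 <= lnn n by rewrite ln_ge0// ler1n.
rewrite !indic_co; have [un|un] := ltP u (lnn n).
  rewrite (lt_trans un (lnn_lt n)) /= andbT.
  by rewrite !mul0r mulr0 !addr0.
rewrite (le_trans l0 un)/= mul0r add0r.
have [un'|_] := ltP u (lnn n.+1); last by rewrite !mul0r mulr0 addr0.
rewrite !mul1r mulr1 (@frac_partE _ n.+1)//.
by rewrite -{1}(@lnK _ n.+1%:R) ?posrE// -{1}(@lnK _ n.+2%:R) ?posrE// ler_expR ltr_expR un.
Qed.

(** Abel summation. The function {exp u} exp (- s u) on u >= 0 is the sum of the G k,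
    on each of which the fractional part is an exponential minus an integer; the
    integrals of the G k add up to the partial sums of the Dirichlet series and a
    boundary term that vanishes in the limit because Re s > 1. *)
Lemma zeta_cont_series : cseries_to (fun n => cpow n.+1%:R (- s)) (zeta_cont s).
Proof.
have ki := lap_conv_fracker_left s0.
have ki' := lap_conv_neg ki.
have kE u : fracker_left (- u) = \1_`[0, +oo[ u * frac_part (expR u).
  by rewrite /fracker_left /fracker opprK /hlf indic_Nyc indic_cy oppr_le0.
have Jcv : cvgC (fun n => \sum_(k < n) CInt (G k)) (laplace fracker_left s).
  rewrite (laplace_neg ki).
  under eq_fun => n do rewrite -(CInt_sum n (fun k => (G_int k).1)).
  apply: (@CInt_dominated_cvg _ (fun n u => \sum_(k < n) G k u) _
      (fun u => `|fracker_left (- u) * expR (- Re s * u)|)).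
  - by move=> n; apply: CL1_sum => k; exact: (G_int k).1.
  - by apply: lap_conv_CL1; rewrite ReN.
  - exact: L1_norm ki'.
  - move=> u; apply: (@cvgC_squeeze _ _ _ (fun=> 0)); last exact: cvg_cst.
    near=> n; rewrite G_partial /lap_fun kE indic_co indic_cy.
    rewrite (_ : u < lnn n) ?andbT ?subrr ?normc0//.
    rewrite -[u]expRK ltr_ln ?posrE ?expR_gt0//.
    rewrite (lt_le_trans (_ : _ < n%:R))// ?ler_nat//.
    by near: n; exact: nbhs_infty_gtr.
  - move=> n u; rewrite G_partial normcM normcR normc_cexp_lin ReN normrM.
    rewrite normrM (ger0_norm (expR_ge0 _)) ler_wpM2r ?expR_ge0// kE normrM.
    rewrite ler_wpM2r// indic_co indic_cy !ger0_norm//.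
    by case: (0 <= u); rewrite /= ?ler_nat ?leq_b1.
have nP : cvgC (fun n => n.+1%:R * P n) 0.
  apply: (@cvgC_squeeze _ _ _ (fun n => expR (- ((Re s - 1) * lnn n)))).
    apply: nearW => n; rewrite subr0 -cexp_1s normc_cexp_lin ReD ReN ler_expR.
    by rewrite -mulNr opprB.
  apply: (@cvg_comp _ _ _ lnn (fun x => expR (- ((Re s - 1) * x))) _ (pinfty_nbhs R)).
    apply/cvgryPgt => A; near=> n.
    rewrite -[A]expRK ltr_ln ?posrE ?expR_gt0//.
    rewrite (lt_le_trans (_ : _ < n%:R))// ?ler_nat//.
    by near: n; exact: nbhs_infty_gtr.
  by apply: cvg_expR_decay; rewrite subr_gt0.
apply: cvgC_unshift.
have h := cvgCD (cvgCD nP (cvgCM (cvgC_cst (s / (1 - s))) (cvgCD nP (cvgC_cst (-1)))))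
  (cvgCM (cvgC_cst (- s)) Jcv).
suff : cvgC (fun n => \sum_(k < n.+1) P k) (zeta_cont s) by [].
have -> : zeta_cont s = 0 + s / (1 - s) * (0 + -1) + - s * laplace fracker_left s.
  have sn1' : s - 1 != 0 by rewrite -opprB oppr_eq0.
  rewrite /zeta_cont; field; by rewrite sn1 sn1'.
move: h; congr cvgC; apply/funext => n; rewrite G_sum.
move: (\sum_(_ < _) _) => S; move: (P n) (n.+1%:R : R[i]) => p m; field.
by rewrite sn0 sn1.
Unshelve. all: by end_near. Qed.

End DirichletSeries.

Lemma is_zeta_cont : is_zeta zeta_cont.
Proof.
split=> [s s1|s s0 s1]; first exact: zeta_cont_series.
exact: zeta_cont_analytic.
Qed.

(** The difference of two continuations vanishes near 2, hence at the end of every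
    segment from 2 that avoids 1, in particular at every nonreal point; a real
    point s is then reached from s + i. *)
Lemma is_zeta_unique (Z1 Z2 : R[i] -> R[i]) s : is_zeta Z1 -> is_zeta Z2 ->
  0 < Re s -> s != 1 -> Z1 s = Z2 s.
Proof.
move=> [ser1 an1] [ser2 an2] s0 s1.
pose D w := Z1 w + -1 * Z2 w.
have anD w : 0 < Re w -> w != 1 -> analytic_at D w.
  by move=> w0 w1; apply: analyticD; [exact: an1|apply: analyticZ; exact: an2].
have D2 : vanishes_near D (toC 2).
  exists 1 => // w w2; have w1 : 1 < Re w.
    have := le_lt_trans (norm_Re_le _) w2; rewrite ReD ReN /= ltr_norml.
    by move=> /andP[]; lra.
  by rewrite /D (cvgC_unique (ser1 w w1) (ser2 w w1)) mulN1r subrr.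
have nonreal w : 0 < Re w -> Im w != 0 -> vanishes_near D w.
  move=> w0 wi; apply: vanishes_along_segment D2 => t /andP[t0 t1].
  apply: anD.
    by rewrite ReD Re_scale ReD ReN /=; nra.
  have [->|t00] := eqVneq t 0.
    rewrite mul0r addr0; apply/eqP => /(congr1 (@complex.Re R)) /=; lra.
  apply: contraNneq wi => /(congr1 (@complex.Im R)).
  rewrite ImD Im_scale ImD ImN /= oppr0 addr0 add0r => /eqP.
  by rewrite mulf_eq0 (negbTE t00).
suff [e e0 De] : vanishes_near D s.
  have := De s; rewrite subrr normc0 => /(_ e0); rewrite /D mulN1r => /eqP.
  by rewrite subr_eq0 => /eqP.
have [si|si] := eqVneq (Im s) 0; last exact: nonreal.
pose s' := s + Complex 0 1.
have h' : vanishes_near D s'.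
  by apply: nonreal; rewrite ?ReD ?ImD /= ?addr0// si add0r oner_eq0.
apply: vanishes_along_segment h' => t /andP[t0 t1].
have -> : s' + toC t * (s - s') = s + Complex 0 (1 - t).
  by apply: complex_eq; rewrite !(ReD, ImD, Re_scale, Im_scale, ReN, ImN) /=; ring.
apply: anD; first by rewrite ReD /= addr0.
apply: contraNneq s1 => E; apply/eqP/complex_eq => //.
by have := congr1 (@complex.Re R) E; rewrite ReD /= addr0.
Qed.

Lemma zetaE s : 0 < Re s -> s != 1 -> zeta s = zeta_cont s.
Proof.
move=> s0 s1; apply: is_zeta_unique => //; last exact: is_zeta_cont.
by apply: xgetPex; exists zeta_cont; exact: is_zeta_cont.
Qed.

Lemma laplace_fracker_zeta s : 0 < Re s < 1 -> laplace fracker s = - (zeta s / s).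
Proof.
move=> s01; have /andP[s0 s1] := s01.
rewrite laplace_fracker_zeta_cont// zetaE//.
by apply: contraTneq s1 => ->; rewrite ltxx.
Qed.

End Zeta.

(** * The Plancherel inequality *)

Section Plancherel.
Context {R : realType}.
Local Notation mu := (@lebesgue_measure R).
Implicit Types (f g a b phi : R -> R) (t u v w x y : R).

(** The form of Fubini used for trigonometric kernels: the joint factor is
    bounded and the integrability comes from the separate factors. *)
Lemma fubini_bounded a b (B : R * R -> R) (M : R) : L1 a -> L1 b ->
  measurable_fun setT B -> (forall z, `|B z| <= M) ->
  L1 (fun y => b y * Int (fun x => a x * B (x, y))) /\
  Int (fun x => a x * Int (fun y => b y * B (x, y))) =
  Int (fun y => b y * Int (fun x => a x * B (x, y))).
Proof.
move=> ai bi mB BM.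
have ma := L1_measurable ai; have mb := L1_measurable bi.
have mBx x : measurable_fun setT (fun y => B (x, y)).
  by apply: (measurableT_comp mB); exact: measurable_fun_pair.
have mBy y : measurable_fun setT (fun x => B (x, y)).
  by apply: (measurableT_comp mB); exact: measurable_fun_pair.
have bB x : L1 (fun y => b y * B (x, y)) by exact: (@L1_mul_bounded _ _ _ M).
have aB y : L1 (fun x => a x * B (x, y)) by exact: (@L1_mul_bounded _ _ _ M).
pose F (z : R * R) := a z.1 * (b z.2 * B z).
have mF : measurable_fun setT F.
  by apply: measurable_funM; [|apply: measurable_funM => //]; exact: measurableT_comp.
have Fx x : L1 (fun y => F (x, y)) by exact: eq_L1 (L1Z (a x) (bB x)).
have Fy y : L1 (fun x => F (x, y)).
  by apply: eq_L1 (L1Z (b y) (aB y)) => x; rewrite /F/= mulrCA.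
have M0 : 0 <= M := le_trans (normr_ge0 _) (BM (0, 0)).
have Foo : (\int[mu]_x \int[mu]_y (`|F (x, y)|)%:E < +oo)%E.
  apply: (@le_lt_trans _ _ (\int[mu]_x (M * Int (fun y => `|b y|) * `|a x|)%:E)%E).
    apply: ge0_le_integral => //.
    - by move=> x _; apply: integral_ge0 => y _; rewrite lee_fin.
    - apply: (@measurable_fun_fubini_tonelli_F _ _ _ _ _ mu (fun z => (`|F z|)%:E)) => //.
      by apply/measurable_EFinP; exact: measurableT_comp.
    - by apply/measurable_EFinP; apply: measurable_funM => //; exact: measurableT_comp.
    - move=> x _; rewrite -EFin_Int; last exact: L1_norm.
      rewrite lee_fin mulrAC -IntZ; last exact: L1_norm.
      apply: le_Int; [exact: L1_norm|apply: L1Z; exact: L1_norm|].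
      move=> y; rewrite /F/= !normrM mulrA mulrC mulrA.
      by rewrite ler_wpM2r// ler_wpM2r// BM.
  rewrite -EFin_Int ?ltry//; apply: L1Z; exact: L1_norm.
have [_ Fi E] := fubini mF Fx Fy Foo.
have FyE y : Int (fun x => F (x, y)) = b y * Int (fun x => a x * B (x, y)).
  by rewrite -IntZ//; apply: eq_Int => x; rewrite /F/= mulrCA.
split; first by apply: eq_L1 Fi => y; exact: FyE.
transitivity (Int (fun x => Int (fun y => F (x, y)))).
  by apply: eq_Int => x; rewrite -IntZ.
by rewrite E; apply: eq_Int => y; exact: FyE.
Qed.

Definition fcos phi t := Int (fun u => phi u * cos (t * u)).
Definition fsin phi t := Int (fun u => phi u * sin (t * u)).

Lemma laplace_imag phi t :
  laplace phi (Complex 0 t) = Complex (fcos phi t) (fsin phi t).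
Proof.
by rewrite /laplace /CInt; congr Complex; apply: eq_Int => u;
  rewrite (Re_lap_fun, Im_lap_fun) /= mul0r expR0 mul1r.
Qed.

Lemma norm_cos_le1 x : `|cos x| <= 1.
Proof. by rewrite ler_norml cos_geN1 cos_le1. Qed.

Lemma norm_sin_le1 x : `|sin x| <= 1.
Proof. by rewrite ler_norml sin_geN1 sin_le1. Qed.

Lemma measurable_cos_lin t : measurable_fun setT (fun u : R => cos (t * u)).
Proof. by apply: measurableT_comp; [exact: measurable_cos|exact: measurable_lin]. Qed.

Lemma measurable_sin_lin t : measurable_fun setT (fun u : R => sin (t * u)).
Proof. by apply: measurableT_comp; [exact: measurable_sin|exact: measurable_lin]. Qed.

Lemma L1_fcos phi t : L1 phi -> L1 (fun u => phi u * cos (t * u)).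
Proof.
move=> pi; apply: (@L1_mul_bounded _ _ _ 1) => //; first exact: measurable_cos_lin.
by move=> u; exact: norm_cos_le1.
Qed.

Lemma L1_fsin phi t : L1 phi -> L1 (fun u => phi u * sin (t * u)).
Proof.
move=> pi; apply: (@L1_mul_bounded _ _ _ 1) => //; first exact: measurable_sin_lin.
by move=> u; exact: norm_sin_le1.
Qed.

Lemma norm_fcos_le phi t : L1 phi -> `|fcos phi t| <= Int (fun u => `|phi u|).
Proof.
move=> pi; apply: le_trans (le_norm_Int (L1_fcos t pi)) _.
apply: le_Int; [exact: L1_norm (L1_fcos t pi)|exact: L1_norm|].
by move=> u; rewrite normrM ler_piMr// norm_cos_le1.
Qed.

Lemma norm_fsin_le phi t : L1 phi -> `|fsin phi t| <= Int (fun u => `|phi u|).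
Proof.
move=> pi; apply: le_trans (le_norm_Int (L1_fsin t pi)) _.
apply: le_Int; [exact: L1_norm (L1_fsin t pi)|exact: L1_norm|].
by move=> u; rewrite normrM ler_piMr// norm_sin_le1.
Qed.

(** Continuity under the integral, with |phi| as domination. *)
Lemma fcos_fsin_continuous phi : L1 phi ->
  continuous (fcos phi) /\ continuous (fsin phi).
Proof.
move=> pi; split=> t.
  have := @continuity_under_integral R _ _ mu (fun t u => phi u * cos (t * u)) setT
    measurableT (t - 1) (t + 1) _ _ (fun u => `|phi u|).
  apply => //.
  - by move=> s _; exact: L1_fcos.
  - apply: aeW => u _ s _; apply: cvgM; first exact: cvg_cst.
    apply: (@cvg_comp _ _ _ (fun s => s * u) cos); last exact: continuous_cos.
    by apply: cvgM; [exact: cvg_id|exact: cvg_cst].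
  - exact: L1_norm.
  - by move=> s _; apply: aeW => u _; rewrite normrM ler_piMr// norm_cos_le1.
  - by rewrite inE/= in_itv/= ltrBlDr ltrDl ltr01.
have := @continuity_under_integral R _ _ mu (fun t u => phi u * sin (t * u)) setT
  measurableT (t - 1) (t + 1) _ _ (fun u => `|phi u|).
apply => //.
- by move=> s _; exact: L1_fsin.
- apply: aeW => u _ s _; apply: cvgM; first exact: cvg_cst.
  apply: (@cvg_comp _ _ _ (fun s => s * u) sin); last exact: continuous_sin.
  by apply: cvgM; [exact: cvg_id|exact: cvg_cst].
- exact: L1_norm.
- by move=> s _; apply: aeW => u _; rewrite normrM ler_piMr// norm_sin_le1.
- by rewrite inE/= in_itv/= ltrBlDr ltrDl ltr01.
Qed.

(** The Abel summation factor of the frequency integrals, and later the weight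
    under which polynomials are dense. *)
Definition damp (e t : R) : R := expR (- (e * `|t|)).

Lemma measurable_damp e : measurable_fun setT (damp e).
Proof.
apply: measurableT_comp => //; apply: measurableT_comp => //.
by apply: measurable_funM => //; exact: normr_measurable.
Qed.

Lemma damp_halves e t : t != 0 ->
  damp e t = hlf t * expR (e * t) + hlf (- t) * expR (e * - t).
Proof.
move=> t0; rewrite /damp /hlf !indic_Nyc oppr_le0.
have [tl|tg] := leP t 0.
  have tl' : t < 0 by rewrite lt_neqAle t0.
  by rewrite leNgt tl'/= mul1r mul0r addr0 ltr0_norm// mulrN opprK.
by rewrite (ltW tg) mul0r mul1r add0r gtr0_norm// mulrN.
Qed.

Lemma L1_damp e : 0 < e -> L1 (damp e).
Proof.
move=> e0; have h := lap_conv_hlf e0.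
have h2 := L1D h (Int_neg h).1.
apply: (L1_le (measurable_damp e) _ h2) => t; rewrite ger0_norm ?expR_ge0//.
have [->|t0] := eqVneq t 0; last by rewrite (damp_halves _ t0).
rewrite /damp normr0 !mulr0 oppr0 mulr0 expR0 /hlf indic_Nyc lexx.
by rewrite !mul1r lerDl.
Qed.

(** Up to its value at 0, damp e is the sum of hlf t * exp (e t) and of its
    reflection, so the integral is twice the real part of 1/(e + i w), the transform
    of hlf. The result is the Poisson kernel. *)
Lemma Int_damp_cos e w : 0 < e ->
  Int (fun t => damp e t * cos (t * w)) = 2 * e / (e ^+ 2 + w ^+ 2).
Proof.
move=> e0; have h := lap_conv_hlf e0.
have e0' : 0 < Re (Complex e w) by [].
have [c _] := lap_conv_CL1 (h : lap_conv hlf (Re (Complex e w))).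
pose q t := hlf t * (expR (e * t) * cos (w * t)).
have qi : L1 q by apply: eq_L1 c => t; rewrite Re_lap_fun.
have q_int : Int q = e / (e ^+ 2 + w ^+ 2).
  have := congr1 (@complex.Re R) (laplace_hlf e0').
  rewrite [LHS]/= (eq_Int (fun t => Re_lap_fun hlf (Complex e w) t)) => ->.
  by [].
transitivity (Int (fun t => q t + q (- t))).
  apply: (@eq_Int_except _ 0).
  - by apply: measurable_funM; [exact: measurable_damp|under eq_fun do rewrite mulrC; exact: measurable_cos_lin].
  - by apply: L1_measurable; apply: L1D => //; exact: (Int_neg qi).1.
  - move=> t /damp_halves ->; rewrite /q mulrDl [w * - t]mulrN cosN [w * t]mulrC.
    by rewrite !mulrA.
rewrite IntD//; last exact: (Int_neg qi).1.
rewrite -(Int_neg qi).2 q_int; ring.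
Qed.

(** The density of the Cauchy law, times 2 pi. *)
Definition cauchy x : R := 2 / (1 + x ^+ 2).

Lemma cauchy_ge0 x : 0 <= cauchy x.
Proof. by rewrite divr_ge0// addr_ge0// sqr_ge0. Qed.

Lemma cauchy_integral : L1 cauchy /\ Int cauchy = 2 * pi.
Proof.
have D x : 0 < 1 + x ^+ 2 :> R by rewrite ltr_pwDl// sqr_ge0.
have cc : continuous cauchy.
  move=> x; apply: cvgM; first exact: cvg_cst.
  apply: cvgV; first by rewrite gt_eqF.
  by apply: cvgD; [exact: cvg_cst|exact: exprn_continuous].
have E : (\int[mu]_x (cauchy x)%:E = (2 * pi)%:E)%E.
  rewrite ge0_symfun_integralT//=.
  - rewrite (_ : (\int[mu]_(x in _) _)%E = (2%:E * (pi / 2)%:E)%E).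
      by rewrite -EFinM; congr EFin; field.
    rewrite -integral0y_oneDsqr -ge0_integralZl//=.
    + by rewrite -set_itvcy.
    + apply: measurable_funTS; apply/measurable_EFinP.
      by apply: continuous_measurable_fun; exact: continuous_oneDsqrV.
  - exact: cauchy_ge0.
  - by move=> x; rewrite /cauchy /= sqrrN.
have L : L1 cauchy.
  apply: L1_lty; first exact: continuous_measurable_fun.
  under eq_integral do rewrite ger0_norm ?cauchy_ge0//.
  by rewrite E ltry.
by split=> //; apply: EFin_inj; rewrite EFin_Int.
Qed.

Definition fnorm2 phi t := fcos phi t ^+ 2 + fsin phi t ^+ 2.

(** The squared modulus of the transform at t is the double integral of
    phi u * phi v * cos (t (v - u)); integrating in t first, against the damping
    factor, produces the Poisson kernel. *)
Lemma damped_fnorm2 phi e : 0 < e -> L1 phi ->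
  L1 (fun u => phi u * Int (fun v => phi v * (2 * e / (e ^+ 2 + (v - u) ^+ 2)))) /\
  Int (fun t => damp e t * fnorm2 phi t) =
  Int (fun u => phi u * Int (fun v => phi v * (2 * e / (e ^+ 2 + (v - u) ^+ 2)))).
Proof.
move=> e0 pi; have di := L1_damp e0.
have [cc cs] := fcos_fsin_continuous pi.
pose N := Int (fun u => `|phi u|).
have inner u t : Int (fun v => phi v * cos (t * (v - u))) =
    fcos phi t * cos (t * u) + fsin phi t * sin (t * u).
  rewrite [fcos _ _ * _]mulrC [fsin _ _ * _]mulrC -!IntZ; [|exact: L1_fsin|exact: L1_fcos].
  rewrite -IntD; [|apply: L1Z; exact: L1_fcos|apply: L1Z; exact: L1_fsin].
  by apply: eq_Int => v; rewrite mulrBr cosB; ring.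
have m2 (F : R -> R) : measurable_fun setT F ->
    measurable_fun setT (fun z : R * R => F (z.1 * z.2)).
  by move=> mF; apply: measurableT_comp => //; exact: measurable_funM.
have -> : Int (fun t => damp e t * fnorm2 phi t) = Int (fun t => damp e t *
    Int (fun u => phi u * (fcos phi t * cos (t * u) + fsin phi t * sin (t * u)))).
  apply: eq_Int => t; congr (_ * _); rewrite /fnorm2 !expr2.
  rewrite -[X in X * _ + _]/(fcos phi t) -!IntZ; [|exact: L1_fsin|exact: L1_fcos].
  rewrite -IntD; [|apply: L1Z; exact: L1_fcos|apply: L1Z; exact: L1_fsin].
  by apply: eq_Int => u; ring.
have Du u : Int (fun t => damp e t * (fcos phi t * cos (t * u) + fsin phi t * sin (t * u))) =
    Int (fun v => phi v * (2 * e / (e ^+ 2 + (v - u) ^+ 2))).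
  under eq_Int => t do rewrite -inner.
  have [||_ ->] := @fubini_bounded (damp e) phi (fun z => cos (z.1 * (z.2 - u))) 1 di pi.
  - apply: measurableT_comp; first exact: measurable_cos.
    by apply: measurable_funM => //; exact: measurable_funB.
  - by move=> z; exact: norm_cos_le1.
  - apply: eq_Int => v; congr (_ * _) => /=.
    by rewrite Int_damp_cos.
have [||Li ->] := @fubini_bounded (damp e) phi (fun z => fcos phi z.1 * cos (z.1 * z.2) +
   fsin phi z.1 * sin (z.1 * z.2)) (N + N) di pi.
- apply: measurable_funD; apply: measurable_funM.
  + by apply: measurableT_comp => //; exact: continuous_measurable_fun.
  + exact: m2 measurable_cos.
  + by apply: measurableT_comp => //; exact: continuous_measurable_fun.
  + exact: m2 measurable_sin.
- move=> z; rewrite (le_trans (ler_normD _ _))// !normrM lerD//.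
    by rewrite -[leRHS]mulr1 ler_pM// ?norm_fcos_le ?norm_cos_le1.
  by rewrite -[leRHS]mulr1 ler_pM// ?norm_fsin_le ?norm_sin_le1.
split; first by apply: eq_L1 Li => u /=; rewrite Du.
by apply: eq_Int => u /=; rewrite Du.
Qed.

(** Substituting v = e x + u turns the Poisson kernel into a Cauchy law of scale e. *)
Lemma cauchy_average phi e u : 0 < e -> L1 phi ->
  Int (fun v => phi v * (2 * e / (e ^+ 2 + (v - u) ^+ 2))) =
  Int (fun x => phi (e * x + u) * cauchy x).
Proof.
move=> e0 pi; have mphi := L1_measurable pi.
pose q v := phi v * (2 * e / (e ^+ 2 + (v - u) ^+ 2)).
have D (w : R) : 0 < e ^+ 2 + w ^+ 2 by rewrite ltr_pwDl ?exprn_gt0// sqr_ge0.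
have qi : L1 q.
  apply: (@L1_mul_bounded _ _ _ (2 * e / e ^+ 2)) => //.
    apply: continuous_measurable_fun => v; apply: cvgM; first exact: cvg_cst.
    apply: cvgV; first by rewrite gt_eqF.
    apply: cvgD; first exact: cvg_cst.
    apply: (@cvg_comp _ _ _ (fun v => v - u) (fun w => w ^+ 2)).
      by apply: cvgB; [exact: cvg_id|exact: cvg_cst].
    exact: exprn_continuous.
  move=> v; rewrite ger0_norm ?divr_ge0 ?mulr_ge0 ?(ltW e0) ?(ltW (D _))//.
  rewrite ler_wpM2l ?mulr_ge0 ?(ltW e0)// lef_pV2 ?posrE ?exprn_gt0//.
  by rewrite lerDl sqr_ge0.
have [qa ->] := Int_affine u e0 qi.
rewrite -IntZ//; apply: eq_Int => x; rewrite /q /cauchy mulrCA; congr (_ * _).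
have h1 : e != 0 by rewrite gt_eqF.
have h2 : 1 + x ^+ 2 != 0 by rewrite gt_eqF// ltr_pwDl// sqr_ge0.
rewrite addrK exprMn (_ : e ^+ 2 + _ = e ^+ 2 * (1 + x ^+ 2)); last by ring.
by field; rewrite h1 h2.
Qed.

(** Damping the frequency integral by exp (- e |t|) turns it into the pairing of
    phi with 2 pi times its average over the Cauchy law of scale e. As e tends to 0
    the average tends to phi at continuity points, while the damped integrals stay
    below the undamped one. *)
Lemma plancherel_le phi (M : R) : L1 phi -> (forall u, `|phi u| <= M) ->
  {ae mu, forall u, {for u, continuous phi}} ->
  ((2 * pi)%:E * \int[mu]_u (phi u ^+ 2)%:E <= \int[mu]_t (fnorm2 phi t)%:E)%E.
Proof.
move=> pii pM pc; have mphi := L1_measurable pii.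
have [ci cE] := cauchy_integral.
have M0 : 0 <= M := le_trans (normr_ge0 _) (pM 0).
pose e n : R := n.+1%:R^-1.
have e0 n : 0 < e n by rewrite invr_gt0.
have e_0 : e @ \oo --> (0 : R) by exact: cvg_harmonic.
pose A n u := Int (fun x => phi (e n * x + u) * cauchy x).
have mshift n u : measurable_fun setT (fun x => phi (e n * x + u) * cauchy x).
  apply: measurable_funM; last exact: L1_measurable ci.
  by apply: measurableT_comp => //; exact: measurable_affine.
have bshift n u x : `|phi (e n * x + u) * cauchy x| <= M * cauchy x.
  by rewrite normrM (ger0_norm (cauchy_ge0 _)) ler_wpM2r// cauchy_ge0.
have Mi : L1 (fun x => M * cauchy x) by exact: L1Z.
have ishift n u : L1 (fun x => phi (e n * x + u) * cauchy x) by apply: L1_le Mi.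
have AM n u : `|A n u| <= M * (2 * pi).
  rewrite (le_trans (le_norm_Int _))// -cE -IntZ//.
  by apply: le_Int => //; exact: L1_norm.
have Acv u : {for u, continuous phi} -> A ^~ u @ \oo --> 2 * pi * phi u.
  move=> cu; rewrite mulrC -cE -IntZ//.
  have [] // := @dominated_cvg _ (fun n x => phi (e n * x + u) * cauchy x)
    (fun x => phi u * cauchy x) (fun x => M * cauchy x).
  - by apply: measurable_funM => //; exact: L1_measurable ci.
  - apply: aeW => x; apply: cvgM; last exact: cvg_cst.
    have h : (fun n => e n * x + u) @ \oo --> 0 * x + u.
      by apply: cvgD; [apply: cvgM => //; exact: cvg_cst|exact: cvg_cst].
    rewrite mul0r add0r in h.
    exact: (@cvg_comp _ _ _ (fun n => e n * x + u) phi _ (nbhs u) _ h cu).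
have E n : L1 (fun u => phi u * A n u) /\
    Int (fun t => damp (e n) t * fnorm2 phi t) = Int (fun u => phi u * A n u).
  have [h1 h2] := damped_fnorm2 (e0 n) pii; split.
    by apply: eq_L1 h1 => u; rewrite cauchy_average.
  by rewrite h2; apply: eq_Int => u; rewrite cauchy_average.
have p2i : L1 (fun u => phi u ^+ 2).
  by apply: eq_L1 (L1_mul_bounded pii mphi pM) => u; rewrite expr2.
have lim : (fun n => Int (fun u => phi u * A n u)) @ \oo -->
    2 * pi * Int (fun u => phi u ^+ 2).
  rewrite -IntZ//.
  have [] // := @dominated_cvg _ (fun n u => phi u * A n u) (fun u => 2 * pi * phi u ^+ 2)
    (fun u => M * (2 * pi) * `|phi u|).
  - by move=> n; exact: L1_measurable (E n).1.
  - by apply: L1_measurable; exact: L1Z.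
  - by apply: L1Z; exact: L1_norm.
  - have [N [mN N0 sN]] := pc; exists N; split=> // u /= nu; apply: sN => /= cu.
    apply: nu; rewrite expr2 mulrCA; apply: cvgM; [exact: cvg_cst|exact: Acv].
  - by move=> n u; rewrite normrM mulrC ler_wpM2r.
have f0 t : 0 <= fnorm2 phi t by rewrite addr_ge0 ?sqr_ge0.
have [cc cs] := fcos_fsin_continuous pii.
have mf : measurable_fun setT (fnorm2 phi).
  by apply: measurable_funD; apply: measurable_funX; exact: continuous_measurable_fun.
have N0 : 0 <= Int (fun u => `|phi u|) by exact: Int_ge0.
have le n : ((Int (fun u => phi u * A n u))%:E <= \int[mu]_t (fnorm2 phi t)%:E)%E.
  rewrite -(E n).2 EFin_Int; last first.
    apply: (@L1_mul_bounded _ _ _ (Int (fun u => `|phi u|) ^+ 2 *+ 2)) => //.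
      exact: L1_damp.
    move=> t; rewrite ger0_norm// mulr2n /fnorm2 lerD//.
      by rewrite -[X in X <= _]real_normK ?num_real// lerXn2r ?nnegrE// norm_fcos_le.
    by rewrite -[X in X <= _]real_normK ?num_real// lerXn2r ?nnegrE// norm_fsin_le.
  apply: ge0_le_integral => //.
  - by move=> t _; rewrite lee_fin mulr_ge0// expR_ge0.
  - by apply/measurable_EFinP; apply: measurable_funM => //; exact: measurable_damp.
  - exact/measurable_EFinP.
  - move=> t _; rewrite lee_fin ler_piMl// /damp -[leRHS]expR0 ler_expR.
    by rewrite oppr_le0 mulr_ge0// ltW.
rewrite -EFin_Int// -EFinM.
move: le; case: (\int[mu]_t _)%E => [b||] le.
- rewrite lee_fin -(cvg_lim _ lim)//; apply: limr_le; first by apply/cvg_ex; eexists; exact: lim.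
  by apply: nearW => n; have := le n; rewrite lee_fin.
- by rewrite leey.
- by have := le 0%N; rewrite leeNy_eq.
Qed.
End Plancherel.

(** * Density of polynomials for an exponential weight *)

Section PolynomialDensity.
Context {R : realType}.
Local Notation mu := (@lebesgue_measure R).
Variable c : R.
Hypothesis c0 : 0 < c.
Implicit Types (f g : R -> R) (p q : {poly R}) (t u : R).

(** Squared norm for the weight exp (- c |t|). *)
Definition wnorm f : \bar R := (\int[mu]_t (f t ^+ 2 * damp c t)%:E)%E.

Lemma damp_ge0 t : 0 <= damp c t. Proof. exact: expR_ge0. Qed.

Lemma measurable_sqr_damp f : measurable_fun setT f ->
  measurable_fun setT (fun t => f t ^+ 2 * damp c t).
Proof.
by move=> mf; apply: measurable_funM; [exact: measurable_funX|exact: measurable_damp].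
Qed.

Lemma wnormD f g : measurable_fun setT f -> measurable_fun setT g ->
  (wnorm (fun t => f t + g t)%R <= 2%:E * wnorm f + 2%:E * wnorm g)%E.
Proof.
move=> mf mg.
have m2 (h : R -> R) : measurable_fun setT h -> measurable_fun setT (fun t => (h t ^+ 2 * damp c t)%:E).
  by move=> mh; apply/measurable_EFinP; exact: measurable_sqr_damp.
have p2 h t : (0 <= (h t ^+ 2 * damp c t)%:E)%E by rewrite lee_fin mulr_ge0 ?sqr_ge0 ?damp_ge0.
rewrite /wnorm -!ge0_integralZl_EFin//; [|exact: m2..].
rewrite -ge0_integralD//; last 4 first.
- by move=> t _; rewrite mule_ge0.
- by apply: emeasurable_funM => //; exact: m2.
- by move=> t _; rewrite mule_ge0.
- by apply: emeasurable_funM => //; exact: m2.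
apply: ge0_le_integral => //.
- by move=> t _; exact: (p2 (fun t => f t + g t)).
- by apply: m2; exact: measurable_funD.
- by apply: emeasurable_funD; apply: emeasurable_funM => //; exact: m2.
- move=> t _; rewrite -!EFinM -EFinD lee_fin !mulrA -mulrDl ler_wpM2r ?damp_ge0//.
  by have := sqr_ge0 (f t - g t); nra.
Qed.

Lemma wnormM_le f g (M : R) : measurable_fun setT f -> measurable_fun setT g ->
  (forall t, `|f t| <= M) ->
  (wnorm (fun t => f t * g t)%R <= (M ^+ 2)%:E * wnorm g)%E.
Proof.
move=> mf mg fM; have M0 : 0 <= M := le_trans (normr_ge0 _) (fM 0).
rewrite /wnorm -ge0_integralZl_EFin ?sqr_ge0//; last 2 first.
- by move=> t _; rewrite lee_fin mulr_ge0 ?sqr_ge0 ?damp_ge0.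
- by apply/measurable_EFinP; exact: measurable_sqr_damp.
apply: ge0_le_integral => //.
- by move=> t _; rewrite lee_fin mulr_ge0 ?sqr_ge0 ?damp_ge0.
- by apply/measurable_EFinP; apply: measurable_sqr_damp; exact: measurable_funM.
- apply: emeasurable_funM => //; apply/measurable_EFinP; exact: measurable_sqr_damp.
- move=> t _; rewrite -EFinM lee_fin mulrA ler_wpM2r ?damp_ge0// exprMn ler_wpM2r ?sqr_ge0//.
  by rewrite -[leLHS]real_normK ?num_real// lerXn2r ?nnegrE.
Qed.

Lemma L1_exp_damp (b : R) : b < c -> L1 (fun t => expR (b * `|t|) * damp c t).
Proof.
move=> bc; apply: eq_L1 (L1_damp (_ : 0 < c - b)) => [t|]; last by rewrite subr_gt0.
by rewrite /damp -expRD; congr expR; ring.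
Qed.

(** Polynomials are negligible against the weight: each multiplication by t costs
    half of the exponent. *)
Lemma poly_exp_bound p (b : R) : 0 < b ->
  exists2 C : R, 0 <= C & forall t, `|p.[t]| <= C * expR (b * `|t|).
Proof.
elim/poly_ind: p b => [|p a ih] b b0.
  by exists 0 => // t; rewrite horner0 normr0 mul0r.
have b2 : 0 < b / 2 by rewrite divr_gt0.
have [C C0 pC] := ih _ b2; exists (C * (b / 2)^-1 + `|a|).
  by rewrite addr_ge0// mulr_ge0// invr_ge0 ltW.
move=> t; rewrite hornerMXaddC (le_trans (ler_normD _ _))// mulrDl lerD//; last first.
  by rewrite ler_peMr// -[leLHS]expR0 ler_expR mulr_ge0// ltW.
rewrite normrM (le_trans (ler_wpM2r _ (pC t)))//.
rewrite -[leLHS]mulrA -[leRHS]mulrA ler_wpM2l//.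
rewrite [leRHS](_ : _ = expR (b / 2 * `|t|) * ((b / 2)^-1 * expR (b / 2 * `|t|))); last first.
  by rewrite mulrCA -expRD; congr (_ * expR _); field.
rewrite ler_wpM2l ?expR_ge0// mulrC ler_pdivlMr//.
rewrite (le_trans _ (expR_ge1Dx _))// mulrC lerDr ler01//.
Qed.

(** The closure of the polynomials for the weighted norm. *)
Definition approx f := measurable_fun setT f /\
  forall e : R, 0 < e -> exists p, (wnorm (fun t => f t - p.[t])%R <= e%:E)%E.

Lemma measurable_horner p : measurable_fun setT (fun t : R => p.[t]).
Proof.
elim/poly_ind: p => [|p a ih].
  by under eq_fun do rewrite horner0; exact: measurable_cst.
under eq_fun do rewrite hornerMXaddC.
by apply: measurable_funD => //; exact: measurable_funM.
Qed.

Lemma wnorm0 : wnorm (fun=> 0) = 0%E.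
Proof.
by rewrite /wnorm; apply: integral0_eq => t _; rewrite expr0n/= mul0r.
Qed.

Lemma approx_poly p : approx (fun t => p.[t]).
Proof.
split; first exact: measurable_horner.
move=> e e0; exists p; under [X in wnorm X]eq_fun do rewrite subrr.
by rewrite wnorm0 lee_fin ltW.
Qed.

Lemma approx_closed f : measurable_fun setT f ->
  (forall e : R, 0 < e -> exists2 g, approx g &
    (wnorm (fun t => f t - g t)%R <= e%:E)%E) -> approx f.
Proof.
move=> mf fg; split=> // e e0; have e4 : 0 < e / 4 by rewrite divr_gt0.
have [g [mg ag] fge] := fg _ e4; have [p gp] := ag _ e4; exists p.
have -> : (fun t => f t - p.[t]) = (fun t => (f t - g t) + (g t - p.[t])).
  by apply/funext => t; rewrite addrA subrK.
apply: le_trans (wnormD _ _) _.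
- exact: measurable_funB.
- by apply: measurable_funB => //; exact: measurable_horner.
- apply: le_trans (leeD (lee_wpmul2l _ fge) (lee_wpmul2l _ gp)) _ => //.
  by rewrite -!EFinM -EFinD lee_fin; lra.
Qed.

Lemma approxD f g : approx f -> approx g -> approx (fun t => f t + g t).
Proof.
move=> [mf af] [mg ag]; split; first exact: measurable_funD.
move=> e e0; have e4 : 0 < e / 4 by rewrite divr_gt0.
have [p fp] := af _ e4; have [q gq] := ag _ e4; exists (p + q).
have -> : (fun t => f t + g t - (p + q).[t]) = (fun t => (f t - p.[t]) + (g t - q.[t])).
  by apply/funext => t; rewrite hornerD; ring.
apply: le_trans (wnormD _ _) _.
- by apply: measurable_funB => //; exact: measurable_horner.
- by apply: measurable_funB => //; exact: measurable_horner.
- apply: le_trans (leeD (lee_wpmul2l _ fp) (lee_wpmul2l _ gq)) _ => //.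
  by rewrite -!EFinM -EFinD lee_fin; lra.
Qed.

(** Multiplication by a bounded function is continuous, so its effect on the
    closure is determined by its effect on polynomials. *)
Lemma approx_mul_bounded f g (M : R) : measurable_fun setT f ->
  (forall t, `|f t| <= M) -> (forall p, approx (fun t => f t * p.[t])) ->
  approx g -> approx (fun t => f t * g t).
Proof.
move=> mf fM fp [mg ag]; apply: approx_closed; first exact: measurable_funM.
move=> e e0; have M1 : 0 < M ^+ 2 + 1 by rewrite ltr_wpDl// sqr_ge0.
have [p gp] := ag (e / (M ^+ 2 + 1)) (divr_gt0 e0 M1).
exists (fun t => f t * p.[t]) => //.
under [X in wnorm X]eq_fun do rewrite -mulrBr.
apply: le_trans (wnormM_le mf _ fM) _.
  by apply: measurable_funB => //; exact: measurable_horner.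
apply: le_trans (lee_wpmul2l _ gp) _; first by rewrite lee_fin sqr_ge0.
by rewrite -EFinM lee_fin mulrCA ger_pMr// ler_pdivrMr// mul1r lerDl.
Qed.

(** Dominated convergence, the closure being stable under limits in norm. *)
Lemma approx_limit (f_ : nat -> R -> R) f g : (forall n, approx (f_ n)) ->
  (forall t, f_ ^~ t @ \oo --> f t) -> (forall n t, `|f_ n t| <= g t) ->
  L1 (fun t => g t ^+ 2 * damp c t) -> approx f.
Proof.
move=> af f_f f_g gi.
have mf_ n : measurable_fun setT (f_ n) := (af n).1.
have mf : measurable_fun setT f.
  by apply: (@measurable_fun_cvg _ _ _ _ f_) => // t _; exact: f_f.
apply: approx_closed => // e e0.
pose d n t := (f t - f_ n t) ^+ 2 * damp c t.
have md n : measurable_fun setT (d n).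
  by apply: measurable_sqr_damp; exact: measurable_funB.
have fg t : `|f t| <= g t.
  have h : (fun n => `|f_ n t|) @ \oo --> `|f t| by apply: cvg_norm; exact: f_f.
  rewrite -(cvg_lim _ h)//; apply: limr_le; first by apply/cvg_ex; eexists; exact: h.
  exact: nearW.
have dg n t : `|d n t| <= 4 * (g t ^+ 2 * damp c t).
  have d0 : 0 <= d n t by rewrite /d mulr_ge0 ?sqr_ge0 ?damp_ge0.
  rewrite (ger0_norm d0) /d mulrA ler_wpM2r ?damp_ge0//.
  rewrite -[leLHS]real_normK ?num_real// (_ : 4 * g t ^+ 2 = (2 * g t) ^+ 2); last by ring.
  have g0 : 0 <= g t := le_trans (normr_ge0 _) (fg t).
  rewrite lerXn2r ?nnegrE ?mulr_ge0//.
  by rewrite (le_trans (ler_normB _ _))// (_ : 2 * g t = g t + g t) ?lerD//; ring.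
have dcv : {ae mu, forall t, d ^~ t @ \oo --> (0 : R)}.
  apply: aeW => t; rewrite -(mul0r (damp c t)); apply: cvgM; last exact: cvg_cst.
  have h : (fun n => (f t - f_ n t) ^+ 2) @ \oo --> (f t - f t) ^+ 2.
    apply: (@cvg_comp _ _ _ (fun n => f t - f_ n t) (fun x => x ^+ 2) _
      (nbhs (f t - f t))); last exact: exprn_continuous.
    by apply: cvgB; [exact: cvg_cst|exact: f_f].
  by rewrite subrr expr0n in h.
have [_] := dominated_cvg md (measurable_cst _) (L1Z 4 gi) dcv dg.
rewrite Int0 => /cvgrPdist_le/(_ e e0)[N _ /(_ N (leqnn N))].
rewrite sub0r normrN => dN; exists (f_ N) => //.
rewrite /wnorm -EFin_Int; last exact: L1_le (md N) (dg N) (L1Z 4 gi).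
by rewrite lee_fin; apply: le_trans dN; exact: ler_norm.
Qed.

Let approx_trig u := forall p,
  approx (fun t => p.[t] * cos (u * t)) /\ approx (fun t => p.[t] * sin (u * t)).

Lemma approxZ (a : R) f : approx f -> approx (fun t => a * f t).
Proof.
move=> af; apply: (@approx_mul_bounded (fun=> a) f `|a|) => // p.
rewrite (_ : (fun t => _) = (fun t => (a *: p).[t])); first exact: approx_poly.
by apply/funext => t; rewrite hornerZ.
Qed.

(** The exponents add up to 2 (c/8 + c/8) < c, so that p(t) exp (h |t|) still has
    finite weighted norm. *)
Lemma L1_poly_exp_sqr p (h : R) : 0 <= h -> h <= c / 8 ->
  exists2 C : R, 0 <= C & (forall t, `|p.[t]| <= C * expR (c / 8 * `|t|)) /\
  L1 (fun t => (C * expR (c / 8 * `|t|) * expR (h * `|t|)) ^+ 2 * damp c t).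
Proof.
move=> h0 hc; have c8 : 0 < c / 8 by rewrite divr_gt0.
have [C C0 pC] := poly_exp_bound p c8; exists C => //; split=> //.
have bc : 2 * (c / 8 + h) < c by lra.
apply: eq_L1 (L1Z (C ^+ 2) (L1_exp_damp bc)) => t.
rewrite mulrA; congr (_ * _); rewrite !exprMn -[RHS]mulrA; congr (_ * _).
by rewrite -!expRM_natl -expRD; congr expR; ring.
Qed.

(** Expand cos (h t) and sin (h t) in Taylor series: the partial sums are
    polynomials at most exp (|h t|), and [L1_poly_exp_sqr] dominates their
    products by p. The functional F is the real or the imaginary part. *)
Let approx_trig_step u (h : R) : `|h| <= c / 8 -> approx_trig u -> approx_trig (u + h).
Proof.
move=> hc au.
pose z t : R[i] := Complex 0 (h * t).
have tay (F : R[i] -> R) : (forall x w, F (toC x * w) = x * F w) ->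
    (forall n (v : nat -> R[i]), F (\sum_(k < n) v k) = \sum_(k < n) F (v k)) ->
    (forall w, `|F w| <= normc w) ->
    (forall w : nat -> R[i], forall l, cvgC w l -> (fun n => F (w n)) @ \oo --> F l) ->
    forall p f, (forall q, approx (fun t => q.[t] * f t)) -> (forall t, `|f t| <= 1) ->
    approx (fun t => p.[t] * f t * F (cexp (z t))).
  move=> Fsc Fsum Fle Fcv p f fq f1.
  pose T n : {poly R} := \sum_(k < n) F ((Complex 0 h) ^+ k / k`!%:R) *: 'X^k.
  have TE n t : (T n).[t] = F (\sum_(k < n) z t ^+ k / k`!%:R).
    rewrite /T horner_sum (Fsum n (fun k => z t ^+ k / k`!%:R)).
    apply: eq_bigr => k _; rewrite hornerZ hornerXn mulrC -Fsc; congr F.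
    rewrite mulrA rmorphXn -exprMn; congr (_ ^+ _ / _).
    by apply: complex_eq; rewrite ?Re_scale ?Im_scale /= ?mulr0// mulrC.
  have [C C0 [pC Li]] := L1_poly_exp_sqr p (normr_ge0 h) hc.
  apply: (@approx_limit (fun n t => (p * T n).[t] * f t) _
    (fun t => C * expR (c / 8 * `|t|) * expR (`|h| * `|t|))) => //.
  - move=> t; have h1 := Fcv _ _ (cexp_series (z t)).
    have -> : p.[t] * f t * F (cexp (z t)) = p.[t] * F (cexp (z t)) * f t by rewrite mulrAC.
    apply: cvgM; last exact: cvg_cst.
    under eq_fun do rewrite hornerM TE.
    by apply: cvgM; [exact: cvg_cst|exact: h1].
  - move=> n t; rewrite hornerM !normrM -[leRHS]mulr1 ler_pM ?mulr_ge0// ler_pM//.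
    rewrite TE (le_trans (Fle _))// (le_trans (cexp_psum_le (z t) n))// ler_expR.
    by rewrite (le_trans (normc_le _))//= normr0 add0r normrM.
have cos_z t : Re (cexp (z t)) = cos (h * t) by rewrite /cexp /= expR0 mul1r.
have sin_z t : Im (cexp (z t)) = sin (h * t) by rewrite /cexp /= expR0 mul1r.
have tRe := tay (@complex.Re R) (@Re_scale R) (@Re_sum R) (@norm_Re_le R)
  (fun w l wl => ((cvgCP w l).1 wl).1).
have tIm := tay (@complex.Im R) (@Im_scale R) (@Im_sum R) (@norm_Im_le R)
  (fun w l wl => ((cvgCP w l).1 wl).2).
have acos q := (au q).1; have asin q := (au q).2.
have c1 t : `|cos (u * t)| <= 1 by exact: norm_cos_le1.
have s1 t : `|sin (u * t)| <= 1 by exact: norm_sin_le1.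
move=> p; split.
  rewrite (_ : (fun t => _) = (fun t => p.[t] * cos (u * t) * Re (cexp (z t)) +
      -1 * (p.[t] * sin (u * t) * Im (cexp (z t))))).
    by apply: approxD; [exact: tRe|apply: approxZ; exact: tIm].
  by apply/funext => t; rewrite cos_z sin_z mulrDl cosD; ring.
rewrite (_ : (fun t => _) = (fun t => p.[t] * sin (u * t) * Re (cexp (z t)) +
    p.[t] * cos (u * t) * Im (cexp (z t)))).
  by apply: approxD; [exact: tRe|exact: tIm].
by apply/funext => t; rewrite cos_z sin_z mulrDl sinD; ring.
Qed.

(** A frequency u is reached by steps u/(n + 1) of length at most c/8. *)
Let approx_trig_all u : approx_trig u.
Proof.
have h n (h : R) : `|h| <= c / 8 -> approx_trig (n%:R * h).
  move=> hc; elim: n => [|n ih].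
    rewrite mul0r => p; split.
      under eq_fun do rewrite mul0r cos0 mulr1; exact: approx_poly.
    under eq_fun do rewrite mul0r sin0 mulr0.
    by have := approx_poly 0; under eq_fun do rewrite horner0.
  rewrite -natr1 mulrDl mul1r; exact: approx_trig_step.
have c8 : 0 < c / 8 by rewrite divr_gt0.
have [n nu] : exists n : nat, `|u| / (c / 8) < n.+1%:R.
  exists (Num.truncn (`|u| / (c / 8))).
  by rewrite truncnS_gt.
rewrite -(@divfK _ n.+1%:R _ u) 1?mulrC; last by rewrite pnatr_eq0.
apply: h; rewrite normrM normfV (ger0_norm (ler0n _ _)) ler_pdivrMr//.
by rewrite mulrC -ler_pdivrMr// ltW.
Qed.

(** Bounded functions that multiply the closure into itself. They form an algebra
    stable under bounded pointwise limits, and p = 1 puts them in the closure. *)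
Definition multiplier f := [/\ measurable_fun setT f,
  exists M : R, forall t, `|f t| <= M &
  forall p, approx (fun t => f t * p.[t])].

Lemma multiplier_cst (a : R) : multiplier (fun=> a).
Proof.
split=> //; first by exists `|a|.
by move=> p; apply: approxZ; exact: approx_poly.
Qed.

Lemma multiplierD f g : multiplier f -> multiplier g -> multiplier (fun t => f t + g t).
Proof.
move=> [mf [M fM] fp] [mg [N gN] gp]; split; first exact: measurable_funD.
  by exists (M + N) => t; rewrite (le_trans (ler_normD _ _))// lerD.
by move=> p; under eq_fun do rewrite mulrDl; exact: approxD.
Qed.

Lemma multiplierM f g : multiplier f -> multiplier g -> multiplier (fun t => f t * g t).
Proof.
move=> [mf [M fM] fp] [mg [N gN] gp]; split; first exact: measurable_funM.
  by exists (M * N) => t; rewrite normrM ler_pM.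
move=> p; under eq_fun do rewrite -mulrA.
exact: approx_mul_bounded fp (gp p).
Qed.

Lemma multiplierB f g : multiplier f -> multiplier g -> multiplier (fun t => f t - g t).
Proof.
move=> mf mg; have := multiplierD mf (multiplierM (multiplier_cst (-1)) mg).
by congr multiplier; apply/funext => t; rewrite mulN1r.
Qed.

Lemma multiplier_limit (f_ : nat -> R -> R) f (M : R) :
  (forall n, multiplier (f_ n)) -> (forall n t, `|f_ n t| <= M) ->
  (forall t, f_ ^~ t @ \oo --> f t) -> multiplier f.
Proof.
move=> af fM f_f; have M0 : 0 <= M := le_trans (normr_ge0 _) (fM 0%N 0).
split.
- apply: (@measurable_fun_cvg _ _ _ _ f_) => [n|t _]; last exact: f_f.
  by have [] := af n.
- exists M => t; have h : (fun n => `|f_ n t|) @ \oo --> `|f t|.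
    by apply: cvg_norm; exact: f_f.
  rewrite -(cvg_lim _ h)//; apply: limr_le; first by apply/cvg_ex; eexists; exact: h.
  exact: nearW.
- move=> p; have h0 : 0 <= (0 : R) by [].
  have c80 : 0 <= c / 8 by rewrite divr_ge0 // ltW.
  have [C C0 [pC Li]] := L1_poly_exp_sqr p h0 c80.
  apply: (@approx_limit (fun n t => f_ n t * p.[t]) _
    (fun t => M * (C * expR (c / 8 * `|t|) * expR (0 * `|t|)))).
  + by move=> n; have [] := af n.
  + by move=> t; apply: cvgM; [exact: f_f|exact: cvg_cst].
  + by move=> n t; rewrite mul0r expR0 mulr1 normrM ler_pM.
  + by apply: eq_L1 (L1Z (M ^+ 2) Li) => t; rewrite mulrA -exprMn.
Qed.

Lemma multiplier_cos u : multiplier (fun t => cos (u * t)).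
Proof.
split; first exact: measurable_cos_lin.
  by exists 1 => t; exact: norm_cos_le1.
by move=> p; under eq_fun do rewrite mulrC; have [] := approx_trig_all u p.
Qed.

Lemma multiplier_sin u : multiplier (fun t => sin (u * t)).
Proof.
split; first exact: measurable_sin_lin.
  by exists 1 => t; exact: norm_sin_le1.
by move=> p; under eq_fun do rewrite mulrC; have [] := approx_trig_all u p.
Qed.

(** The iteration x |-> (3 x - x^3)/2 fixes -1, 0 and 1, and drives the rest of
    [-1, 1] to the sign; being polynomial, it stays in the algebra of multipliers. *)
Let sgn_step (x : R) : R := (3 * x - x ^+ 3) / 2.

(** One step multiplies 1 - y by 1 - (y + y^2)/2, at most 1 - x/2 when y >= x. *)
Let sgn_iter_pos (x : R) n : 0 < x <= 1 ->
  x <= iter n sgn_step x <= 1 /\ 1 - iter n sgn_step x <= (1 - x / 2) ^+ n.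
Proof.
move=> /andP[x0 x1]; elim: n => [|n [/andP[ih1 ih2] ih3]].
  by rewrite /= lexx expr0; split=> //; lra.
rewrite iterS exprS; move: (iter n sgn_step x) ih1 ih2 ih3 => y xy y1 yn.
have y0 : 0 < y by exact: lt_le_trans x0 xy.
have e1 : 1 - sgn_step y = (1 - y) * (1 - (y + y ^+ 2) / 2) by rewrite /sgn_step; field.
have e2 : sgn_step y - y = y * (1 - y ^+ 2) / 2 by rewrite /sgn_step; field.
have y2 : y ^+ 2 <= 1 by rewrite expr_le1// ltW.
have yy : 0 <= y ^+ 2 by exact: sqr_ge0.
split; first (apply/andP; split).
- rewrite (le_trans xy)// -subr_ge0 e2 divr_ge0// mulr_ge0 ?(ltW y0)// subr_ge0//.
- rewrite -subr_ge0 e1 mulr_ge0 ?subr_ge0//; lra.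
- rewrite e1 mulrC; apply: ler_pM => //; lra.
Qed.

Let sgn_stepN x : sgn_step (- x) = - sgn_step x.
Proof. by rewrite /sgn_step; field. Qed.

Let sgn_iterN n x : iter n sgn_step (- x) = - iter n sgn_step x.
Proof. by elim: n => // n ih; rewrite !iterS ih sgn_stepN. Qed.

Let sgn_iter0 n : iter n sgn_step 0 = 0.
Proof. by elim: n => // n ih; rewrite iterS ih /sgn_step expr0n mulr0 subr0 mul0r. Qed.

Let sgn_iter_cvg (x : R) : `|x| <= 1 ->
  (fun n => iter n sgn_step x) @ \oo --> Num.sg x /\ forall n, `|iter n sgn_step x| <= 1.
Proof.
have pos y : 0 < y <= 1 ->
    (fun n => iter n sgn_step y) @ \oo --> (1 : R) /\ forall n, `|iter n sgn_step y| <= 1.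
  move=> y01; have /andP[y0 y1] := y01; split; last first.
    move=> n; have [/andP[h1 h2] _] := sgn_iter_pos n y01.
    by rewrite ger0_norm// (le_trans (ltW y0)).
  apply/subr_cvg0/norm_cvg0P.
  have h : (fun n => (1 - y / 2) ^+ n) @ \oo --> (0 : R).
    apply: cvg_expr; rewrite ger0_norm; lra.
  apply: (squeeze_cvgr _ (cvg_cst 0) h); apply: nearW => n.
  have [/andP[h1 h2] h3] := sgn_iter_pos n y01.
  by rewrite normr_ge0/= distrC ger0_norm ?subr_ge0.
have [x0|x0|<-] := ltgtP 0 x.
- by move=> x1; rewrite gtr0_sg//; apply: pos; rewrite x0/= -(gtr0_norm x0).
- move=> x1; rewrite ltr0_sg//; have [|h1 h2] := pos (- x).
    by rewrite oppr_gt0 x0/= -(ltr0_norm x0).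
  split; last by move=> n; rewrite -normrN -sgn_iterN.
  rewrite (_ : (fun n => _) = (fun n => - iter n sgn_step (- x))); first exact: cvgN.
  by apply/funext => n; rewrite sgn_iterN opprK.
- move=> _; rewrite sgr0; split.
    by under eq_fun do rewrite sgn_iter0; exact: cvg_cst.
  by move=> n; rewrite sgn_iter0 normr0.
Qed.

Lemma multiplier_sg f : multiplier f -> (forall t, `|f t| <= 1) ->
  multiplier (fun t => Num.sg (f t)).
Proof.
move=> mf f1; apply: (@multiplier_limit (fun n t => iter n sgn_step (f t)) _ 1).
- elim=> [|n ih] //=.
  have m3 := multiplierM ih (multiplierM ih ih).
  have := multiplierM (multiplier_cst (2^-1)) (multiplierB (multiplierM (multiplier_cst 3) ih) m3).
  by congr multiplier; apply/funext => t; rewrite /sgn_step; field.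
- by move=> n t; have [_] := sgn_iter_cvg (f1 t); exact.
- by move=> t; have [] := sgn_iter_cvg (f1 t).
Qed.

(** The function sin ((t - a)/n) has the sign of t - a as soon as |t - a| < n pi. *)
Lemma multiplier_halfline (a : R) : multiplier (fun t => Num.sg (t - a)).
Proof.
apply: (@multiplier_limit (fun n t => Num.sg (sin (n.+1%:R^-1 * (t - a)))) _ 1).
- move=> n; apply: multiplier_sg; last by move=> t; exact: norm_sin_le1.
  set u := n.+1%:R^-1.
  have := multiplierB (multiplierM (multiplier_sin u) (multiplier_cst (cos (u * a))))
    (multiplierM (multiplier_cos u) (multiplier_cst (sin (u * a)))).
  by congr multiplier; apply/funext => t; rewrite mulrBr sinB.
- by move=> n t; rewrite normr_sg lern1 leq_b1.
- move=> t; apply: cvg_near_cst; set x := t - a; near=> n.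
  have xn : `|n.+1%:R^-1 * x| < pi.
    rewrite normrM gtr0_norm ?invr_gt0// mulrC ltr_pdivrMr// mulrC -ltr_pdivrMr ?pi_gt0//.
    rewrite (lt_le_trans (_ : _ < n%:R))// ?ler_nat//.
    by near: n; exact: nbhs_infty_gtr.
  have pos (y : R) : 0 < y -> `|n.+1%:R^-1 * y| < pi -> Num.sg (sin (n.+1%:R^-1 * y)) = 1.
    move=> y0; rewrite gtr0_norm ?mulr_gt0 ?invr_gt0// => ypi.
    by rewrite gtr0_sg// sin_gt0_pi// mulr_gt0 ?invr_gt0.
  have [x0|x0|x0] := ltgtP 0 x.
  + by rewrite pos// gtr0_sg.
  + have := pos (- x); rewrite mulrN normrN oppr_gt0 sinN sgrN => /(_ x0 xn) E.
    by rewrite (ltr0_sg x0) -[LHS]opprK E.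
  + by rewrite -x0 mulr0 sin0 sgr0.
Unshelve. all: by end_near. Qed.

(** Approaching a from the left gives the value 1 at a itself. *)
Lemma multiplier_step (a : R) : multiplier (fun t => (a <= t)%R%:R).
Proof.
apply: (@multiplier_limit (fun n t => (1 + Num.sg (t - (a - n.+1%:R^-1))) * 2^-1) _ 1).
- move=> n; apply: multiplierM; last exact: multiplier_cst.
  by apply: multiplierD; [exact: multiplier_cst|exact: multiplier_halfline].
- move=> n t; case: sgrP => _; rewrite ger0_norm; lra.
- move=> t; apply: cvg_near_cst; have [ta|] := leP a t.
    near=> n.
    have h : 0 < t - (a - n.+1%:R^-1).
      have e0 : 0 < n.+1%:R^-1 :> R by rewrite invr_gt0.
      by rewrite opprB addrC addrAC -addrA ltr_wpDr// subr_ge0.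
    by rewrite (gtr0_sg h); apply: (_ : (1 + 1) * 2^-1 = 1 :> R); field.
  rewrite -subr_gt0 => at0; near=> n.
  have h : t - (a - n.+1%:R^-1) < 0.
    have eat : n.+1%:R^-1 < a - t.
      by near: n; exact: (near_infty_natSinv_lt (PosNum at0)).
    by rewrite opprB addrCA -opprB subr_lt0.
  by rewrite (ltr0_sg h) subrr mul0r.
Unshelve. all: by end_near. Qed.

(** At most one term is nonzero, that of the unit cell containing y. *)
Lemma sum_unit_steps (v : nat -> R) (y : R) N :
  \sum_(k < N) v k * ((k%:R <= y)%R%:R - (k.+1%:R <= y)%R%:R) =
  if (0 <= y) && (y < N%:R) then v (Num.truncn y) else 0.
Proof.
elim: N => [|N ih].
  by rewrite big_ord0; case: ltP; rewrite ?andbF// => y0; rewrite leNgt y0.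
rewrite big_ord_recr/= ih.
have [y0|y0] := leP 0 y; rewrite /=; last first.
  by rewrite !leNgt !(lt_le_trans y0)//= subrr mulr0 addr0.
have [yN|yN] := ltP y N%:R.
  have yN1 : y < N.+1%:R by rewrite (lt_le_trans yN)// ler_nat.
  by rewrite [_ <= y]leNgt yN1 subrr mulr0 addr0.
rewrite add0r; have [yN1|yN1] := ltP y N.+1%:R; last by rewrite subrr mulr0.
rewrite subr0 mulr1; congr v; apply/esym/truncn_def.
by rewrite yN.
Qed.

(** A continuous function is the pointwise limit of its step functions on the grid
    of mesh 1/n in [-n, n[. *)
Lemma multiplier_continuous f (M : R) : continuous f -> (forall t, `|f t| <= M) ->
  multiplier f.
Proof.
move=> cf fM; have M0 : 0 <= M := le_trans (normr_ge0 _) (fM 0).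
pose x n k : R := k%:R / n.+1%:R - n%:R.
pose y n t : R := (t + n%:R) * n.+1%:R.
pose N n := (n.*2 * n.+1)%N.
pose f_ n t := \sum_(k < N n) f (x n k) * ((k%:R <= y n t)%R%:R - (k.+1%:R <= y n t)%R%:R).
have ky n k t : (k%:R <= y n t) = (x n k <= t).
  by rewrite /x /y -ler_pdivrMr// lerBlDr.
have f_E n t : f_ n t = if (0 <= y n t) && (y n t < (N n)%:R)
    then f (x n (Num.truncn (y n t))) else 0.
  exact: (@sum_unit_steps (fun k => f (x n k))).
apply: (@multiplier_limit f_ _ M).
- move=> n; rewrite /f_; elim: (N n) => [|m ih].
    by under eq_fun do rewrite big_ord0; exact: multiplier_cst.
  under eq_fun do rewrite big_ord_recr/= !ky.
  apply: multiplierD; first by move: ih; under eq_fun do (under eq_bigr do rewrite !ky).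
  by apply: multiplierM; [exact: multiplier_cst|
    apply: multiplierB; exact: multiplier_step].
- by move=> n t; rewrite f_E; case: ifP => _; rewrite ?normr0.
- move=> t; have tn : \forall n \near \oo, `|t| < n%:R by exact: nbhs_infty_gtr.
  have xt : (fun n => x n (Num.truncn (y n t))) @ \oo --> t.
    apply/subr_cvg0/norm_cvg0P.
    apply: (squeeze_cvgr _ (cvg_cst 0) (@cvg_harmonic R)); near=> n.
    have : `|t| < n%:R by near: n.
    rewrite ltr_norml => /andP[nt _]; rewrite normr_ge0/=.
    have y0 : 0 <= y n t by rewrite mulr_ge0// -lerBlDr sub0r ltW.
    have /andP[k1 k2] := truncn_itv y0; move: k1 k2; set k := Num.truncn _ => k1 k2.
    have -> : x n k - t = (k%:R - y n t) / n.+1%:R.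
      by rewrite /x /y mulrBl mulfK//; ring.
    rewrite normrM normfV (ger0_norm (ler0n _ _)) ler_piMl ?invr_ge0//.
    rewrite distrC ger0_norm ?subr_ge0// lerBlDl; move: k2; rewrite -natr1.
    exact: ltW.
  have h := @cvg_comp _ _ _ (fun n => x n (Num.truncn (y n t))) f _ (nbhs t) _ xt (cf t).
  apply: cvg_trans h; apply: near_eq_cvg; near=> n; rewrite f_E /=.
  have : `|t| < n%:R by near: n.
  rewrite ltr_norml => /andP[nt tn'].
  rewrite ifT// /y mulr_ge0//= -?lerBlDr ?sub0r ?(ltW nt)//.
  by rewrite /N natrM ltr_pM2r// -addnn natrD ltrD2r.
Unshelve. all: by end_near. Qed.

End PolynomialDensity.

(** * Exponentially decaying functions *)

Section Tame.
Context {R : realType}.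
Local Notation mu := (@lebesgue_measure R).
Implicit Types (G H : R -> R) (s : R[i]) (u v w x t : R).

(** Continuity and the decay inherited from the hypotheses on g0: x^alpha at 0 and
    x^(- 1 - alpha) at infinity, with x = exp u. *)
Definition tame (alpha : R) G := continuous G /\ exists2 C : R, 0 <= C &
  forall u, `|G u| <= C * expR (alpha * u) /\ `|G u| <= C * expR (- ((1 + alpha) * u)).

Variable alpha : R.

Lemma tameD G H : tame alpha G -> tame alpha H -> tame alpha (fun u => G u + H u).
Proof.
move=> [cG [C C0 GC]] [cH [D D0 HD]]; split.
  by move=> u; apply: cvgD; [exact: cG|exact: cH].
exists (C + D); first exact: addr_ge0.
move=> u; have [g1 g2] := GC u; have [h1 h2] := HD u.
by split; rewrite mulrDl (le_trans (ler_normD _ _))// lerD.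
Qed.

Lemma tameZ (a : R) G : tame alpha G -> tame alpha (fun u => a * G u).
Proof.
move=> [cG [C C0 GC]]; split.
  by move=> u; apply: cvgM; [exact: cvg_cst|exact: cG].
exists (`|a| * C); first exact: mulr_ge0.
by move=> u; have [g1 g2] := GC u; split; rewrite normrM -mulrA ler_wpM2l.
Qed.

(** Away from 0, the smaller of the two exponential bounds; its transform
    converges for - alpha < Re s < 1 + alpha. *)
Definition envelope u := hlf u * expR (alpha * u) + hlf (- u) * expR (- ((1 + alpha) * u)).

Lemma le_envelope G C : (forall u, `|G u| <= C * expR (alpha * u) /\
    `|G u| <= C * expR (- ((1 + alpha) * u))) -> 0 <= C ->
  forall u, `|G u| <= C * envelope u.
Proof.
move=> GC C0 u; have [g1 g2] := GC u; rewrite /envelope /hlf !indic_Nyc oppr_le0.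
have [u0|u0] := leP u 0.
  by rewrite (le_trans g1)// ler_wpM2l// mul1r lerDl mulr_ge0// expR_ge0.
by rewrite (ltW u0) mul0r add0r mul1r.
Qed.

Lemma lap_conv_envelope (sigma : R) : - alpha < sigma < 1 + alpha ->
  lap_conv envelope sigma.
Proof.
move=> /andP[s0 s1]; apply: lap_convD.
  have h : 0 < alpha + sigma by rewrite addrC -ltrBlDr sub0r.
  by apply: eq_L1 (lap_conv_hlf h) => u; rewrite -mulrA -expRD mulrDl.
have h : 0 < 1 + alpha - sigma by rewrite subr_gt0.
apply: eq_L1 (lap_conv_neg (lap_conv_hlf h)) => u.
by rewrite -mulrA -expRD; congr (_ * expR _); ring.
Qed.

Lemma tame_measurable G : tame alpha G -> measurable_fun setT G.
Proof. by move=> [cG _]; exact: continuous_measurable_fun. Qed.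

Lemma lap_conv_tame G (sigma : R) : tame alpha G -> - alpha < sigma < 1 + alpha ->
  lap_conv G sigma.
Proof.
move=> Gt sa; have [cG [C C0 GC]] := Gt.
apply: (lap_conv_le (tame_measurable Gt) (le_envelope GC C0)).
exact/lap_convZ/lap_conv_envelope.
Qed.

(** Integration by parts: the decay kills the boundary terms. *)
Lemma laplace_derive G G' s : tame alpha G -> tame alpha G' ->
  (forall u, is_derive u 1 G (G' u)) -> - alpha < Re s < 1 + alpha ->
  laplace G' s = - (s * laplace G s).
Proof.
move=> tG tG' dG sa; have [cG [C C0 GC]] := tG; have [cG' _] := tG'.
have /andP[sa1 sa2] := sa.
have i1 := lap_conv_CL1 (lap_conv_tame tG' sa).
have i2 := lap_conv_CL1 (lap_conv_tame tG sa).
have i3 := CL1Z s i2.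
suff h : CInt (fun u => lap_fun G' s u + s * lap_fun G s u) = 0.
  apply/eqP; rewrite -subr_eq0 opprK; apply/eqP.
  by rewrite -CIntZ// -CIntD.
have is_ := CL1D i1 i3.
have decay (f : R -> R) : (forall u, `|f u| <= `|G u| * expR (Re s * u)) ->
    (fun n : nat => f n%:R) @ \oo --> (0 : R) /\
    (fun n : nat => f (- n%:R)) @ \oo --> (0 : R).
  move=> fG.
  have cvn (b : R) : 0 < b -> (fun n : nat => C * expR (- (b * n%:R))) @ \oo --> (0 : R).
    move=> b0; rewrite -(mulr0 C); apply: cvgM; first exact: cvg_cst.
    exact: (@cvg_comp _ _ _ (fun n : nat => n%:R : R) (fun x => expR (- (b * x))) _
      (pinfty_nbhs R) _ cvgr_idn (cvg_expR_decay b0)).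
  split; apply/norm_cvg0P.
    have b0 : 0 < 1 + alpha - Re s by rewrite subr_gt0.
    apply: (squeeze_cvgr _ (cvg_cst 0) (cvn _ b0)); apply: nearW => n.
    rewrite normr_ge0/= (le_trans (fG _))//.
    apply: le_trans (ler_wpM2r (expR_ge0 _) (GC _).2) _.
    rewrite -mulrA -expRD ler_wpM2l// ler_expR le_eqVlt; apply/orP; left; apply/eqP; ring.
  have b0 : 0 < alpha + Re s by rewrite addrC -ltrBlDr sub0r.
  apply: (squeeze_cvgr _ (cvg_cst 0) (cvn _ b0)); apply: nearW => n.
  rewrite normr_ge0/= (le_trans (fG _))//.
  apply: le_trans (ler_wpM2r (expR_ge0 _) (GC _).1) _.
  rewrite -mulrA -expRD ler_wpM2l// ler_expR le_eqVlt; apply/orP; left; apply/eqP; ring.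
have [c1 c2] := cexp_continuous s.
have cR : continuous (fun u => Re (s * cexp (s * toC u))).
  under eq_fun do rewrite ReM.
  move=> u; apply: cvgB; apply: cvgM; try exact: cvg_cst; [exact: c1|exact: c2].
have cI : continuous (fun u => Im (s * cexp (s * toC u))).
  under eq_fun do rewrite ImM.
  move=> u; apply: cvgD; apply: cvgM; try exact: cvg_cst; [exact: c2|exact: c1].
have bnd (F : R[i] -> R) : (forall z, `|F z| <= normc z) -> forall u,
    `|G u * F (cexp (s * toC u))| <= `|G u| * expR (Re s * u).
  by move=> Fz u; rewrite normrM ler_wpM2l// -normc_cexp_lin.
apply: complex_eq.
  have [l1 l2] := decay _ (bnd _ (@norm_Re_le R)).
  pose f' u := G' u * Re (cexp (s * toC u)) + G u * Re (s * cexp (s * toC u)).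
  have E u : Re (lap_fun G' s u + s * lap_fun G s u) = f' u.
    by rewrite ReD /lap_fun /f' Re_scale [s * (_ * _)]mulrCA Re_scale.
  transitivity (Int f'); first exact: eq_Int E.
  rewrite -[RHS](subrr (0 : R)); apply: (@Int_derive_line _ (fun u => G u * Re (cexp (s * toC u)))) l1 l2.
  - move=> u; apply: drvM.
    by under eq_fun do rewrite cexp_linE; exact: (is_derive_cexp s u).1.
  - move=> u; apply: cvgD; apply: cvgM; [exact: cG'|exact: c1|exact: cG|].
    exact: cR.
  - exact: eq_L1 E is_.1.
have [l1 l2] := decay _ (bnd _ (@norm_Im_le R)).
pose f' u := G' u * Im (cexp (s * toC u)) + G u * Im (s * cexp (s * toC u)).
have E u : Im (lap_fun G' s u + s * lap_fun G s u) = f' u.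
  by rewrite ImD /lap_fun /f' Im_scale [s * (_ * _)]mulrCA Im_scale.
transitivity (Int f'); first exact: eq_Int E.
rewrite -[RHS](subrr (0 : R)); apply: (@Int_derive_line _ (fun u => G u * Im (cexp (s * toC u)))) l1 l2.
- move=> u; apply: drvM.
  by under eq_fun do rewrite cexp_linE; exact: (is_derive_cexp s u).2.
- move=> u; apply: cvgD; apply: cvgM; [exact: cG'|exact: c2|exact: cG|].
  exact: cI.
- exact: eq_L1 E is_.2.
Qed.

End Tame.

(** * The sequence of functions in the logarithmic variable *)

Section Eulerian.
Context {R : realType}.
Variables (g0 : R -> R) (alpha : R).
Hypothesis g0_smooth : smooth_pos g0.
Hypothesis alpha0 : 0 < alpha.
Hypothesis g0_at0 : forall k : nat,
  (fun x : R => x `^ (k%:R - alpha) * derive1n k g0 x) @ 0^'+ --> (0 : R).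
Hypothesis g0_atoo : forall k : nat,
  (fun x : R => x `^ (k%:R + 1 + alpha) * derive1n k g0 x) @ +oo --> (0 : R).
Implicit Types (f g : R -> R) (s : R[i]) (u v w x t : R).

(** The functions x^j g0^(j) are the natural unknowns: x d/dx maps them to
    combinations of each other, and the hypotheses bound exactly these. *)
Definition euler_term j x := x ^+ j * derive1n j g0 x.

Lemma is_derive_euler_term j x : 0 < x ->
  is_derive x 1 (euler_term j) (x^-1 * (j%:R * euler_term j x + euler_term j.+1 x)).
Proof.
move=> x0; have d : is_derive x 1 (derive1n j g0) (derive1n j.+1 g0 x).
  have /derivableP := @g0_smooth j x x0.
  by rewrite /derive1n iterS -[iter j _ _]/(derive1n j g0) derive1E.
have m : is_derive x 1 (fun x : R => x ^+ j) (j%:R * x ^+ j.-1).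
  by have := drv_monomial 1 j x; rewrite mul1r; under eq_fun do rewrite mul1r.
apply: is_derive_eq (drvM m d) _; rewrite /euler_term exprS.
case: j {d m} => [|j].
  by rewrite !mul0r !add0r expr0 mulr1 mulrA mulVf ?gt_eqF// mul1r.
by rewrite /= exprS; field; rewrite gt_eqF.
Qed.

Lemma drv_comp_expR f f' u : (forall x, 0 < x -> is_derive x 1 f (x^-1 * f' x)) ->
  is_derive u 1 (fun u => f (expR u)) (f' (expR u)).
Proof.
move=> df; have := is_derive1_comp (df _ (expR_gt0 u)) (is_derive_expR u).
by rewrite mulrAC mulVf ?mul1r// gt_eqF// expR_gt0.
Qed.

(** The two limits give the bounds outside a compact interval, where continuity
    gives them up to a constant. *)
Lemma tame_euler_term j : tame alpha (fun u => euler_term j (expR u)).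
Proof.
pose h u := euler_term j (expR u).
have ch : continuous h.
  move=> u; apply: (@drv_continuous _ _ u).
  by apply: drv_comp_expR => x; exact: is_derive_euler_term.
have hE (y : R) u : expR u `^ (j%:R + y) * derive1n j g0 (expR u) = expR (y * u) * h u.
  rewrite -expRM mulrDr expRD expRM_natr /h /euler_term [u * y]mulrC.
  ring.
have [a a0 ha] : exists2 a : R, a <= 0 & forall u, u < a -> `|h u| <= expR (alpha * u).
  have /cvgrPdist_le/(_ 1 ltr01)[e /= e0 He] := @g0_at0 j.
  (* The bound 0 on a, and 0 <= b below, ensure a <= b and fix the sign of u
     outside [a, b]. *)
  exists (Num.min 0 (ln e)); first by rewrite ge_min lexx.
  move=> u; rewrite lt_min => /andP[u0 ue].
  have ue' : expR u < e by rewrite -(@lnK _ e)// ltr_expR.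
  have := He (expR u); rewrite /= sub0r normrN gtr0_norm ?expR_gt0// => /(_ ue' isT).
  rewrite sub0r normrN hE normrM (ger0_norm (expR_ge0 _)) mulNr expRN.
  by rewrite ler_pdivrMl ?expR_gt0// mulr1.
have [b b0 hb] : exists2 b : R, 0 <= b &
    forall u, b < u -> `|h u| <= expR (- ((1 + alpha) * u)).
  have /cvgrPdist_le/(_ 1 ltr01)[e /= [er He]] := @g0_atoo j.
  exists (Num.max 0 (ln (Num.max 1 e))); first by rewrite le_max lexx.
  move=> u; rewrite gt_max => /andP[u0 ue].
  have ue' : e < expR u.
    rewrite (le_lt_trans (_ : _ <= Num.max 1 e))//; first by rewrite le_max lexx orbT.
    by rewrite -(@lnK _ (Num.max 1 e)) ?ltr_expR// posrE lt_max ltr01.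
  have := He (expR u) ue'.
  rewrite sub0r normrN -addrA hE normrM (ger0_norm (expR_ge0 _)) expRN.
  by rewrite -ler_pdivlMl ?expR_gt0// mulr1.
have ab : a <= b := le_trans a0 b0.
have [m _ hm] := @EVT_max R (fun u => `|h u|) a b ab
  (continuous_subspaceT (fun u => cvg_norm (ch u))).
pose B := `|h m|; pose C := 1 + B * (expR (- (alpha * a)) + expR ((1 + alpha) * b)).
have B0 : 0 <= B by exact: normr_ge0.
have C1 : 1 <= C.
  by rewrite /C lerDl mulr_ge0 ?B0 ?addr_ge0 ?expR_ge0.
have aa : 0 < 1 + alpha by rewrite addr_gt0.
split=> //; exists C; first exact: le_trans ler01 C1.
move=> u; rewrite -/(h u).
have [ua|ua] := ltP u a.
  have u0 : u <= 0 by rewrite (le_trans (ltW ua)).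
  have h1 : `|h u| <= C * expR (alpha * u).
    by rewrite (le_trans (ha u ua))// ler_peMl// expR_ge0.
  have au : alpha * u <= 0 by rewrite mulr_ge0_le0// ltW.
  split=> //; apply: le_trans h1 _.
  by rewrite ler_wpM2l ?(le_trans ler01)// ler_expR mulrDl mul1r; lra.
have [ub|ub] := ltP b u.
  have u0 : 0 <= u by rewrite (le_trans b0 (ltW ub)).
  have h1 : `|h u| <= C * expR (- ((1 + alpha) * u)).
    by rewrite (le_trans (hb u ub))// ler_peMl// expR_ge0.
  have au : 0 <= alpha * u by rewrite mulr_ge0// ltW.
  split=> //; apply: le_trans h1 _.
  by rewrite ler_wpM2l ?(le_trans ler01)// ler_expR mulrDl mul1r; lra.
have hB : `|h u| <= B by apply: hm; rewrite in_itv/= ua.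
have e1 : B <= C * expR (alpha * u).
  apply: (@le_trans _ _ (B * expR (- (alpha * a)) * expR (alpha * u))).
    rewrite -mulrA -expRD ler_peMr// -[leLHS]expR0 ler_expR addrC subr_ge0.
    by rewrite ler_pM2l.
  rewrite ler_wpM2r ?expR_ge0// /C mulrDr ler_wpDl// lerDl mulr_ge0// expR_ge0.
have e2 : B <= C * expR (- ((1 + alpha) * u)).
  apply: (@le_trans _ _ (B * expR ((1 + alpha) * b) * expR (- ((1 + alpha) * u)))).
    rewrite -mulrA -expRD ler_peMr// -[leLHS]expR0 ler_expR subr_ge0.
    by rewrite ler_pM2l.
  rewrite ler_wpM2r ?expR_ge0// /C mulrDr ler_wpDl// lerDr mulr_ge0// expR_ge0.
by split; apply: le_trans hB _.
Qed.

(** The span of the x^j g0^(j) on the positive half-line. It is stable under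
    x d/dx, hence contains every g_k. *)
Inductive eulerian : (R -> R) -> Prop :=
| eulerian_term j : eulerian (euler_term j)
| eulerianD f g : eulerian f -> eulerian g -> eulerian (fun x => f x + g x)
| eulerianZ (a : R) f : eulerian f -> eulerian (fun x => a * f x)
| eulerian_ext f g : (forall x, 0 < x -> f x = g x) -> eulerian f -> eulerian g.

Lemma eulerian_tame f : eulerian f -> tame alpha (fun u => f (expR u)).
Proof.
elim=> [j|{}f g _ tf _ tg|a {}f _ tf|{}f g fg _ tf].
- exact: tame_euler_term.
- exact: tameD.
- exact: tameZ.
- by under eq_fun do rewrite -fg ?expR_gt0//.
Qed.

(** Differentiating in the logarithmic variable stays in the class. *)
Lemma eulerian_derive f : eulerian f -> exists2 f', eulerian f' &
  forall x, 0 < x -> is_derive x 1 f (x^-1 * f' x).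
Proof.
elim=> [j|{}f g _ [f' ef df] _ [g' eg dg]|a {}f _ [f' ef df]|{}f g fg _ [f' ef df]].
- exists (fun x => j%:R * euler_term j x + euler_term j.+1 x).
    by apply: eulerianD; [apply: eulerianZ|]; exact: eulerian_term.
  by move=> x; exact: is_derive_euler_term.
- exists (fun x => f' x + g' x); first exact: eulerianD.
  by move=> x x0; rewrite mulrDr; apply: drvD; [exact: df|exact: dg].
- exists (fun x => a * f' x); first exact: eulerianZ.
  by move=> x x0; rewrite mulrCA; apply: drvZ; exact: df.
- exists f' => // x x0; apply: near_eq_is_derive (df x x0).
  by near=> y; apply: fg; near: y; exact: lt_nbhsr.
Unshelve. all: by end_near. Qed.

Variable r : nat -> R.

Lemma gseq_eulerian k : eulerian (gseq r g0 k).
Proof.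
elim: k => [|k ek] /=.
  apply: eulerian_ext (eulerian_term 0) => x x0.
  by rewrite /euler_term expr0 mul1r.
have [f' ef df] := eulerian_derive ek.
apply: eulerian_ext (eulerianD (eulerianZ (-1) ef) (eulerianZ (- r k) ek)) => x x0.
rewrite derive1E (@derive_val _ _ _ _ _ _ _ (df x x0)) mulNr mulNr mul1r mulNr.
by rewrite mulrA mulfV ?mul1r// gt_eqF.
Qed.

Definition glog k u := gseq r g0 k (expR u).

Lemma tame_glog k : tame alpha (glog k).
Proof. exact: eulerian_tame (gseq_eulerian k). Qed.

(** The Euler operator is d/du in the logarithmic variable, so it contributes a
    factor - s. *)
Lemma laplace_glogS k s : - alpha < Re s < 1 + alpha ->
  laplace (glog k.+1) s = (s - toC (r k)) * laplace (glog k) s.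
Proof.
move=> sa; have [f' ef df] := eulerian_derive (gseq_eulerian k).
have tf' := eulerian_tame ef; have tk := tame_glog k.
have lf := lap_conv_tame tf' sa; have lk := lap_conv_tame tk sa.
have dk u : is_derive u 1 (glog k) (f' (expR u)) by exact: drv_comp_expR.
have -> : glog k.+1 = fun u => -1 * f' (expR u) + - r k * glog k u.
  apply/funext => u; rewrite /glog /=.
  rewrite derive1E (@derive_val _ _ _ _ _ _ _ (df _ (expR_gt0 u))) mulN1r mulNr mulNr.
  by rewrite mulrA mulfV ?mul1r// gt_eqF// expR_gt0.
rewrite laplaceD; [|exact: lap_convZ..].
rewrite !laplaceZ// (laplace_derive tk tf' dk sa) !rmorphN rmorph1; ring.
Qed.

Lemma laplace_glog k s : - alpha < Re s < 1 + alpha ->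
  laplace (glog k) s = \prod_(j < k) (s - toC (r j)) * laplace (glog 0) s.
Proof.
move=> sa; elim: k => [|k ih]; first by rewrite big_ord0 mul1r.
by rewrite laplace_glogS// ih big_ord_recr/= mulrA [_ * (s - _)]mulrC.
Qed.

Lemma gseq_continuous k x : 0 < x -> {for x, continuous (gseq r g0 k)}.
Proof.
have [f' _ df] := eulerian_derive (gseq_eulerian k).
by move=> x0; exact: drv_continuous (df x x0).
Qed.

End Eulerian.

(** * Mellin transforms in the logarithmic variable *)

Section MellinLog.
Context {R : realType}.
Local Notation mu := (@lebesgue_measure R).
Implicit Types (f g G : R -> R) (s : R[i]) (u v w x t : R).

Lemma measurable_mellin_integrand f s : measurable_fun (`]0, +oo[ : set R) f ->
  measurable_fun (`]0, +oo[ : set R) (fun x => Re (mellin_integrand f s x)) /\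
  measurable_fun (`]0, +oo[ : set R) (fun x => Im (mellin_integrand f s x)).
Proof.
move=> mf; split.
  rewrite [X in measurable_fun _ X](_ : _ =
    fun x => f x * (x `^ Re (s - 1) * cos (Im (s - 1) * ln x))); last first.
    by apply/funext => x; rewrite /mellin_integrand Re_scale.
  apply: measurable_funM => //; apply: measurable_funTS; apply: measurable_funM.
    exact: measurable_powR.
  apply: measurableT_comp; first exact: measurable_cos.
  by apply: measurable_funM => //; exact: measurable_ln.
rewrite [X in measurable_fun _ X](_ : _ =
  fun x => f x * (x `^ Re (s - 1) * sin (Im (s - 1) * ln x))); last first.
  by apply/funext => x; rewrite /mellin_integrand Im_scale.
apply: measurable_funM => //; apply: measurable_funTS; apply: measurable_funM.
  exact: measurable_powR.
apply: measurableT_comp; first exact: measurable_sin.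
by apply: measurable_funM => //; exact: measurable_ln.
Qed.

(** The Jacobian exp u restores the exponent s - 1 to s. *)
Lemma mellin_integrand_expR f s u :
  toC (expR u) * mellin_integrand f s (expR u) = lap_fun (fun u => f (expR u)) s u.
Proof.
rewrite /mellin_integrand cpow_expR mulrCA -cexp_toC -cexpD; congr (_ * cexp _).
ring.
Qed.

Lemma mellin_laplace f s : measurable_fun (`]0, +oo[ : set R) f ->
  mellin f s = laplace (fun u => f (expR u)) s.
Proof.
move=> mf; have [m1 m2] := measurable_mellin_integrand s mf.
rewrite /mellin /cintegral !Rintegral_expR// /laplace /CInt; congr Complex.
  by apply: eq_Int => u; rewrite -mellin_integrand_expR [RHS]Re_scale [RHS]mulrC.
by apply: eq_Int => u; rewrite -mellin_integrand_expR [RHS]Im_scale [RHS]mulrC.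
Qed.

Lemma mellin_defined_log f s : measurable_fun (`]0, +oo[ : set R) f ->
  lap_conv (fun u => f (expR u)) (Re s) -> mellin_defined f s.
Proof.
move=> mf fi; have [m1 m2] := measurable_mellin_integrand s mf; split=> //.
have nE x : 0 < x -> normc (mellin_integrand f s x) = `|f x| * x `^ (Re s - 1).
  move=> x0; rewrite /mellin_integrand normcM normcR cpowE// normc_cexp_lin.
  by rewrite /powR gt_eqF// ReD ReN.
rewrite [X in (X < _)%E](_ : _ =
    \int[mu]_(x in `]0%R, +oo[) (`|f x| * x `^ (Re s - 1))%:E)%E; last first.
  apply: eq_integral => x; rewrite inE/= in_itv/= andbT => x0.
  by congr EFin; exact: nE.
rewrite ge0_integral_expR_in.
- have := lty_L1 fi; congr (_ < _)%E; apply: eq_integral => u _.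
  rewrite normrM (ger0_norm (expR_ge0 _)) -mulrA -expRM -expRD.
  by congr (_ * expR _)%:E; ring.
- apply: measurable_funM; first exact: measurableT_comp.
  by apply: measurable_funTS; exact: measurable_powR.
- by move=> x _; rewrite mulr_ge0// powR_ge0.
Qed.

(** The transform g |-> g^x in the logarithmic variable, see [cross_expR]. *)
Definition fracconv G v := Int (fun u => fracker (v - u) * G u).

Lemma cross_expR g v : measurable_fun (`]0, +oo[ : set R) g ->
  cross g (expR v) = fracconv (fun u => g (expR u)) v.
Proof.
move=> mg; rewrite /cross Rintegral_expR.
  apply: eq_Int => u; rewrite divfK ?gt_eqF ?expR_gt0// /fracker.
  by rewrite opprB expRD expRN.
have h : measurable_fun (`]0, +oo[ : set R)
    (fun x => frac_part (x / expR v) * g x * x `^ (-1)).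
  apply: measurable_funM; last by apply: measurable_funTS; exact: measurable_powR.
  apply: measurable_funM => //; apply: measurable_funTS.
  apply: measurableT_comp; first exact: measurable_frac_part.
  exact: measurable_funM.
apply: eq_measurable_fun h => x; rewrite inE/= in_itv/= andbT => x0.
by rewrite powR_inv1// ltW.
Qed.

(** The kernel is at most min (1, exp (- w)). *)
Lemma fracker_exp_bound (sigma w : R) : 0 < sigma < 1 -> `|fracker w * expR (sigma * w)| <= 1.
Proof.
move=> /andP[s0 s1]; have /andP[f0 f1] := fracker01 w.
rewrite ger0_norm ?mulr_ge0 ?expR_ge0//.
have [w0|w0] := leP w 0.
  rewrite -[leRHS]mulr1 ler_pM// ?expR_ge0// -expR0 ler_expR.
  by rewrite mulr_ge0_le0// ltW.
apply: le_trans (ler_wpM2r (expR_ge0 _) (frac_part_le (expR_ge0 _))) _.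
rewrite -expRD -expR0 ler_expR; nra.
Qed.

(** The convolution theorem, applied to the real and imaginary parts of the two
    weighted factors. The last bound is what makes the combinations of the g_k^x
    admissible in [plancherel_le]. *)
Lemma laplace_fracconv G s : 0 < Re s < 1 -> lap_conv G (Re s) ->
  [/\ lap_conv (fracconv G) (Re s),
      laplace (fracconv G) s = laplace fracker s * laplace G s &
      forall v, `|fracconv G v * expR (Re s * v)| <= Int (fun u => `|G u * expR (Re s * u)|)].
Proof.
move=> s01 Gi; have Fi := lap_conv_fracker s01.
have mG := lap_conv_measurable Gi.
pose p w := fracker w * expR (Re s * w); pose q u := G u * expR (Re s * u).
have p1 w : `|p w| <= 1 by exact: fracker_exp_bound.
have mp : measurable_fun setT p by exact: L1_measurable Fi.
have mps v : measurable_fun setT (fun u => p (v - u)).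
  by apply: measurableT_comp => //; exact: measurable_funB.
have pqi v : L1 (fun u => p (v - u) * q u).
  apply: (@eq_L1 _ (fun u => q u * p (v - u))) => [u|]; first by rewrite mulrC.
  exact: (@L1_mul_bounded _ _ _ 1).
have E v : fracconv G v * expR (Re s * v) = Int (fun u => p (v - u) * q u).
  have fE u : p (v - u) * q u = expR (Re s * v) * (fracker (v - u) * G u).
    rewrite /p /q mulrBr expRD expRN; field.
    by rewrite gt_eqF// expR_gt0.
  have fi : L1 (fun u => fracker (v - u) * G u).
    apply: eq_L1 (L1Z (expR (Re s * v))^-1 (pqi v)) => u.
    by rewrite fE mulKf// gt_eqF// expR_gt0.
  by rewrite mulrC -IntZ//; apply: eq_Int => u; rewrite fE.
have [Li _] := convolution Fi Gi p1.
split.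
- by apply: eq_L1 Li => v; rewrite E.
- have [pc ps] := lap_conv_CL1 Fi; have [qc qs] := lap_conv_CL1 Gi.
  have bR w : `|Re (lap_fun fracker s w)| <= 1.
    by rewrite (le_trans (norm_Re_le _))// normc_lap_fun fracker_exp_bound.
  have bI w : `|Im (lap_fun fracker s w)| <= 1.
    by rewrite (le_trans (norm_Im_le _))// normc_lap_fun fracker_exp_bound.
  have [cc1 cc2] := convolution pc qc bR.
  have [ss1 ss2] := convolution ps qs bI.
  have [cs1 cs2] := convolution pc qs bR.
  have [sc1 sc2] := convolution ps qc bI.
  have inner (a b : R -> R) : L1 a -> L1 b -> (forall w, `|a w| <= 1) ->
      forall v, L1 (fun u => a (v - u) * b u).
    move=> ai bi a1 v; apply: (@eq_L1 _ (fun u => b u * a (v - u))) => [u|].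
      by rewrite mulrC.
    apply: (@L1_mul_bounded _ _ _ 1) => //.
    by apply: measurableT_comp; [exact: L1_measurable|exact: measurable_funB].
  have split_ v u : toC (p (v - u) * q u) * Complex (cos (Im s * v)) (sin (Im s * v)) =
      lap_fun fracker s (v - u) * lap_fun G s u.
    apply: complex_eq; [rewrite Re_scale ReM|rewrite Im_scale ImM];
      rewrite !Re_lap_fun !Im_lap_fun /= /p /q;
      rewrite -[Im s * v](subrK (Im s * u)) -mulrBr ?cosD ?sinD; ring.
  have Rv v : Re (lap_fun (fracconv G) s v) =
      Int (fun u => Re (lap_fun fracker s (v - u)) * Re (lap_fun G s u)) -
      Int (fun u => Im (lap_fun fracker s (v - u)) * Im (lap_fun G s u)).
    rewrite -IntB; [|exact: (inner _ _ pc qc bR v)|exact: (inner _ _ ps qs bI v)].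
    rewrite Re_lap_fun mulrA E mulrC -IntZ//; apply: eq_Int => u.
    by rewrite -ReM -split_ Re_scale mulrC.
  have Iv v : Im (lap_fun (fracconv G) s v) =
      Int (fun u => Re (lap_fun fracker s (v - u)) * Im (lap_fun G s u)) +
      Int (fun u => Im (lap_fun fracker s (v - u)) * Re (lap_fun G s u)).
    rewrite -IntD; [|exact: (inner _ _ pc qs bR v)|exact: (inner _ _ ps qc bI v)].
    rewrite Im_lap_fun mulrA E mulrC -IntZ//; apply: eq_Int => u.
    by rewrite -ImM -split_ Im_scale mulrC.
  apply: complex_eq.
    rewrite ReM [LHS]/= (eq_Int Rv) IntB// cc2 ss2.
    by [].
  rewrite ImM [LHS]/= (eq_Int Iv) IntD// cs2 sc2.
  by [].
- move=> v; rewrite E (le_trans (le_norm_Int (pqi v)))//.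
  apply: le_Int; [exact: L1_norm|exact: L1_norm|].
  by move=> u; rewrite normrM ler_piMl.
Qed.

Lemma measurable_cross g : measurable_fun (`]0, +oo[ : set R) g ->
  measurable_fun setT (fracconv (fun u => g (expR u))) ->
  measurable_fun (`]0, +oo[ : set R) (cross g).
Proof.
move=> mg mX.
have mXl : measurable_fun (`]0, +oo[ : set R)
    (fun t => fracconv (fun u => g (expR u)) (ln t)).
  by apply: measurable_funTS; apply: measurableT_comp => //; exact: measurable_ln.
apply: eq_measurable_fun mXl => t; rewrite inE/= in_itv/= andbT => t0.
by rewrite -cross_expR// lnK.
Qed.

(** The variable is moved from the kernel, which jumps, to G, which is continuous
    and dominated, uniformly for v near v0, by a multiple of the reflected envelope. *)
Lemma fracconv_continuous (alpha : R) G : 0 < alpha -> tame alpha G ->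
  continuous (fracconv G).
Proof.
move=> alpha0 tG v0; have [cG [C C0 GC]] := tG.
have G0 : - alpha < (0 : R) < 1 + alpha by rewrite oppr_lt0 alpha0 addr_gt0.
have Gi : L1 G by apply: eq_L1 (lap_conv_tame tG G0) => u; rewrite mul0r expR0 mulr1.
have rev v : L1 (fun w => fracker w * G (v - w)) /\
    fracconv G v = Int (fun w => fracker w * G (v - w)).
  have mfr : measurable_fun setT (fun u => fracker (v - u)).
    by apply: measurableT_comp; [exact: measurable_fracker|exact: measurable_funB].
  have h : L1 (fun u => fracker (v - u) * G u).
    apply: (@eq_L1 _ (fun u => G u * fracker (v - u))) => [u|]; first by rewrite mulrC.
    apply: (@L1_mul_bounded _ _ _ 1) => // u.
    by have /andP[f0 f1] := fracker01 (v - u); rewrite ger0_norm.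
  have [h1 e1] := Int_affine v ltr01 h; have [h2 e2] := Int_neg h1.
  have E u : fracker (v - (1 * - u + v)) * G (1 * - u + v) = fracker u * G (v - u).
    by rewrite mul1r [- u + v]addrC opprB addrCA subrr addr0.
  split; first exact: eq_L1 E h2.
  by rewrite /fracconv e1 e2 mul1r; apply: eq_Int.
have -> : fracconv G = fun v => \int[mu]_w (fracker w * G (v - w)).
  by apply/funext => v; have [_ ->] := rev v.
pose K := C * (expR (alpha * (v0 + 1)) + expR (- ((1 + alpha) * (v0 - 1)))).
have ei : L1 (fun w => K * envelope alpha (- w)).
  apply: L1Z; have := lap_conv_envelope G0 => /Int_neg[+ _].
  by apply: eq_L1 => u; rewrite mul0r expR0 mulr1.
have a1 : 0 < 1 + alpha by rewrite addr_gt0.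
have := @continuity_under_integral R _ _ mu (fun v w => fracker w * G (v - w)) setT
  measurableT (v0 - 1) (v0 + 1) _ _ (fun w => K * envelope alpha (- w)).
apply.
- by move=> v _; exact: (rev v).1.
- apply: aeW => w _ v _; apply: cvgM; first exact: cvg_cst.
  apply: (@cvg_comp _ _ _ (fun v => v - w) G _ (nbhs (v - w))); last exact: cG.
  by apply: cvgB; [exact: cvg_id|exact: cvg_cst].
- exact: ei.
- move=> v; rewrite /= in_itv/= => /andP[v1 v2]; apply: aeW => w _.
  have /andP[f0 f1] := fracker01 w; rewrite normrM ger0_norm//.
  apply: (@le_trans _ _ `|G (v - w)|); first by rewrite ler_piMl.
  have [g1 g2] := GC (v - w); rewrite /K /envelope /hlf !indic_Nyc opprK oppr_le0.
  rewrite -mulrA; have [w0|w0] := leP 0 w.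
    apply: le_trans g1 _; rewrite ler_wpM2l// mul1r.
    apply: (@le_trans _ _ (expR (alpha * (v0 + 1)) * expR (alpha * - w))).
      by rewrite -expRD ler_expR -mulrDr ler_pM2l// lerD2r ltW.
    apply: ler_pM; rewrite ?expR_ge0 ?lerDl ?expR_ge0// mulr_ge0// expR_ge0.
  rewrite (ltW w0) mul0r add0r mul1r.
  apply: le_trans g2 _; rewrite ler_wpM2l//.
  apply: (@le_trans _ _ (expR (- ((1 + alpha) * (v0 - 1))) *
      expR (- ((1 + alpha) * - w)))).
    by rewrite -expRD ler_expR -opprD lerN2 -mulrDr ler_pM2l// lerD2r ltW.
  by apply: ler_pM; rewrite ?expR_ge0 ?lerDr ?expR_ge0.
- by rewrite inE/= in_itv/= ltrBlDr ltrDl ltr01.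
Qed.

End MellinLog.

(** * Zeros on the critical line *)

Section NonVanishing.
Context {R : realType}.
Local Notation mu := (@lebesgue_measure R).
Implicit Types (f g G : R -> R) (s z w : R[i]) (u v x t : R).

Definition has_cluster_of_zeros (F : R[i] -> R[i]) z := forall e : R, 0 < e ->
  exists w, [/\ w != z, normc (w - z) < e & F w = 0].

(** Every nonempty partial sum of the series at 2 is at least its first term 1. *)
Lemma zeta_cont_2_neq0 : zeta_cont (toC 2 : R[i]) != 0.
Proof.
have s1 : 1 < Re (toC 2 : R[i]) by rewrite /= ltr1n.
have /cvgCP[h _] := zeta_cont_series s1.
suff : 1 <= Re (zeta_cont (toC 2 : R[i])).
  by apply: contraTneq => ->; rewrite ler10.
rewrite -(cvg_lim _ h)//; apply: limr_ge; first by apply/cvg_ex; eexists; exact: h.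
exists 1%N => // n /= n0; case: n n0 => // n _.
have E (k : nat) : Re (cpow k.+1%:R (- toC 2) : R[i]) = k.+1%:R `^ (- 2).
  by rewrite /cpow /= oppr0 mul0r cos0 mulr1.
rewrite (Re_sum _ (fun k => cpow k.+1%:R (- toC 2))).
rewrite (eq_bigr (fun k : 'I_n.+1 => k.+1%:R `^ (- 2))); last by move=> k _; exact: E.
rewrite big_ord_recl powR1 lerDl sumr_ge0// => k _; exact: powR_ge0.
Qed.

(** Vanishing near s would propagate to 2 along the segment from s to 2, which
    avoids the pole 1 since s is not real. *)
Lemma zeta_cont_nonvanishing s : 0 < Re s -> Im s != 0 -> ~ vanishes_near zeta_cont s.
Proof.
move=> s0 si /vanishes_along_segment => /(_ (toC 2)) h.
have [t /andP[t0 t1]|e e0] := h; last first.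
  move=> /(_ (toC 2)); rewrite subrr normc0 => /(_ e0) /eqP.
  by rewrite (negbTE zeta_cont_2_neq0).
apply: zeta_cont_analytic.
  by rewrite ReD Re_scale ReD ReN /=; nra.
have [->|t11] := eqVneq t 1.
  rewrite rmorph1 mul1r addrC subrK; apply/eqP => /(congr1 (@complex.Re R)) /=; lra.
apply/eqP => /(congr1 (@complex.Im R)).
rewrite ImD Im_scale ImD ImN /= => /eqP.
rewrite (_ : Im s + _ = (1 - t) * Im s); last by ring.
by rewrite mulf_eq0 (negbTE si) orbF subr_eq0 eq_sym (negbTE t11).
Qed.

Lemma laplace_fracker_isolated s : 0 < Re s < 1 -> Im s != 0 ->
  ~ has_cluster_of_zeros (laplace fracker) s.
Proof.
move=> /andP[s0 s1] si acc; apply: (@zeta_cont_nonvanishing s) => //.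
apply: analytic_vanishes.
  by apply: zeta_cont_analytic => //; apply: contraTneq s1 => ->; rewrite ltxx.
move=> e e0; pose d := Num.min e (Num.min (Re s) (1 - Re s)).
have d0 : 0 < d by rewrite !lt_min e0 s0 subr_gt0.
have [w [ws wd Fw]] := acc d d0; exists w.
move: wd; rewrite !lt_min => /andP[we /andP[w1 w2]]; split=> //.
have := norm_Re_le (w - s); rewrite ReD ReN => wRe.
have w01 : 0 < Re w < 1.
  move: (le_lt_trans wRe w1) (le_lt_trans wRe w2); rewrite !ltr_norml.
  by move=> /andP[? ?] /andP[? ?]; apply/andP; split; lra.
have wn0 : w != 0 by apply: contraTneq w01 => ->; rewrite ltxx.
move/eqP: Fw; rewrite laplace_fracker_zeta_cont// oppr_eq0 mulf_eq0 invr_eq0.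
by rewrite (negbTE wn0) orbF => /eqP.
Qed.

Lemma laplace_shift h (a t : R) :
  laplace h (Complex a t) = laplace (fun u => h u * expR (a * u)) (Complex 0 t).
Proof.
apply: eq_CInt => u; apply: complex_eq.
  by rewrite !Re_lap_fun /= mul0r expR0 mul1r mulrA.
by rewrite !Im_lap_fun /= mul0r expR0 mul1r mulrA.
Qed.

Lemma normc2_laplace_line phi t : normc (laplace phi (Complex 0 t)) ^+ 2 = fnorm2 phi t.
Proof. by rewrite sqr_normc laplace_imag. Qed.

Lemma tame_half (alpha : R) G : 0 < alpha -> tame alpha G ->
  let phi u := G u * expR (2^-1 * u) in
  [/\ L1 phi, continuous phi & exists M, forall u, `|phi u| <= M].
Proof.
move=> alpha0 tG phi; have [cG [C C0 GC]] := tG; split.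
- apply: (lap_conv_tame tG); apply/andP; split; lra.
- move=> u; apply: cvgM; first exact: cG.
  apply: (@cvg_comp _ _ _ (fun u => 2^-1 * u) expR _ (nbhs (2^-1 * u))).
    by apply: cvgM; [exact: cvg_cst|exact: cvg_id].
  exact: continuous_expR.
- exists C => u; have [g1 g2] := GC u; rewrite /phi normrM (ger0_norm (expR_ge0 _)).
  have [u0|u0] := leP u 0.
    rewrite (le_trans (ler_wpM2r (expR_ge0 _) g1))// -mulrA -expRD ler_piMr//.
    rewrite -[leRHS]expR0 ler_expR; nra.
  rewrite (le_trans (ler_wpM2r (expR_ge0 _) g2))// -mulrA -expRD ler_piMr//.
  rewrite -[leRHS]expR0 ler_expR; nra.
Qed.

Lemma Int_indic_cc (a b : R) : a < b -> L1 \1_`[a, b] /\ Int \1_`[a, b] = b - a.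
Proof.
move=> ab; have h : L1 (\1_`[a, b] : R -> R).
  by have := L1_indic_itv a b (@cst_continuous R R 1); apply: eq_L1 => u; rewrite mulr1.
split=> //; apply: EFin_inj; rewrite EFin_Int// integral_indic//= setIT.
by rewrite lebesgue_measure_itv/= lte_fin ab.
Qed.

(** The Plancherel inequality bounds the integral of phi^2 by 0, whereas a nonzero
    value of the continuous function phi would make it positive. *)
Lemma laplace_line_inj (alpha : R) G : 0 < alpha -> tame alpha G ->
  (forall t, laplace G (Complex 2^-1 t) = 0) -> forall u, G u = 0.
Proof.
move=> alpha0 tG G0 u0; have [pii pc [M pM]] := tame_half alpha0 tG.
set phi := fun u => _ in pii pc pM.
have pae : {ae mu, forall u, {for u, continuous phi}} by apply: aeW => u; exact: pc.
have := plancherel_le pii pM pae.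
rewrite (_ : (\int[mu]_t (fnorm2 phi t)%:E = 0)%E); last first.
  apply: integral0_eq => t _; rewrite -normc2_laplace_line -laplace_shift G0.
  by rewrite normc0 expr0n.
have p2i : L1 (fun u => phi u ^+ 2).
  by apply: eq_L1 (L1_mul_bounded pii (L1_measurable pii) pM) => u; rewrite expr2.
rewrite -EFin_Int// -EFinM lee_fin pmulr_rle0 ?mulr_gt0 ?pi_gt0// => I0.
apply/eqP/negPn/negP => Gu.
have phi0 : 0 < phi u0 ^+ 2.
  by rewrite exprn_even_gt0//= mulf_neq0// gt_eqF// expR_gt0.
have c2 : (fun u => phi u ^+ 2) @ u0 --> phi u0 ^+ 2.
  apply: (@cvg_comp _ _ _ phi (fun x => x ^+ 2) _ (nbhs (phi u0))); first exact: pc.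
  exact: exprn_continuous.
have m0 : 0 < phi u0 ^+ 2 / 2 by rewrite divr_gt0.
have /cvgrPdist_lt/(_ _ m0)[d /= d0 hd] := c2.
have d2 : u0 - d / 2 < u0 + d / 2 by lra.
have [ii iE] := Int_indic_cc d2.
have : Int (fun u => phi u0 ^+ 2 / 2 * \1_`[u0 - d / 2, u0 + d / 2] u) <=
    Int (fun u => phi u ^+ 2).
  apply: le_Int => //; first exact: L1Z.
  move=> u; rewrite indic_cc; have [ud|_] := boolP (_ <= _ <= _); last by rewrite mulr0 sqr_ge0.
  have : `|phi u0 ^+ 2 - phi u ^+ 2| < phi u0 ^+ 2 / 2.
    by apply: hd => /=; rewrite ltr_norml; move: ud => /andP[? ?]; apply/andP; split; lra.
  by rewrite ltr_norml mulr1 => /andP[_]; lra.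
rewrite IntZ// iE leNgt => /negP; apply.
by rewrite (le_lt_trans I0)// mulr_gt0//; lra.
Qed.

(** Zeros accumulating at a point of the line would make the transform vanish near
    that point, hence along the whole line. *)
Lemma laplace_tame_isolated (alpha : R) G t0 u0 : 0 < alpha -> tame alpha G -> G u0 != 0 ->
  ~ has_cluster_of_zeros (laplace G) (Complex 2^-1 t0).
Proof.
move=> alpha0 tG Gu acc.
have an s : Re s = 2^-1 -> analytic_at (laplace G) s.
  move=> s2; apply: (@laplace_analytic _ _ _ 2^-1) => //; rewrite s2;
    apply: (lap_conv_tame tG); apply/andP; split; lra.
have v0 : vanishes_near (laplace G) (Complex 2^-1 t0) by apply: analytic_vanishes => //; exact: an.
move/eqP: Gu; apply; apply: (laplace_line_inj alpha0 tG) => t.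
have [e e0 h] : vanishes_near (laplace G) (Complex 2^-1 t).
  apply: vanishes_along_segment v0 => x _; apply: an.
  by rewrite ReD Re_scale ReD ReN /= subrr mulr0 addr0.
by apply: h; rewrite subrr normc0.
Qed.

(** The points of S outside 0 are isolated: sending each to a rational just to
    its right, within its isolation radius, is injective, so S is countable. *)
Lemma isolated_null (S : set R) :
  (forall t, t != 0 -> exists2 e : R, 0 < e & forall w : R, w != t -> `|w - t| < e -> ~ S w) ->
  measurable S -> mu S = 0.
Proof.
move=> iso mS.
have countS : countable (S `\ 0).
  have ex t : exists q : rat, t != 0 -> exists2 e : R, 0 < e &
      (t < ratr q < t + e) /\ forall w : R, w != t -> `|w - t| < e -> ~ S w.
    have [->|t0] := eqVneq t 0; first by exists 0.
    have [e e0 he] := iso t t0.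
    have te : t < t + e by rewrite ltrDl.
    have [q] := rat_in_itvoo te; rewrite in_itv/= => qte.
    by exists q => _; exists e.
  have [q hq] := choice ex.
  apply/countable_injP; exists (pickle \o q) => t t' /set_mem[St t0] /set_mem[St' t0'] /=.
  move=> /(pcan_inj pickleK) qq.
  have [|e e0 [qte he]] := hq t; first exact/eqP.
  have [|e' e'0 [qte' he']] := hq t'; first exact/eqP.
  rewrite qq in qte; case/andP: qte => q1 q2; case/andP: qte' => q3 q4.
  have [//|tt] := eqVneq t t'.
  have [lt|lt|//] := ltgtP t t'.
    exfalso; apply: (he t') => //; first by rewrite eq_sym.
    by rewrite gtr0_norm ?subr_gt0// ltrBlDl (lt_trans q3).
  exfalso; apply: (he' t) => //.
  by rewrite gtr0_norm ?subr_gt0// ltrBlDl (lt_trans q1).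
have h : mu (S `\ (0 : R)) = 0 by exact: countable_lebesgue_measure0.
apply/eqP; rewrite eq_le measure_ge0 andbT.
apply: (@le_trans _ _ (mu ((S `\ 0) `|` [set 0]))).
  apply: le_measure; rewrite ?inE//.
    by apply: measurableU => //; exact: measurableD.
  by move=> t St; have [->|/eqP t0] := eqVneq t 0; [right|left].
have <- : (mu (S `\ 0%R) + mu [set 0%R] = 0)%E.
  by rewrite h lebesgue_measure_set1 adde0.
by apply: measureU2 => //; exact: measurableD.
Qed.

End NonVanishing.

(** * Real polynomials on the critical line *)

Section PolynomialsOnTheLine.
Context {R : realType}.
Implicit Types (p Q : {poly R}) (t : R) (s : R[i]).

Definition line t : R[i] := Complex 2^-1 t.
Definition ceval Q s : R[i] := (map_poly (real_complex R) Q).[s].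

Lemma ceval_lin Q s (a b : R) :
  ceval (Q * ('X - b%:P) + a%:P) s = ceval Q s * (s - toC b) + toC a.
Proof. by rewrite /ceval rmorphD rmorphM rmorphB /= map_polyX !map_polyC/= !hornerE. Qed.

(** On the line s - 1/2 = i t, so multiplication by s - 1/2 exchanges polynomials
    in t that are real and even with those that are imaginary and odd. *)
Lemma ceval_parity p : exists Q1 Q2, forall t,
  ceval Q1 (line t) = Complex ((p.[t] + p.[- t]) / 2) 0 /\
  ceval Q2 (line t) = Complex 0 ((p.[t] - p.[- t]) / 2).
Proof.
elim/poly_ind: p => [|p a [Q1 [Q2 ih]]].
  by exists 0, 0 => t; rewrite /ceval !rmorph0 !horner0 subrr addr0 mul0r.
exists ((- Q2) * ('X - (2^-1)%:P) + a%:P), (Q1 * ('X - (2^-1)%:P) + 0%:P) => t.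
have [h1 h2] := ih t; rewrite !ceval_lin h1 /ceval rmorphN hornerN -/(ceval _ _) h2.
have -> : line t - toC 2^-1 = Complex 0 t.
  by apply: complex_eq; rewrite ?ReD ?ImD ?ReN ?ImN /= ?subrr ?subr0.
rewrite !hornerMXaddC; split; apply: complex_eq; rewrite ?ReD ?ImD ?ReM ?ImM ?ReN ?ImN /=; by field.
Qed.

(** Newton's basis: removing the multiple of prod_(j < n) (X - r_j) that carries
    the coefficient of degree n lowers the size. *)
Lemma newton_expansion (r : nat -> R) n Q : (size Q <= n)%N ->
  exists c : nat -> R, forall s,
    ceval Q s = \sum_(k < n) toC (c k) * \prod_(j < k) (s - toC (r j)).
Proof.
elim: n Q => [|n ih] Q.
  by rewrite leqn0 size_poly_eq0 => /eqP ->; exists (fun=> 0) => s; rewrite big_ord0 /ceval rmorph0 horner0.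
move=> sQ; pose P : {poly R} := \prod_(0 <= j < n) ('X - (r j)%:P).
have sP : size P = n.+1.
  by rewrite /P size_prod_XsubC size_iota subn0.
have lP : P`_n = 1.
  have : P \is monic by exact: monic_prod_XsubC.
  by rewrite monicE lead_coefE sP => /eqP.
have sQ' : (size (Q - Q`_n *: P)%R <= n)%N.
  apply/leq_sizeP => i; rewrite leq_eqVlt => /orP[/eqP<-|ni].
    by rewrite coefB coefZ lP mulr1 subrr.
  by rewrite coefB coefZ (nth_default 0 (leq_trans sQ ni)) (@nth_default _ 0 P i) ?sP// mulr0 subrr.
have [c hc] := ih _ sQ'; exists (fun k => if (k < n)%N then c k else Q`_n) => s.
rewrite big_ord_recr/= ltnn -{1}(subrK (Q`_n *: P) Q).
rewrite /ceval rmorphD hornerD; congr (_ + _).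
  by rewrite -/(ceval _ _) hc; apply: eq_bigr => k _; rewrite ltn_ord.
rewrite /= map_polyZ hornerZ; congr (_ * _).
rewrite /P big_mkord rmorph_prod horner_prod; apply: eq_bigr => j _.
by rewrite rmorphB /= map_polyX map_polyC/= !hornerE.
Qed.

End PolynomialsOnTheLine.

(** * Approximate inversion on the critical line *)

Section Symmetrization.
Context {R : realType}.
Local Notation mu := (@lebesgue_measure R).
Implicit Types (f : R -> R) (p : {poly R}) (t c : R).

Lemma wnorm_reflect c f : measurable_fun setT f -> wnorm c (fun t => f (- t)) = wnorm c f.
Proof.
move=> mf; rewrite /wnorm [RHS]ge0_integralN; first last.
- by move=> t; rewrite lee_fin mulr_ge0 ?sqr_ge0 ?damp_ge0.
- by apply/measurable_EFinP; exact: measurable_sqr_damp.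
- by apply: eq_integral => t _; rewrite /damp normrN.
Qed.

(** The part of p of the same parity as f is the mean of p and of its reflection,
    which approximate f equally well. *)
Lemma wnorm_symmetrize c f p (sgn : R) : measurable_fun setT f -> `|sgn| = 1 ->
  (forall t, f (- t) = sgn * f t) ->
  (wnorm c (fun t => f t - (p.[t] + sgn * p.[- t]) / 2)%R <=
   4%:E * wnorm c (fun t => f t - p.[t])%R)%E.
Proof.
move=> mf s1 fs; set d := fun t => _ - p.[t].
have md : measurable_fun setT d by apply: measurable_funB => //; exact: measurable_horner.
have md' : measurable_fun setT (fun t => d (- t)) by apply: measurableT_comp.
have ss : sgn * sgn = 1 by rewrite -expr2 -real_normK ?num_real// s1 expr1n.
rewrite [X in wnorm c X](_ : _ = fun t => 2^-1 * d t + (2^-1 * sgn) * d (- t)); last first.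
  apply/funext => t; rewrite /d fs.
  rewrite (_ : 2^-1 * sgn * _ = 2^-1 * (sgn * sgn) * f t - 2^-1 * sgn * p.[- t]); last by ring.
  by rewrite ss; field.
have mc (a : R) : measurable_fun [set: R] (fun _ : R => a) by exact: measurable_cst.
apply: le_trans (wnormD c _ _) _; [exact: measurable_funM|exact: measurable_funM|].
have half1 : `|2^-1 : R| <= 1 by rewrite ger0_norm ?invf_le1 ?ler1n.
have b1 (_ : R) : `|2^-1 : R| <= 1 by [].
have b2 (_ : R) : `|2^-1 * sgn| <= 1 by rewrite normrM s1 mulr1.
have h1 := wnormM_le c (mc 2^-1) md b1; have h2 := wnormM_le c (mc (2^-1 * sgn)) md' b2.
rewrite wnorm_reflect// expr1n !mul1e in h2; rewrite expr1n mul1e in h1.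
rewrite (_ : 4%:E = 2%:E + 2%:E)%E; last by rewrite -EFinD; congr EFin; ring.
by rewrite ge0_muleDl ?lee_fin// leeD// lee_pmul2l.
Qed.

End Symmetrization.

Section RegularizedInverse.
Context {R : realType}.
Local Notation mu := (@lebesgue_measure R).
Implicit Types (p q Q : {poly R}) (t : R).
Variables (F : R -> R[i]) (K delta : R).
Hypothesis delta0 : 0 < delta.
Hypothesis cRe : continuous (fun t => Re (F t)).
Hypothesis cIm : continuous (fun t => Im (F t)).
Hypothesis F_conj : forall t, F (- t) = Complex (Re (F t)) (- Im (F t)).
Hypothesis F_decay : forall t, normc (F t) <= K * expR (- (delta * `|t|)).
Hypothesis F_neq0 : {ae mu, forall t, F t != 0}.

Let N t := Re (F t) ^+ 2 + Im (F t) ^+ 2.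
Let m t := (4^-1 + t ^+ 2)^-1.

Let N0 t : 0 <= N t. Proof. by rewrite addr_ge0 ?sqr_ge0. Qed.
Let den0 t : 0 < 4^-1 + t ^+ 2.
Proof. by rewrite ltr_pwDl ?invr_gt0 ?sqr_ge0. Qed.
Let m0 t : 0 < m t. Proof. by rewrite invr_gt0. Qed.
Let K0 : 0 <= K.
Proof. by have := le_trans (normc_ge0 _) (F_decay 0); rewrite normr0 mulr0 oppr0 expR0 mulr1. Qed.
Let N_damp t : N t <= K ^+ 2 * damp (2 * delta) t.
Proof.
rewrite /N -sqr_normc /damp (_ : - (2 * delta * `|t|) = - (delta * `|t|) + - (delta * `|t|)); last by ring.
by rewrite expRD -expr2 -exprMn lerXn2r ?nnegrE ?normc_ge0 ?mulr_ge0 ?expR_ge0.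
Qed.
Let normc_F t : normc (F t) <= K.
Proof.
rewrite (le_trans (F_decay t))// ler_piMr// -[leRHS]expR0 ler_expR oppr_le0.
by rewrite mulr_ge0// ltW.
Qed.

Let cN : continuous N.
Proof.
move=> t; apply: cvgD.
  apply: (@cvg_comp _ _ _ (fun t => Re (F t)) (fun x => x ^+ 2) _ (nbhs (Re (F t)))); first exact: cRe.
  exact: exprn_continuous.
apply: (@cvg_comp _ _ _ (fun t => Im (F t)) (fun x => x ^+ 2) _ (nbhs (Im (F t)))); first exact: cIm.
exact: exprn_continuous.
Qed.

Let cm : continuous m.
Proof.
move=> t; apply: cvgV; first by rewrite gt_eqF.
by apply: cvgD; [exact: cvg_cst|exact: exprn_continuous].
Qed.

Lemma inv_line t : (line t)^-1 = Complex (2^-1 * m t) (- (t * m t)).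
Proof.
have d : 4^-1 + t ^+ 2 != 0 by rewrite gt_eqF.
have E : line t * Complex (2^-1 * m t) (- (t * m t)) = 1.
  have d' : 1 + t ^+ 2 * 4 != 0 by rewrite gt_eqF// ltr_wpDr// mulr_ge0 ?sqr_ge0.
  apply: complex_eq; rewrite ?ReM ?ImM /= /m; last ring.
  by field.
have l0 : line t != 0 by apply: contra_eq_neq E => ->; rewrite mul0r eq_sym oner_neq0.
by rewrite -[LHS]mulr1 -E mulKf.
Qed.

Lemma L1_inv_line : L1 m.
Proof.
have [ci _] := @cauchy_integral R.
have a0 : (0 : R) < 2 by [].
have [h _] := Int_affine 0 a0 ci.
apply: eq_L1 (L1Z 2 h) => t; rewrite /cauchy /m addr0.
by field; rewrite gt_eqF//=; have := sqr_ge0 t; nra.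
Qed.

(** For eta > 0, U eta + i V eta = conj F / (s (|F|^2 + eta)) is a bounded and
    continuous substitute for 1/(s F), the latter being unbounded where F is small. *)
Let w eta t := (N t + eta)^-1.
Let U eta t := m t * w eta t * (2^-1 * Re (F t) - t * Im (F t)).
Let V eta t := - (m t * w eta t * (2^-1 * Im (F t) + t * Re (F t))).

Let w_gt0 eta t : 0 < eta -> 0 < w eta t.
Proof. by move=> e0; rewrite invr_gt0 ltr_wpDl. Qed.

(** With T = U eta + i V eta and P = a + i b,
    1/s - P F = (1/s) (1 - |F|^2 / (|F|^2 + eta)) + (T - P) F. *)
Lemma regularized_error eta (a b : R) t : 0 < eta ->
  normc ((line t)^-1 - Complex a b * F t) ^+ 2 <=
  2 * (m t * (1 - N t * w eta t) ^+ 2) +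
  2 * K ^+ 2 * ((U eta t - a) ^+ 2 * damp (2 * delta) t + (V eta t - b) ^+ 2 * damp (2 * delta) t).
Proof.
move=> e0; have h1 : Complex (U eta t) (V eta t) * F t = toC (N t * w eta t) * (line t)^-1.
  by rewrite inv_line; apply: complex_eq; rewrite (Re_scale, Im_scale) (ReM, ImM) /= /U /V /N; ring.
have -> : (line t)^-1 - Complex a b * F t =
   toC (1 - N t * w eta t) * (line t)^-1 + Complex (U eta t - a) (V eta t - b) * F t.
  have -> : Complex (U eta t - a) (V eta t - b) = Complex (U eta t) (V eta t) - Complex a b by [].
  rewrite rmorphB rmorph1 mulrBl mul1r [in RHS]mulrBl h1; ring.
set x := toC _ * _; set y := _ * F t.
have h : normc (x + y) ^+ 2 <= 2 * normc x ^+ 2 + 2 * normc y ^+ 2.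
  have := le_normcD x y; have := normc_ge0 (x + y).
  have := normc_ge0 x; have := normc_ge0 y; have := sqr_ge0 (normc x - normc y); nra.
apply: le_trans h _; apply: lerD.
  rewrite ler_wpM2l// /x normcM exprMn normcR real_normK ?num_real// mulrC ler_wpM2r ?sqr_ge0//.
  rewrite inv_line sqr_normc /=.
  (* m t is the squared modulus of the inverse of line t. *)
  rewrite (_ : _ + _ = m t * (m t * (4^-1 + t ^+ 2))); last by field.
  by rewrite /m mulVf ?gt_eqF// mulr1.
rewrite -mulrA ler_wpM2l// /y normcM exprMn !sqr_normc /= -mulrDl mulrCA.
by rewrite ler_wpM2l ?addr_ge0 ?sqr_ge0//; exact: N_damp.
Qed.

Let cw eta : 0 < eta -> continuous (w eta).
Proof.
move=> e0 t; apply: cvgV; first by rewrite gt_eqF// ltr_wpDl.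
by apply: cvgD; [exact: cN|exact: cvg_cst].
Qed.

Let w_le1 eta t : 0 < eta -> 0 <= N t * w eta t <= 1.
Proof.
move=> e0; rewrite mulr_ge0 ?(ltW (w_gt0 _ _))//= ler_pdivrMr ?ltr_wpDl// mul1r.
by rewrite lerDl ltW.
Qed.

Let merr eta : 0 < eta -> measurable_fun setT (fun t => m t * (1 - N t * w eta t) ^+ 2).
Proof.
move=> e0; apply: measurable_funM; first exact: continuous_measurable_fun.
apply: measurable_funX; apply: measurable_funB => //.
by apply: measurable_funM; apply: continuous_measurable_fun => //; exact: cw.
Qed.

Let err_le eta t : 0 < eta -> `|m t * (1 - N t * w eta t) ^+ 2| <= m t.
Proof.
move=> e0; have /andP[h1 h2] := w_le1 t e0.
have mt := ltW (m0 t); rewrite ger0_norm; last by rewrite mulr_ge0 ?sqr_ge0.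
by apply: ler_piMr => //; rewrite exprn_ile1 ?subr_ge0// lerBlDr lerDl.
Qed.

(** The integrand is at most 1/|s|^2 and tends to 0 where F is nonzero. *)
Lemma regularized_cvg : (fun n => Int (fun t => m t * (1 - N t * w n.+1%:R^-1 t) ^+ 2)) @ \oo --> (0 : R).
Proof.
rewrite -(Int0 (R := R)).
apply: (dominated_cvg _ _ L1_inv_line (_ : {ae mu, forall t, _ ^~ t @ \oo --> (0 : R)}) _).2 => //.
- by move=> n; exact: merr.
- move: F_neq0; apply: negligibleS => t /=; apply: contra_not => Ft.
  have Nt : N t != 0 by rewrite /N -sqr_normc expf_neq0// gt_eqF// normc_gt0.
  rewrite -(mulr0 (m t)); apply: cvgM; first exact: cvg_cst.
  rewrite [X in _ --> X](_ : 0 = (1 - N t * (N t + 0)^-1) ^+ 2); last first.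
    by rewrite addr0 mulfV// subrr expr0n.
  have c2 : (fun n => 1 - N t * w n.+1%:R^-1 t) @ \oo --> 1 - N t * (N t + 0)^-1.
    apply: cvgB; first exact: cvg_cst.
    apply: cvgM; first exact: cvg_cst.
    apply: cvgV; first by rewrite addr0.
    by apply: cvgD; [exact: cvg_cst|exact: cvg_harmonic].
  by apply: (@cvg_comp _ _ _ _ (fun x => x ^+ 2) _ _ _ c2); exact: exprn_continuous.
- by move=> n t; exact: err_le.
Qed.

Let N_even t : N (- t) = N t. Proof. by rewrite /N F_conj /= sqrrN. Qed.
Let m_even t : m (- t) = m t. Proof. by rewrite /m sqrrN. Qed.

Let U_even eta t : U eta (- t) = 1 * U eta t.
Proof. by rewrite /U /w N_even m_even F_conj /=; ring. Qed.

Let V_odd eta t : V eta (- t) = - 1 * V eta t.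
Proof. by rewrite /V /w N_even m_even F_conj /=; ring. Qed.

Let cU eta : 0 < eta -> continuous (U eta).
Proof.
move=> e0 t; apply: cvgM; first by apply: cvgM; [exact: cm|exact: cw].
apply: cvgB; first by apply: cvgM; [exact: cvg_cst|exact: cRe].
by apply: cvgM; [exact: cvg_id|exact: cIm].
Qed.

Let cV eta : 0 < eta -> continuous (V eta).
Proof.
move=> e0 t; apply: cvgN; apply: cvgM; first by apply: cvgM; [exact: cm|exact: cw].
apply: cvgD; first by apply: cvgM; [exact: cvg_cst|exact: cIm].
by apply: cvgM; [exact: cvg_id|exact: cRe].
Qed.

(** Since t^2 + 1/4 >= |t|, m is at most 4 and |t| m at most 1. *)
Let mw_bound eta t (a b : R) : 0 < eta -> `|a| <= K -> `|b| <= K ->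
  `|m t * w eta t * (2^-1 * a + t * b)| <= 3 * K / eta.
Proof.
move=> e0 aK bK; rewrite -mulrA [_ / eta]mulrC mulrCA normrM ler_pM//.
  rewrite gtr0_norm ?w_gt0// lef_pV2 ?posrE ?ltr_wpDl//.
  by rewrite lerDr.
rewrite mulrDr (le_trans (ler_normD _ _))// !mulrA !normrM.
have -> : 3 * K = 2 * K + 1 * K by ring.
have D := den0 t; have m_0 := m0 t.
apply: lerD; apply: ler_pM => //.
  by rewrite !gtr0_norm// /m mulrC -invfM invf_ple ?posrE ?mulr_gt0//; have := sqr_ge0 t; lra.
rewrite -normrM; rewrite -(@ler_pXn2r _ 2) ?nnegrE// expr1n real_normK ?num_real//.
rewrite exprMn /m exprVn mulrC ler_pdivrMr ?exprn_gt0// mul1r.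
by have := sqr_ge0 t; have := sqr_ge0 (t ^+ 2 - 4^-1); nra.
Qed.

(** First eta is chosen to make the regularization error small, then polynomials p
    and q close to U eta and V eta; their symmetrized parts are the real and
    imaginary parts of a real polynomial in s. *)
Lemma inverse_approx (e : R) : 0 < e -> exists Q : {poly R},
  (\int[mu]_t (normc ((line t)^-1 - ceval Q (line t) * F t) ^+ 2)%:E <= e%:E)%E.
Proof.
move=> e0.
have [n hn] : exists n, 2 * Int (fun t => m t * (1 - N t * w n.+1%:R^-1 t) ^+ 2) <= e / 2.
  have e4 : 0 < e / 4 by rewrite divr_gt0.
  have /cvgrPdist_le/(_ _ e4)[n _ /(_ n (leqnn n))] := regularized_cvg.
  rewrite sub0r normrN => h; exists n; move: (le_trans (ler_norm _) h); lra.
set eta : R := n.+1%:R^-1 in hn; have eta0 : 0 < eta by rewrite invr_gt0.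
pose c := 2 * delta; have c0 : 0 < c by rewrite mulr_gt0.
(* 2 K^2 times the two errors, each at most 4 e1, amounts to at most e/2. *)
pose e1 := e / (32 * (K ^+ 2 + 1)).
have K1 : 0 < K ^+ 2 + 1 by rewrite ltr_wpDl ?sqr_ge0.
have e10 : 0 < e1 by rewrite divr_gt0// mulr_gt0.
have ReK t : `|Re (F t)| <= K := le_trans (norm_Re_le _) (normc_F t).
have ImK t : `|Im (F t)| <= K := le_trans (norm_Im_le _) (normc_F t).
have UM t : `|U eta t| <= 3 * K / eta.
  by rewrite /U -mulrN mw_bound// normrN.
have VM t : `|V eta t| <= 3 * K / eta by rewrite normrN mw_bound.
have aprx f : continuous f -> (forall t, `|f t| <= 3 * K / eta) -> approx c f.
  move=> cf fM; have [mf _ h] := multiplier_continuous c0 cf fM.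
  by have := h 1; under eq_fun do rewrite hornerE mulr1.
have [mU /(_ _ e10)[p hp]] := aprx _ (cU eta0) UM.
have [mV /(_ _ e10)[q hq]] := aprx _ (cV eta0) VM.
have hp' := wnorm_symmetrize c p mU (normr1 _) (U_even eta).
have hq' := wnorm_symmetrize c q mV (normrN1 _) (V_odd eta).
have [Q1 [Q1' hQ1]] := ceval_parity p; have [Q2' [Q2 hQ2]] := ceval_parity q.
pose a t := (p.[t] + 1 * p.[- t]) / 2; pose b t := (q.[t] + - 1 * q.[- t]) / 2.
have QE t : ceval (Q1 + Q2) (line t) = Complex (a t) (b t).
  rewrite /ceval rmorphD hornerD -!/(ceval _ _) (hQ1 t).1 (hQ2 t).2.
  by apply: complex_eq; rewrite (ReD, ImD) /= /a /b; field.
have mp_ (p0 : {poly R}) (sg : R) : measurable_fun setT (fun t => (p0.[t] + sg * p0.[- t]) / 2).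
  apply: measurable_funM => //; apply: measurable_funD; first exact: measurable_horner.
  by apply: measurable_funM => //; apply: measurableT_comp => //; exact: measurable_horner.
have mRe : measurable_fun setT (fun t => Re (F t)) by exact: continuous_measurable_fun.
have mIm : measurable_fun setT (fun t => Im (F t)) by exact: continuous_measurable_fun.
have mm : measurable_fun setT m by exact: continuous_measurable_fun.
have mDU : measurable_fun setT (fun t => (U eta t - a t) ^+ 2 * damp c t).
  by apply: measurable_sqr_damp; apply: measurable_funB => //; exact: mp_.
have mDV : measurable_fun setT (fun t => (V eta t - b t) ^+ 2 * damp c t).
  by apply: measurable_sqr_damp; apply: measurable_funB => //; exact: mp_.
have mE := merr eta0.
exists (Q1 + Q2).
pose D t := 2 * (m t * (1 - N t * w eta t) ^+ 2) +
  2 * K ^+ 2 * ((U eta t - a t) ^+ 2 * damp c t + (V eta t - b t) ^+ 2 * damp c t).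
have D1 t : 0 <= m t * (1 - N t * w eta t) ^+ 2 by rewrite mulr_ge0 ?sqr_ge0// ltW.
have D2 t : 0 <= (U eta t - a t) ^+ 2 * damp c t by rewrite mulr_ge0 ?sqr_ge0 ?damp_ge0.
have D3 t : 0 <= (V eta t - b t) ^+ 2 * damp c t by rewrite mulr_ge0 ?sqr_ge0 ?damp_ge0.
apply: (@le_trans _ _ (\int[mu]_t (D t)%:E)%E).
  apply: ge0_le_integral => //.
  - by move=> t _; rewrite lee_fin sqr_ge0.
  - apply/measurable_EFinP.
    rewrite [X in measurable_fun _ X](_ : _ = fun t =>
      (2^-1 * m t - (a t * Re (F t) - b t * Im (F t))) ^+ 2 +
      (- (t * m t) - (a t * Im (F t) + b t * Re (F t))) ^+ 2); last first.
      by apply/funext => t; rewrite QE inv_line sqr_normc !(ReD, ImD, ReN, ImN) ReM ImM.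
    have [ma mb] := (mp_ p 1, mp_ q (- 1)).
    apply: measurable_funD; apply: measurable_funX; apply: measurable_funB.
    + exact: measurable_funM.
    + by apply: measurable_funB; exact: measurable_funM.
    + by apply: measurableT_comp => //; exact: measurable_funM.
    + by apply: measurable_funD; exact: measurable_funM.
  - apply/measurable_EFinP; apply: measurable_funD; first exact: measurable_funM.
    by apply: measurable_funM => //; exact: measurable_funD.
  - by move=> t _; rewrite lee_fin QE; exact: regularized_error.
have L1E : L1 (fun t => m t * (1 - N t * w eta t) ^+ 2).
  by apply: L1_le L1_inv_line => // t; exact: err_le.
have -> : (\int[mu]_t (D t)%:E =
    2%:E * (Int (fun t => m t * (1 - N t * w eta t) ^+ 2)%R)%:E + (2 * K ^+ 2)%:E *
    (wnorm c (fun t => U eta t - a t)%R + wnorm c (fun t => V eta t - b t)%R))%E.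
  have k0 : 0 <= 2 * K ^+ 2 by rewrite mulr_ge0 ?sqr_ge0.
  rewrite EFin_Int// /wnorm -ge0_integralD//; last 4 first.
  - by move=> t _; rewrite lee_fin.
  - exact/measurable_EFinP.
  - by move=> t _; rewrite lee_fin.
  - exact/measurable_EFinP.
  rewrite -!ge0_integralZl_EFin//; last 4 first.
  - by move=> t _; rewrite -EFinD lee_fin addr_ge0.
  - by apply: emeasurable_funD; exact/measurable_EFinP.
  - by move=> t _; rewrite lee_fin.
  - exact/measurable_EFinP.
  rewrite -ge0_integralD//=.
  - by move=> t _; rewrite -EFinM lee_fin mulr_ge0.
  - by apply: emeasurable_funM => //; exact/measurable_EFinP.
  - by move=> t _; rewrite -EFinD -EFinM lee_fin mulr_ge0// addr_ge0.
  - by apply: emeasurable_funM => //; apply: emeasurable_funD; exact/measurable_EFinP.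
have h1 : (wnorm c (fun t => U eta t - a t)%R + wnorm c (fun t => V eta t - b t)%R <= (8 * e1)%:E)%E.
  rewrite (_ : 8 * e1 = 4 * e1 + 4 * e1); last by ring.
  rewrite EFinD !EFinM leeD//.
    by apply: (le_trans hp'); rewrite lee_pmul2l.
  by apply: (le_trans hq'); rewrite lee_pmul2l.
apply: (@le_trans _ _ ((e / 2)%:E + (2 * K ^+ 2)%:E * (8 * e1)%:E)%E).
  by rewrite leeD// ?lee_wpmul2l ?lee_fin ?mulr_ge0 ?sqr_ge0// -EFinM lee_fin.
rewrite -EFinM -EFinD lee_fin.
have : 2 * K ^+ 2 * (8 * e1) <= e / 2.
  rewrite (_ : _ * (8 * e1) = e / 2 * (K ^+ 2 / (K ^+ 2 + 1))); last by rewrite /e1; field; rewrite gt_eqF.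
  by rewrite ler_piMr ?divr_ge0 ?(ltW e0)// ler_pdivrMr// mul1r lerDl.
lra.
Qed.

End RegularizedInverse.

(** * Mellin transforms of the g_k^x and approximation of the indicator *)

Section Optimal.
Context {R : realType}.

(** It suffices to take x n within 1/(n + 1) of the infimum of E n. *)
Lemma cvg_near_optimal (T : Type) (x0 : T) (E : nat -> T -> \bar R) :
  (forall n x, 0 <= E n x)%E ->
  (forall e : R, 0 < e -> exists N, forall n, (N <= n)%N -> exists x, (E n x <= e%:E)%E) ->
  exists x : nat -> T, (fun n => E n (x n)) @ \oo --> 0%E.
Proof.
move=> E0 Esmall; pose I n := ereal_inf (range (E n)).
have I0 n : (0 <= I n)%E by apply: le_ereal_inf_tmp => _ [x _ <-].
have ex n : exists x, (I n < +oo)%E -> (E n x < I n + (n.+1%:R^-1)%:E)%E.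
  have [Ioo|/negP Ioo] := boolP (I n < +oo)%E; last by exists x0.
  have Ifin : I n \is a fin_num by rewrite ge0_fin_numE.
  have n0 : 0 < n.+1%:R^-1 :> R by rewrite invr_gt0.
  by have [_ [x _ <-] hx] := lb_ereal_inf_adherent n0 Ifin; exists x.
have [x hx] := choice ex; exists x.
have small (e : R) : 0 < e -> exists N, forall n, (N <= n)%N -> (E n (x n) <= e%:E)%E.
  move=> e0; have e2 : 0 < e / 2 by rewrite divr_gt0.
  have [N hN] := Esmall _ e2.
  have /cvgrPdist_le/(_ _ e2)[M _ hM] := @cvg_harmonic R.
  exists (maxn N M) => n; rewrite geq_max => /andP[Nn Mn].
  have [y hy] := hN n Nn.
  have Ie : (I n <= (e / 2)%:E)%E by apply: le_trans hy; apply: ereal_inf_lbound; exists y.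
  apply/ltW/(lt_le_trans (hx n (le_lt_trans Ie (ltry _)))).
  have := hM n Mn; rewrite sub0r normrN /harmonic ger0_norm ?invr_ge0// => h.
  have -> : e%:E = ((e / 2)%:E + (e / 2)%:E)%E by rewrite -EFinD -splitr.
  by apply: leeD => //; rewrite lee_fin.
apply/fine_cvgP; split.
  have [N hN] := small 1 ltr01; exists N => // n /= Nn.
  by rewrite ge0_fin_numE// (le_lt_trans (hN n Nn)) ?ltry.
apply/cvgrPdist_le => e e0; have [N hN] := small e e0; exists N => // n /= Nn.
have fin : E n (x n) \is a fin_num by rewrite ge0_fin_numE// (le_lt_trans (hN n Nn)) ?ltry.
rewrite sub0r normrN ger0_norm; last exact: fine_ge0.
by rewrite -lee_fin fineK// hN.
Qed.

End Optimal.

Section CriticalLine.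
Context {R : realType}.
Local Notation mu := (@lebesgue_measure R).
Implicit Types (h : R -> R) (s : R[i]) (t : R).

Lemma laplace_line_continuous h : lap_conv h 2^-1 ->
  continuous (fun t => Re (laplace h (line t))) /\ continuous (fun t => Im (laplace h (line t))).
Proof.
move=> hi; have [c1 c2] := fcos_fsin_continuous hi.
have E t : laplace h (line t) = Complex (fcos (fun u => h u * expR (2^-1 * u)) t)
    (fsin (fun u => h u * expR (2^-1 * u)) t).
  by rewrite /line laplace_shift laplace_imag.
by split; under eq_fun do rewrite E.
Qed.

Lemma laplace_line_conj h t : lap_conv h 2^-1 ->
  laplace h (line (- t)) = Complex (Re (laplace h (line t))) (- Im (laplace h (line t))).
Proof.
move=> hi; rewrite /line !(laplace_shift _ 2^-1) !laplace_imag.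
have fcosN (phi : R -> R) : fcos phi (- t) = fcos phi t.
  by apply: eq_Int => u; rewrite mulNr cosN.
have fsinN (phi : R -> R) : L1 phi -> fsin phi (- t) = - fsin phi t.
  move=> phi1; rewrite /fsin -IntN; last exact: L1_fsin.
  by apply: eq_Int => u; rewrite mulNr sinN mulrN.
by rewrite fcosN fsinN.
Qed.

(** The bound is uniform since |exp (i t u)| = 1. *)
Lemma laplace_line_bound h : lap_conv h 2^-1 ->
  exists2 K : R, 0 <= K & forall t, normc (laplace h (line t)) <= K.
Proof.
move=> hi; exists (Int (fun u => `|h u * expR (2^-1 * u)|) *+ 2).
  by rewrite mulrn_wge0// Int_ge0.
move=> t; apply: normc_CInt_le; [exact: lap_conv_CL1|exact: L1_norm|].
by move=> u; rewrite normc_lap_fun.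
Qed.

Lemma laplace_lincomb n (a : nat -> R) (h : nat -> R -> R) s :
  (forall k, lap_conv (h k) (Re s)) ->
  lap_conv (fun u => \sum_(k < n) a k * h k u) (Re s) /\
  laplace (fun u => \sum_(k < n) a k * h k u) s = \sum_(k < n) toC (a k) * laplace (h k) s.
Proof.
move=> hi; elim: n => [|n [ih1 ih2]].
  have E : (fun u : R => \sum_(k < 0) a k * h k u) = fun u => 0 * h 0%N u.
    by apply/funext => u; rewrite big_ord0 mul0r.
  by rewrite E; split; [exact: lap_convZ|rewrite laplaceZ// rmorph0 mul0r big_ord0].
have E : (fun u : R => \sum_(k < n.+1) a k * h k u) =
    fun u => \sum_(k < n) a k * h k u + a n * h n u.
  by apply/funext => u; rewrite big_ord_recr.
have hn := lap_convZ (a n) (hi n).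
rewrite E; split; first exact: lap_convD.
by rewrite laplaceD// laplaceZ// ih2 big_ord_recr.
Qed.

Lemma punctured_nonvanishing (F : R[i] -> R[i]) z : ~ has_cluster_of_zeros F z ->
  exists2 e : R, 0 < e & forall w, w != z -> normc (w - z) < e -> F w != 0.
Proof.
move=> acc; apply: contrapT => none; apply: acc => e e0.
apply: contrapT => nw; apply: none; exists e => // w wz we.
by apply/eqP => Fw; apply: nw; exists w.
Qed.

Lemma lineB t t' : normc (line t - line t') = `|t - t'|.
Proof.
by rewrite -[line t - _]/(Complex (2^-1 - 2^-1) (t - t')) subrr /normc expr0n/= add0r sqrtr_sqr.
Qed.

End CriticalLine.

Section Step.
Context {R : realType}.
Implicit Types u : R.

Definition negative_half u : R := \1_`]0, 1[ (expR u).

Lemma negative_halfE u : negative_half u = (u < 0)%R%:R.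
Proof. by rewrite /negative_half indicE mem_setE in_itv /= expR_gt0 expR_lt1. Qed.

Lemma measurable_negative_half : measurable_fun setT negative_half.
Proof. by apply: measurableT_comp; [exact: measurable_indic|exact: measurable_expR]. Qed.

Lemma negative_half_hlf u : u != 0 -> negative_half u = hlf u.
Proof. by move=> u0; rewrite negative_halfE /hlf indic_Nyc lt_neqAle u0. Qed.

Lemma lap_conv_negative_half (sigma : R) : 0 < sigma -> lap_conv negative_half sigma.
Proof.
move=> s0; apply: lap_conv_le (lap_conv_hlf s0); first exact: measurable_negative_half.
move=> u; rewrite negative_halfE ger0_norm// /hlf indic_Nyc ler_nat.
by case: (ltP u 0) => // /ltW ->.
Qed.

(** It differs from hlf at 0 only. *)
Lemma laplace_negative_half (s : R[i]) : 0 < Re s -> laplace negative_half s = s^-1.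
Proof.
move=> s0; rewrite -laplace_hlf//.
have [m1 m2] := measurable_lap_fun s measurable_negative_half.
have [m3 m4] := measurable_lap_fun s measurable_hlf.
by rewrite /laplace /CInt; congr Complex; apply: (@eq_Int_except _ 0) => // u u0;
  rewrite /lap_fun negative_half_hlf.
Qed.

Lemma negative_half_continuous u : u != 0 -> {for u, continuous negative_half}.
Proof.
move=> u0; have [un|up|/eqP] := ltgtP u 0; last by rewrite (negbTE u0).
  apply: (@near_cst_continuous R R 1); near=> v.
  by rewrite negative_halfE; have -> // : v < 0; near: v; exact: lt_nbhsl.
apply: (@near_cst_continuous R R 0); near=> v.
rewrite negative_halfE ltNge ltW//; near: v; exact: lt_nbhsr.
Unshelve. all: by end_near. Qed.

End Step.

Section CriticalTransform.
Context {R : realType}.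
Local Notation mu := (@lebesgue_measure R).
Variables (r : nat -> R) (g0 : R -> R) (alpha : R).
Hypothesis g0_smooth : smooth_pos g0.
Hypothesis alpha0 : 0 < alpha.
Hypothesis g0_at0 : forall k : nat,
  (fun x : R => x `^ (k%:R - alpha) * derive1n k g0 x) @ 0^'+ --> (0 : R).
Hypothesis g0_atoo : forall k : nat,
  (fun x : R => x `^ (k%:R + 1 + alpha) * derive1n k g0 x) @ +oo --> (0 : R).
Implicit Types (s : R[i]) (t u : R).

Let g k := gseq r g0 k.
Let G k := glog g0 r k.
Let X k := fracconv (G k).
Let tG k : tame alpha (G k) := tame_glog g0_smooth alpha0 g0_at0 g0_atoo r k.

Let mg k : measurable_fun (`]0, +oo[ : set R) (g k).
Proof.
apply: open_continuous_measurable_fun; first exact: interval_open.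
move=> x; rewrite inE /= in_itv /= andbT => x0.
exact: (gseq_continuous g0_smooth x0).
Qed.

Let cX k : continuous (X k). Proof. exact: fracconv_continuous (tG k). Qed.

Let mcross k : measurable_fun (`]0, +oo[ : set R) (cross (g k)).
Proof.
have h : measurable_fun setT (X k) by apply: continuous_measurable_fun; exact: cX.
by apply: measurable_cross; [exact: mg|exact: h].
Qed.

Let cross_log k : (fun u => cross (g k) (expR u)) = X k.
Proof. by apply/funext => u; rewrite cross_expR. Qed.

Let strip s : 0 < Re s < 1 -> - alpha < Re s < 1 + alpha.
Proof.
move=> /andP[s0 s1]; rewrite (lt_trans _ s0) ?oppr_lt0//=.
by rewrite (lt_le_trans s1)// lerDl ltW.
Qed.

Let lapG k s : 0 < Re s < 1 -> lap_conv (G k) (Re s).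
Proof.
by move=> s01; apply: (lap_conv_tame (tG k)); exact: strip.
Qed.

Let laplaceX k s : 0 < Re s < 1 ->
  laplace (X k) s = \prod_(j < k) (s - toC (r j)) * (laplace fracker s * laplace (G 0) s).
Proof.
move=> s01; have [_ -> _] := laplace_fracconv s01 (lapG k s01).
rewrite [laplace (G k) s](laplace_glog g0_smooth alpha0 g0_at0 g0_atoo); last first.
  exact: strip.
by rewrite mulrCA.
Qed.

(** The convolution theorem together with [laplace_glog] and
    [laplace_fracker_zeta]. *)
Lemma mellin_cross k s : 0 < Re s < 1 ->
  mellin_defined (cross (g k)) s /\
  mellin (cross (g k)) s =
    - ((\prod_(j < k) (s - toC (r j))) * (zeta s / s) * mellin g0 s).
Proof.
move=> s01; split.
  apply: mellin_defined_log; first exact: mcross.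
  by rewrite cross_log; have [] := laplace_fracconv s01 (lapG k s01).
rewrite mellin_laplace// cross_log laplaceX// laplace_fracker_zeta//.
rewrite (mellin_laplace s (mg 0)) mulNr mulrN mulrA //.
Qed.

Let half01 t : 0 < Re (line t) < 1.
Proof. by rewrite /=; apply/andP; split; lra. Qed.

(** The Mellin transform of g_0^x on the critical line. *)
Let F t := laplace fracker (line t) * laplace (G 0) (line t).

Let lfr : lap_conv fracker (2^-1 : R).
Proof. exact: (lap_conv_fracker (half01 0)). Qed.
Let lG0 : lap_conv (G 0) 2^-1.
Proof. exact: (lapG 0 (half01 0)). Qed.

Let cF : continuous (fun t => Re (F t)) /\ continuous (fun t => Im (F t)).
Proof.
have [c1 c2] := laplace_line_continuous lfr; have [c3 c4] := laplace_line_continuous lG0.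
split; under eq_fun do rewrite (ReM, ImM).
  by move=> t; apply: cvgB; apply: cvgM; [exact: c1|exact: c3|exact: c2|exact: c4].
by move=> t; apply: cvgD; apply: cvgM; [exact: c1|exact: c4|exact: c2|exact: c3].
Qed.

Let F_conj t : F (- t) = Complex (Re (F t)) (- Im (F t)).
Proof.
rewrite /F !laplace_line_conj// ReM ImM.
by apply: complex_eq; [rewrite ReM /=|rewrite ImM /=]; ring.
Qed.

(** Each of the two factors has isolated zeros at the points of the line with
    t != 0; continuity of F makes the set of its zeros measurable. *)
Lemma transform_neq0_ae : (exists x : R, 0 < x /\ g0 x != 0) -> {ae mu, forall t, F t != 0}.
Proof.
move=> [x [x0 gx]].
have Gx : G 0 (ln x) != 0 by rewrite /G /glog /= lnK.
have [c1 c2] := cF.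
have mZ : measurable [set t | F t = 0].
  have -> : [set t | F t = 0] =
      (fun t => Re (F t)) @^-1` [set 0] `&` (fun t => Im (F t)) @^-1` [set 0].
    apply/seteqP; split => t; last by case=> h1 h2; exact: (@complex_eq _ (F t) 0 h1 h2).
    by move=> h; split; [exact: (congr1 (fun z => Re z) (h : F t = 0))|exact: (congr1 (fun z => Im z) (h : F t = 0))].
  apply: measurableI; rewrite -[X in measurable X]setTI.
    exact: (continuous_measurable_fun c1 measurableT (measurable_set1 0)).
  exact: (continuous_measurable_fun c2 measurableT (measurable_set1 0)).
have Z0 : mu [set t | F t = 0] = 0%E.
  apply: isolated_null => // t t0.
  have [e1 e10 h1] := punctured_nonvanishing (laplace_fracker_isolated (half01 t) t0).
  have [e2 e20 h2] := punctured_nonvanishing (@laplace_tame_isolated _ _ _ t _ alpha0 (tG 0) Gx).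
  exists (Num.min e1 e2); first by rewrite lt_min e10.
  move=> w wt; rewrite lt_min => /andP[w1 w2] /= /eqP.
  have lw : line w != line t by apply: contra_neq wt => -[].
  by rewrite mulf_eq0 (negbTE (h1 _ lw _)) ?(negbTE (h2 _ lw _)) ?lineB.
exists [set t | F t = 0]; split=> // t /= /negP; rewrite negbK => /eqP //.
Qed.

(** The substitution x = exp u turns the left integral into that of phi^2, and
    the Laplace transform of h on the critical line is 1/s - Q(s) F(s). *)
Lemma approximation_error n (c : nat -> R) (Q : {poly R}) :
  (forall s, ceval Q s = \sum_(k < n) toC (c k) * \prod_(j < k) (s - toC (r j))) ->
  ((2 * pi)%:E * \int[mu]_(x in `]0%R, +oo[)
     (`| \1_`]0%R, 1%R[ x - \sum_(k < n) c k * cross (g k) x | ^+ 2)%:E <=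
   \int[mu]_t (normc ((line t)^-1 - ceval Q (line t) * F t) ^+ 2)%:E)%E.
Proof.
move=> Qc; pose S u := \sum_(k < n) c k * X k u.
pose h u := negative_half u - S u; pose phi u := h u * expR (2^-1 * u).
have Xconv k : lap_conv (X k) 2^-1.
  by have [] := laplace_fracconv (half01 0) (lapG k (half01 0)).
have [Sconv _] := laplace_lincomb n c (s := line 0) Xconv.
have cS : continuous S.
  rewrite /S; elim: n {Qc S h phi Sconv} => [|n ih] u.
    by under eq_fun do rewrite big_ord0; exact: cvg_cst.
  under eq_fun do rewrite big_ord_recr /=.
  by apply: cvgD; [exact: ih|apply: cvgM; [exact: cvg_cst|exact: cX]].
have half0 : (0 : R) < 2^-1 by [].
have nconv := lap_conv_negative_half half0.
have hE : h = fun u => negative_half u + -1 * S u by apply/funext => u; rewrite mulN1r.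
have hconv : lap_conv h 2^-1 by rewrite hE; apply: lap_convD => //; exact: lap_convZ.
have lE t : laplace h (line t) = (line t)^-1 - ceval Q (line t) * F t.
  rewrite hE laplaceD; [|exact: nconv|exact: lap_convZ].
  rewrite laplaceZ// laplace_negative_half// rmorphN rmorph1 mulN1r; congr (_ - _).
  have [_ ->] := laplace_lincomb n c (s := line t) Xconv.
  rewrite Qc mulr_suml; apply: eq_bigr => k _.
  by rewrite laplaceX// mulrA.
have phib : exists M, forall u, `|phi u| <= M.
  have nb u : `|negative_half u * expR (2^-1 * u)| <= 1.
    rewrite negative_halfE; have [u0|_] := ltP u 0; last by rewrite mul0r normr0.
    rewrite mul1r ger0_norm ?expR_ge0// -[leRHS]expR0 ler_expR.
    by rewrite mulr_ge0_le0// ltW.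
  pose B k := Int (fun u => `|G k u * expR (2^-1 * u)|).
  exists (1 + \sum_(k < n) `|c k| * B k) => u.
  rewrite /phi /h mulrBl (le_trans (ler_normB _ _))// lerD// /S mulr_suml.
  rewrite (le_trans (ler_norm_sum _ _ _))// ler_sum// => k _.
  rewrite -mulrA normrM ler_wpM2l//.
  by have [_ _] := laplace_fracconv (half01 0) (lapG k (half01 0)); exact.
have phic : {ae mu, forall u, {for u, continuous phi}}.
  exists [set (0 : R)]; split=> //; first exact: lebesgue_measure_set1.
  move=> u /= nc; apply: contrapT => /eqP u0; apply: nc.
  apply: cvgM; first by apply: cvgB; [exact: negative_half_continuous|exact: cS].
  by apply: continuous_comp; [exact: mulrl_continuous|exact: continuous_expR].
have [M phiM] := phib.
have := plancherel_le hconv phiM phic.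
rewrite (_ : (\int[mu]_t (fnorm2 _ t)%:E)%E =
    (\int[mu]_t (normc ((line t)^-1 - ceval Q (line t) * F t) ^+ 2)%:E)%E); last first.
  by apply: eq_integral => t _; rewrite -normc2_laplace_line -laplace_shift lE.
rewrite ge0_integral_expR_in; last 2 first.
- apply: measurable_funX; apply: measurableT_comp => //; apply: measurable_funB.
    by apply: measurable_funTS; exact: measurable_indic.
  have mS m : measurable_fun (`]0, +oo[ : set R) (fun x => \sum_(k < m) c k * cross (g k) x).
    elim: m => [|m ih].
      rewrite (_ : (fun x : R => _) = cst 0); first exact: measurable_cst.
      by apply/funext => x; rewrite big_ord0.
    rewrite (_ : (fun x : R => _) = fun x => \sum_(k < m) c k * cross (g k) x + c m * cross (g m) x); last first.
      by apply/funext => x; rewrite big_ord_recr.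
    by apply: measurable_funD => //; apply: measurable_funM => //; exact: mcross.
  exact: mS.
- by move=> x _; rewrite sqr_ge0.
rewrite [X in (_ * X <= _)%E -> _](_ : _ = (\int[mu]_u
    ((`| \1_`]0%R, 1%R[ (expR u) - \sum_(k < n) c k * cross (g k) (expR u) | ^+ 2) * expR u)%:E)%E) //.
apply: eq_integral => u _; congr EFin.
rewrite /phi /h exprMn [expR _ ^+ 2]expr2 -expRD real_normK ?num_real// -mulrDl.
rewrite (_ : (2^-1 + 2^-1) * u = u); last by field.
congr ((_ - _) ^+ 2 * _); apply: eq_bigr => k _.
by rewrite -[X in _ = _ * X]/((fun u => cross (g k) (expR u)) u) cross_log.
Qed.

(** A polynomial of size at most n + 1 is a combination of the first n + 1
    elements of Newton's basis, so a good approximant serves for all large n. *)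
Lemma gNB_of_decay : (exists x : R, 0 < x /\ g0 x != 0) ->
  (exists delta : R, 0 < delta /\ exists C : R, forall t : R,
      normc (mellin g0 (Complex (2^-1) t)) <= C * expR (- delta * `|t|)) ->
  gNB g.
Proof.
move=> g0_neq0 [delta [delta0 [C hC]]].
have [K K0 hK] := laplace_line_bound lfr.
have F_decay t : normc (F t) <= (K * C) * expR (- (delta * `|t|)).
  rewrite /F normcM -mulrA ler_pM ?normc_ge0//.
  by have := hC t; rewrite (mellin_laplace _ (mg 0)) mulNr.
have [c1 c2] := cF; have F0 := transform_neq0_ae g0_neq0.
pose E n (c : nat -> R) := (\int[mu]_(x in `]0%R, +oo[)
     (`| \1_`]0%R, 1%R[ x - \sum_(k < n.+1) c k * cross (g k) x | ^+ 2)%:E)%E.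
have [||c hc] := @cvg_near_optimal R (nat -> R) (fun=> 0) E.
- by move=> n c; apply: integral_ge0 => x _; rewrite lee_fin sqr_ge0.
- move=> e e0; have pi2 : 0 < 2 * pi :> R by rewrite mulr_gt0 ?pi_gt0.
  have [Q hQ] := inverse_approx delta0 c1 c2 F_conj F_decay F0 (mulr_gt0 pi2 e0).
  exists (size Q) => n Qn; have [c Qc] := newton_expansion r (leqW Qn).
  exists c; have := le_trans (approximation_error Qc) hQ.
  by rewrite [(2 * pi * e)%:E]EFinM lee_pmul2l.
by exists (fun k n => c n k).
Qed.

End CriticalTransform.

Theorem theorem6 (R : realType) (r : nat -> R) (g0 : R -> R) (alpha : R)
  (g0_smooth : smooth_pos g0)
  (alpha_gt0 : 0 < alpha)
  (g0_at0 : forall k : nat,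
     (fun x : R => x `^ (k%:R - alpha) * derive1n k g0 x) @ 0^'+ --> (0 : R))
  (g0_atoo : forall k : nat,
     (fun x : R => x `^ (k%:R + 1 + alpha) * derive1n k g0 x) @ +oo
       --> (0 : R)) :
  (forall (k : nat) (s : R[i]), 0 < complex.Re s < 1 ->
     mellin_defined (cross (gseq r g0 k)) s /\
     mellin (cross (gseq r g0 k)) s =
       - ((\prod_(j < k) (s - real_complex R (r j))) * (zeta s / s)
            * mellin g0 s)) /\
  ((exists x : R, 0 < x /\ g0 x != 0) ->
   (exists delta : R, 0 < delta /\ exists C : R, forall t : R,
      normc (mellin g0 (Complex (2^-1) t))
        <= C * expR (- delta * `|t|)) ->
   gNB (gseq r g0)).
Proof.
split=> [k s|g0_neq0 decay].
  exact: (mellin_cross _ g0_smooth alpha_gt0 g0_at0 g0_atoo).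
exact: (gNB_of_decay r g0_smooth alpha_gt0 g0_at0 g0_atoo).
Qed.
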